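(* Taking the orienting double, $K\mapsto K_{\mathbf O}$, gives an equivalence of categories $\mathbf{dnKlein}\to\mathbf{dnSymRiem}$.
   Context: **Surfaces.** Surfaces are compact, connected (unless otherwise stated) and may have boundary. $\mathbb C^+$ is the closed upper half plane. A map between subsets of $\mathbb C^+$ is (anti-)analytic if it extends to an (anti-)analytic map on an open neighbourhood, and dianalytic if it is analytic or anti-analytic on each component. Let $B=\{(x,y)\in(\mathbb C^+)^2: xy=0\}$ and $I=\{(x,y)\in\mathbb C^2: xy=0\}$. A nodal surface $(X,N)$ is a Hausdorff space with finite $N\subset X$, $X\setminus N$ a topological surface, each point of $N$ having a neighbourhood modelled on a neighbourhood of the origin in $B$ (boundary node) or $I$ (interior node). Maps between open subsets of $B$ (or $I$) are (anti-)analytic if they are so away from the origin, and dianalytic if on each connected component they are analytic or anti-analytic (so on a connected neighbourhood of the origin both branches are treated alike). A nodal Riemann (resp. Klein) surface is a nodal surface with a maximal analytic (resp. dianalytic) atlas, including charts at the nodes. Irreducible components are the connected components after pulling apart all nodes. **Klein side.** A Klein surface with $n$ oriented marked points is a nodal Klein surface with an ordered $n$-tuple $(p_1,\dots,p_n)$ of distinct non-nodal points and a choice of local orientation at each $p_i$. $\mathbf{dnKlein}$ has as objects nodal Klein surfaces all of whose nodes are boundary nodes, with oriented marked points on the boundary; its morphisms are the dianalytic morphisms, i.e. non-constant continuous maps, dianalytic on all charts (including at nodes), mapping boundary to boundary, with $f(p_i)=p_i'$ and compatible with the chosen local orientations. **Symmetric Riemann side.** A nodal symmetric Riemann surface $(X,\sigma)$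 is a nodal Riemann surface, possibly with boundary, with an antiholomorphic involution $\sigma$; $X$ may be disconnected provided $X/\sigma$ is connected. With $q\colon X\to X/\sigma$ the quotient, $(X,\sigma)$ is admissible if $q$ maps each node to a boundary node, and is dianalytic if moreover $q$ is a dianalytic morphism onto the quotient nodal Klein surface (in particular $q^{-1}(\partial(X/\sigma))=\partial X$ and $X$ has only boundary nodes). A marked symmetric Riemann surface with $(m,n)$ marked points has a $2m$-tuple $(p_1,\dots,p_{2m})$ of distinct non-nodal points with $\sigma(p_i)=p_{m+i}$ and an $n$-tuple of distinct non-nodal $\sigma$-fixed points; admissibility also requires the images of all marked points to lie in the boundary of the quotient (a dianalytic one therefore has marked points only on its boundary). $\mathbf{dnSymRiem}$ has as objects dianalytic marked symmetric Riemann surfaces; morphisms are non-constant continuous maps, analytic on all charts (including at nodes), commuting with the involutions and preserving the marked points in order. **Orienting double.** For a non-singular Klein surface $K$, $f\colon K_{\mathbf O}\to K$ is the double cover by a Riemann surface with $f^{-1}(\partial K)=\partial K_{\mathbf O}$ carrying an antiholomorphic involution $\sigma$ with $f\sigma=f$; it is unique up to unique isomorphism, unramified, and disconnected iff $K$ is orientable. For an object of $\mathbf{dnKlein}$ it is formed on each irreducible component and glued in the canonical way determined by the dianalytic structure at the nodes. For each $i$, $q_i\in f^{-1}(p_i)$ is the point at which $f$ preserves the local orientations; the marked points of $K_{\mathbf O}$ are $(q_1,\dots,q_n,\sigma(q_1),\dots,\sigma(q_n))$, with no $\sigma$-fixed marked points.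
   Formalization: In both categories ''non-constant'' is taken as non-constant on every irreducible component, and morphisms of dnSymRiem are also required to map boundary to boundary; without these conditions the orienting double is not defined on all morphisms, respectively not full. *)

(* Defs.v *)
From HB Require Import structures.
From mathcomp Require Import all_boot all_order all_algebra.
From mathcomp Require Import complex.
From mathcomp Require Import all_classical all_reals all_analysis.

Set Implicit Arguments.
Unset Strict Implicit.
Unset Printing Implicit Defensive.

Import Order.TTheory GRing.Theory Num.Theory.
Import numFieldNormedType.Exports.

Local Open Scope classical_set_scope.
Local Open Scope ring_scope.

(** * Analytic maps between the local models *)

(* The complex numbers with their usual topology: seeing R[i] as a
   numClosedFieldType selects the topological and normed structures of
   mathcomp-analysis. *)
Definition Cplx (R : realType) : numClosedFieldType := R[i].

Section LocalModels.
Variable R : realType.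
Local Notation C := (Cplx R).
Implicit Types (D W : set C) (S : set (C * C)).

Definition holomorphic_on W (g : C -> C) :=
  forall z, W z -> derivable (g : C^o -> C^o) z 1.

Definition analytic_on D (g : C -> C) :=
  exists (W : set C) (G : C -> C),
    [/\ open W, D `<=` W, holomorphic_on W G & {in D, G =1 g}].

(* All local models are realised in C * C, the closed upper half plane being
   the half-line Im >= 0 of the first axis. *)
Inductive point_kind := Smooth | BoundaryNode | InteriorNode.

Definition model (k : point_kind) : set (C * C) :=
  match k with
  | Smooth => [set z | 0 <= 'Im z.1 /\ z.2 = 0]
  | BoundaryNode => [set z | [/\ 0 <= 'Im z.1, 0 <= 'Im z.2 & z.1 * z.2 = 0]]
  | InteriorNode => [set z | z.1 * z.2 = 0]
  end.

Definition model_boundary (k : point_kind) : set (C * C) :=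
  match k with
  | InteriorNode => set0
  | k => model k `&` [set z | 'Im z.1 = 0 /\ 'Im z.2 = 0]
  end.

(* In a nodal model nothing is required at the origin. *)
Definition regular_part (k : point_kind) S : set (C * C) :=
  match k with
  | Smooth => S
  | _ => S `\ (0, 0)
  end.

(* Analyticity is tested on each axis and on each target coordinate. For the
   smooth model the second axis meets S in at most the origin, so that its
   clause is void. *)
Definition analytic (k : point_kind) S (g : C * C -> C * C) :=
  [/\ analytic_on [set t | regular_part k S (t, 0)] (fun t => (g (t, 0)).1),
      analytic_on [set t | regular_part k S (t, 0)] (fun t => (g (t, 0)).2),
      analytic_on [set t | regular_part k S (0, t)] (fun t => (g (0, t)).1) &
      analytic_on [set t | regular_part k S (0, t)] (fun t => (g (0, t)).2)].

Definition conj2 (z : C * C) : C * C := (z.1^*, z.2^*).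

Definition antianalytic (k : point_kind) S (g : C * C -> C * C) :=
  analytic k S (conj2 \o g).

(* The components are those of S with its origin: near a node both branches
   lie in the same component, hence are treated alike. *)
Definition dianalytic (k : point_kind) S (g : C * C -> C * C) :=
  forall z, S z -> analytic k (connected_component S z) g \/
                   antianalytic k (connected_component S z) g.

(** * Charts and nodal surfaces *)

(* chart_map and chart_inv are total; only their values on the domain and on
   its image are meaningful. *)
Record chart (X : topologicalType) := Chart {
  chart_kind : point_kind;
  chart_dom : set X;
  chart_map : X -> C * C;
  chart_inv : C * C -> X }.

Definition is_chart (X : topologicalType) (N : set X) (phi : chart X) :=
  [/\ open (chart_dom phi) /\
        (exists2 V : set (C * C), open V &
           chart_map phi @` chart_dom phi = V `&` model (chart_kind phi)),
      {within chart_dom phi, continuous (chart_map phi)},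
      {within chart_map phi @` chart_dom phi, continuous (chart_inv phi)},
      {in chart_dom phi, cancel (chart_map phi) (chart_inv phi)} &
      match chart_kind phi with
      | Smooth => chart_dom phi `&` N = set0
      | _ => exists p, chart_map phi p = (0, 0) /\ chart_dom phi `&` N = [set p]
      end].

(* The domain and the expression of f in the charts phi and psi. *)
Definition local_dom (X Y : topologicalType) (phi : chart X) (psi : chart Y)
    (f : X -> Y) : set (C * C) :=
  chart_map phi @` (chart_dom phi `&` f @^-1` chart_dom psi).

Definition local_expr (X Y : topologicalType) (phi : chart X) (psi : chart Y)
    (f : X -> Y) : C * C -> C * C :=
  chart_map psi \o f \o chart_inv phi.

Definition in_charts
    (P : point_kind -> set (C * C) -> (C * C -> C * C) -> Prop)
    (X Y : topologicalType) (A : set (chart X)) (B : set (chart Y))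
    (f : X -> Y) :=
  forall phi psi, A phi -> B psi ->
    P (chart_kind phi) (local_dom phi psi f) (local_expr phi psi f).

(* f is analytic in the charts phi and psi on some neighbourhood of p. *)
Definition analytic_near (X Y : topologicalType) (phi : chart X)
    (psi : chart Y) (f : X -> Y) (p : X) :=
  exists U : set X,
    [/\ open U, U p, U `<=` chart_dom phi `&` f @^-1` chart_dom psi &
        analytic (chart_kind phi) (chart_map phi @` U) (local_expr phi psi f)].

Record nodal_data := NodalData {
  points :> topologicalType;
  nodes : set points;
  atlas : set (chart points) }.

Arguments nodes : clear implicits.
Arguments atlas : clear implicits.

(* A compact nodal surface with a maximal P-atlas. *)
Definition nodal_surface
    (P : point_kind -> set (C * C) -> (C * C -> C * C) -> Prop)
    (X : nodal_data) :=
  [/\ hausdorff_space (points X), compact [set: points X] & finite_set (nodes X)] /\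
  [/\ atlas X `<=` is_chart (nodes X),
      forall p : X, exists2 phi, atlas X phi & chart_dom phi p,
      in_charts P (atlas X) (atlas X) idfun &
      forall phi, is_chart (nodes X) phi ->
        in_charts P [set phi] (atlas X) idfun ->
        in_charts P (atlas X) [set phi] idfun -> atlas X phi].

Definition nodal_riemann := nodal_surface analytic.
Definition nodal_klein := nodal_surface dianalytic.

Definition connected_surface (X : nodal_data) :=
  [set: points X] !=set0 /\ connected [set: points X].

Definition boundary (X : nodal_data) : set X :=
  [set p | exists phi, [/\ atlas X phi, chart_dom phi p &
                           model_boundary (chart_kind phi) (chart_map phi p)]].

Arguments boundary : clear implicits.

Definition boundary_node (X : nodal_data) (p : X) :=
  nodes X p /\
  exists phi, [/\ atlas X phi, chart_dom phi p & chart_kind phi = BoundaryNode].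

(** * Morphisms *)

(* The irreducible components, deprived of the nodes, are the connected
   components of the complement of the nodes. Constancy has to be excluded on
   each of them: a map that is constant on one component only need not lift to
   the orienting doubles. *)
Definition nonconstant (X Y : nodal_data) (f : X -> Y) :=
  forall x, ~ nodes X x ->
    exists2 y, connected_component (~` nodes X) x y & f y <> f x.

Definition surface_morphism
    (P : point_kind -> set (C * C) -> (C * C -> C * C) -> Prop)
    (X Y : nodal_data) (f : X -> Y) :=
  [/\ continuous f, nonconstant f, f @` boundary X `<=` boundary Y &
      in_charts P (atlas X) (atlas Y) f].

Definition analytic_morphism := surface_morphism analytic.
Definition dianalytic_morphism := surface_morphism dianalytic.

Definition charts_at (X : nodal_data) (p : X) : set (chart X) :=
  [set phi | atlas X phi /\ chart_dom phi p].

(* A local orientation at p is encoded by the set of all charts at p inducing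
   it: a class for the relation "the transition map is analytic near p". *)
Definition local_orientation (X : nodal_data) (p : X) (o : set (chart X)) :=
  exists2 phi, charts_at p phi &
    o = charts_at p `&` [set psi | analytic_near phi psi idfun p].

Definition preserves_orientation (X Y : nodal_data) (f : X -> Y) (p : X)
    (o : set (chart X)) (o' : set (chart Y)) :=
  forall phi psi, o phi -> o' psi -> analytic_near phi psi f p.

(** * The objects of dnKlein *)

Record klein_obj := KleinObj {
  klein_surf :> nodal_data;
  klein_pts : nat;
  klein_pt : 'I_klein_pts -> klein_surf;
  klein_or : 'I_klein_pts -> set (chart klein_surf);
  kleinP : nodal_klein klein_surf;
  klein_connected : connected_surface klein_surf;
  klein_nodes : forall p, nodes klein_surf p -> boundary_node p;
  klein_pt_inj : injective klein_pt;
  klein_pt_nonnodal : forall i, ~ nodes klein_surf (klein_pt i);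
  klein_pt_boundary : forall i, boundary klein_surf (klein_pt i);
  klein_orP : forall i, local_orientation (klein_pt i) (klein_or i) }.

Definition klein_hom (K L : klein_obj) (f : K -> L) :=
  dianalytic_morphism f /\
  exists e : klein_pts K = klein_pts L, forall i,
    f (klein_pt i) = klein_pt (cast_ord e i) /\
    preserves_orientation f (klein_pt i) (klein_or i) (klein_or (cast_ord e i)).

(** * The objects of dnSymRiem *)

Section OrbitSpace.
Local Open Scope quotient_scope.
Variables (X : topologicalType) (s : X -> X).
Hypothesis sK : involutive s.

Definition orbit_rel (x y : X) := (x == y) || (x == s y).

Lemma orbit_rel_refl : reflexive orbit_rel.
Proof. by move=> x; rewrite /orbit_rel eqxx. Qed.

Lemma orbit_rel_sym : symmetric orbit_rel.
Proof.
by move=> x y; rewrite /orbit_rel (eq_sym y x) -(inv_eq sK) (eq_sym (s x)).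
Qed.

Lemma orbit_rel_trans : transitive orbit_rel.
Proof.
move=> y x z; rewrite /orbit_rel => /orP[/eqP-> //|/eqP->] /orP[/eqP->|/eqP->].
  by rewrite eqxx orbT.
by rewrite sK eqxx.
Qed.

Definition orbit_equiv :=
  EquivRel orbit_rel orbit_rel_refl orbit_rel_sym orbit_rel_trans.

Definition orbit_space : topologicalType :=
  quotient_topology {eq_quot orbit_equiv}.

Definition orbit_map : X -> orbit_space :=
  fun x => \pi_({eq_quot orbit_equiv}) x.

End OrbitSpace.

(* A Klein structure on the orbit space for which the quotient map is a
   dianalytic morphism is the quotient structure. *)
Record symriem_obj := SymRiemObj {
  sym_surf :> nodal_data;
  sym_inv : sym_surf -> sym_surf;
  sym_free : nat;
  sym_fixed : nat;
  sym_free_pt : 'I_(sym_free + sym_free) -> sym_surf;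
  sym_fixed_pt : 'I_sym_fixed -> sym_surf;
  symP : nodal_riemann sym_surf;
  sym_invK : involutive sym_inv;
  sym_inv_continuous : continuous sym_inv;
  sym_inv_antianalytic :
    in_charts antianalytic (atlas sym_surf) (atlas sym_surf) sym_inv;
  sym_free_pt_inj : injective sym_free_pt;
  sym_free_pt_inv : forall i : 'I_sym_free,
    sym_inv (sym_free_pt (lshift _ i)) = sym_free_pt (rshift _ i);
  sym_free_pt_nonnodal : forall i, ~ nodes sym_surf (sym_free_pt i);
  sym_fixed_pt_inj : injective sym_fixed_pt;
  sym_fixed_pt_inv : forall i, sym_inv (sym_fixed_pt i) = sym_fixed_pt i;
  sym_fixed_pt_nonnodal : forall i, ~ nodes sym_surf (sym_fixed_pt i);
  sym_dianalytic :
    exists (N : set (orbit_space sym_invK))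
           (A : set (chart (orbit_space sym_invK))),
      let Q := NodalData N A in
      let q : sym_surf -> Q := @orbit_map sym_surf sym_inv sym_invK in
      [/\ nodal_klein Q /\ connected_surface Q,
          dianalytic_morphism q,
          forall p, nodes sym_surf p -> boundary_node (q p),
          forall i, boundary Q (q (sym_free_pt i)) &
          forall i, boundary Q (q (sym_fixed_pt i))] }.

Definition symriem_hom (X Y : symriem_obj) (f : X -> Y) :=
  [/\ analytic_morphism f,
      forall x, f (sym_inv x) = sym_inv (f x),
      (exists e : (sym_free X + sym_free X = sym_free Y + sym_free Y)%N,
         forall i, f (sym_free_pt i) = sym_free_pt (cast_ord e i)) &
      (exists e : sym_fixed X = sym_fixed Y,
         forall i, f (sym_fixed_pt i) = sym_fixed_pt (cast_ord e i))].

(** * The orienting double *)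

Definition homeo_on (X Y : topologicalType) (V : set X) (U : set Y)
    (f : X -> Y) :=
  {within V, continuous f} /\
  exists g : Y -> X,
    [/\ {within U, continuous g}, f @` V `<=` U, g @` U `<=` V,
        {in V, cancel f g} & {in U, cancel g f}].

Definition double_cover (X Y : topologicalType) (f : X -> Y) :=
  continuous f /\
  forall p : Y, exists (U : set Y) (V W : set X),
    [/\ open U /\ U p, open V /\ open W, V `&` W = set0,
        f @^-1` U = V `|` W & homeo_on V U f /\ homeo_on W U f].

(* The dianalyticity of f at the nodes is what prescribes the gluing of the
   orienting doubles of the irreducible components. *)
Definition orienting_double (K : klein_obj) (X : symriem_obj) (f : X -> K) :=
  [/\ dianalytic_morphism f /\ double_cover f,
      f @^-1` boundary K = boundary X,
      f @^-1` nodes K = nodes X,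
      forall x, f (sym_inv x) = f x &
      sym_fixed X = 0%N /\
      exists e : klein_pts K = sym_free X, forall i,
        let q := sym_free_pt (lshift _ (cast_ord e i)) in
        f q = klein_pt i /\
        preserves_orientation f q (charts_at q) (klein_or i)].

End LocalModels.

(** * Categories of structured sets *)

(* Objects have underlying types, morphisms are the functions satisfying hom,
   and composition is that of functions. *)
Record category_data := CategoryData {
  ob :> Type;
  under : ob -> Type;
  hom : forall A B : ob, (under A -> under B) -> Prop }.

Definition is_category (D : category_data) :=
  (forall A : D, hom (idfun : under A -> under A)) /\
  (forall (A B E : D) (f : under A -> under B) (g : under B -> under E),
     hom f -> hom g -> hom (g \o f)).

Definition mor (D : category_data) (A B : D) :=
  {f : under A -> under B | hom f}.

Definition fn (D : category_data) (A B : D) (f : mor A B) :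
  under A -> under B := sval f.

(* The laws are stated relationally, so as not to mention proofs that
   identities and composites are morphisms. *)
Record functor (D E : category_data) := Functor {
  fobj :> D -> E;
  fmap : forall A B : D, mor A B -> mor (fobj A) (fobj B);
  fmap_id : forall (A : D) (i : mor A A), fn i = idfun -> fn (fmap i) = idfun;
  fmap_comp : forall (A B C : D) (f : mor A B) (g : mor B C) (h : mor A C),
    fn h = fn g \o fn f -> fn (fmap h) = fn (fmap g) \o fn (fmap f) }.

Definition id_functor (D : category_data) : functor D D :=
  @Functor D D id (fun A B f => f) (fun A i e => e)
    (fun A B C f g h e => e).

Definition comp_functor (D E H : category_data) (G : functor E H)
    (F : functor D E) : functor D H :=
  @Functor D H (G \o F) (fun A B f => fmap G (fmap F f))
    (fun A i e => fmap_id G (fmap_id F e))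
    (fun A B C f g h e => fmap_comp G (fmap_comp F e)).

Definition is_iso (D : category_data) (A B : D) (f : mor A B) :=
  exists g : mor B A, fn g \o fn f = idfun /\ fn f \o fn g = idfun.

Definition naturally_isomorphic (D E : category_data) (F G : functor D E) :=
  exists eta : forall A : D, mor (F A) (G A),
    (forall A, is_iso (eta A)) /\
    (forall (A B : D) (f : mor A B),
       fn (eta B) \o fn (fmap F f) = fn (fmap G f) \o fn (eta A)).

Definition is_equivalence (D E : category_data) (F : functor D E) :=
  exists G : functor E D,
    naturally_isomorphic (id_functor D) (comp_functor G F) /\
    naturally_isomorphic (comp_functor F G) (id_functor E).

Definition dnKlein (R : realType) : category_data :=
  @CategoryData (klein_obj R) (fun K => points K) (@klein_hom R).

Definition dnSymRiem (R : realType) : category_data :=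
  @CategoryData (symriem_obj R) (fun X => points X) (@symriem_hom R).

(* F sends K to an orienting double of K, with covering map f K, and a morphism
   to its lift along the covering maps. *)
Definition orienting_double_functor (R : realType)
    (F : functor (dnKlein R) (dnSymRiem R))
    (f : forall K : dnKlein R, under (F K) -> under K) :=
  (forall K, orienting_double (f K)) /\
  (forall (K L : dnKlein R) (g : mor K L),
     f L \o fn (fmap F g) = fn g \o f K).

(* Main.v *)
(* On a nodal surface every dianalytic map is, near each point, either analytic
   or antianalytic with respect to given charts, and never both: this sign is a
   local orientation character. A dianalytic map from a Riemann surface Y to K
   therefore lifts uniquely to an analytic map into an orienting double f of K:
   over h y there are two points, exchanged by the involution, and exactly one
   at which f has the sign of h at y. Conversely an equivariant map between
   orienting doubles descends, since f is a local homeomorphism whose local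
   sections have the signs of f. Together this makes the functor fully faithful.
   An admissible involution has no fixed points, as q \o sigma = q would give q
   both signs there, so X -> X / sigma is an orienting double and the functor is
   essentially surjective. Orienting doubles exist: K_O is the set of pairs
   (point, local orientation), topologised by the charts of K.

   The analysis needed is local: signs are exclusive because an analytic and
   antianalytic function is constant, the boundary is a dianalytic notion by the
   minimum principle for the imaginary part, signs compose at points sent to
   nodes by Riemann's removability theorem, and local sections are analytic up
   to the boundary by the reflection principle. *)

From HB Require Import structures.
From mathcomp Require Import all_boot all_order all_algebra.
From mathcomp Require Import complex.
From mathcomp Require Import all_classical all_reals all_analysis.
From mathcomp Require Import ring lra.
Require Import Defs.

Set Implicit Arguments.
Unset Strict Implicit.
Unset Printing Implicit Defensive.

Import Order.TTheory GRing.Theory Num.Theory.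
Import numFieldNormedType.Exports.

Local Open Scope classical_set_scope.
Local Open Scope ring_scope.

(** * Complex differentiability *)

Section ComplexBasics.
Variable R : realType.
Local Notation C := (Cplx R).
Implicit Types (z w : C) (g h : C -> C).

(** Nothing is required of a nodal map at a node, so the sign of a map at a point is tested only at
    the nearby non-nodal points ([signed_at]), each of which is read through one scalar coordinate
    in a plane or half-plane. The obstacle is composition: [f] may send a smooth point to a node,
    where the sign of [g] is not tested. Such points are isolated and the singularity of [g \o f]
    there is removed; at a boundary point this takes a reflection, which is possible because
    morphisms map boundary to boundary. The function theory rests on Goursat's lemma for rectangles,
    whose sides are parametrised by real intervals. The Cauchy formula is kept in the form
    [T f z = f z * kap z]: the factor [kap], which stands for 2 i pi, is nonzero near the centre by
    a direct estimate and is divided out there. The place of power series is taken by repeated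
    division by [w - z], combined with bounds on the boundary of one fixed square. *)

Definition cabs z : R := Normc.normc z.
Definition cre z : R := complex.Re z.
Definition cim z : R := complex.Im z.
Definition cR (t : R) : C := (t%:C)%C.
Definition cI : C := ('i)%C.

Lemma normE z : `|z| = cR (cabs z).
Proof. by []. Qed.

Lemma cabs_ge0 z : 0 <= cabs z.
Proof. rewrite -(@lecR R); exact: (@normr_ge0 C C z). Qed.

Lemma cabs0 : cabs 0 = 0.
Proof. exact: Normc.normc0. Qed.

Lemma cabs1 : cabs 1 = 1.
Proof. exact: Normc.normc1. Qed.

Lemma cabs_eq0 z : (cabs z == 0) = (z == 0).
Proof.
by apply/eqP/eqP => [/Normc.eq0_normc //|->]; exact: cabs0.
Qed.

Lemma cabs_gt0 z : (0 < cabs z) = (z != 0).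
Proof. by rewrite lt_def cabs_eq0 cabs_ge0 andbT. Qed.

Lemma cabsM z w : cabs (z * w) = cabs z * cabs w.
Proof. exact: Normc.normcM. Qed.

Lemma cabsV z : cabs z^-1 = (cabs z)^-1.
Proof. exact: Normc.normcV. Qed.

Lemma cabsX z n : cabs (z ^+ n) = cabs z ^+ n.
Proof. by elim: n => [|n IH]; rewrite ?expr0 ?cabs1 // !exprS cabsM IH. Qed.

Lemma cabsD z w : cabs (z + w) <= cabs z + cabs w.
Proof. exact: le_normcD. Qed.

Lemma cabsN z : cabs (- z) = cabs z.
Proof. exact: normcN. Qed.

Lemma cabsB z w : cabs (z - w) = cabs (w - z).
Proof. by rewrite -cabsN opprB. Qed.

Lemma cabs_dist z w x : cabs (z - w) <= cabs (z - x) + cabs (x - w).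
Proof. by apply: le_trans (cabsD _ _); rewrite addrA subrK. Qed.

Lemma cReIm z : z = cR (cre z) + cI * cR (cim z).
Proof. exact: complexE. Qed.

Lemma cre_le z : `|cre z| <= cabs z.
Proof. by rewrite -(@lecR R); exact: normc_ge_Re. Qed.

Lemma creD z w : cre (z + w) = cre z + cre w.
Proof. by case: z w => a b [c d]. Qed.
Lemma cimD z w : cim (z + w) = cim z + cim w.
Proof. by case: z w => a b [c d]. Qed.
Lemma creN z : cre (- z) = - cre z.
Proof. by case: z. Qed.
Lemma cimN z : cim (- z) = - cim z.
Proof. by case: z. Qed.
Lemma creM z w : cre (z * w) = cre z * cre w - cim z * cim w.
Proof. by case: z w => a b [c d]. Qed.
Lemma cimM z w : cim (z * w) = cre z * cim w + cim z * cre w.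
Proof. by case: z w => a b [c d]. Qed.
Lemma creR t : cre (cR t) = t. Proof. by []. Qed.
Lemma cimR t : cim (cR t) = 0. Proof. by []. Qed.
Lemma creI : cre cI = 0. Proof. by []. Qed.
Lemma cimI : cim cI = 1. Proof. by []. Qed.
Lemma cRD s t : cR (s + t) = cR s + cR t.
Proof. exact: rmorphD. Qed.
Lemma cRN t : cR (- t) = - cR t.
Proof. exact: rmorphN. Qed.
Lemma cRM s t : cR (s * t) = cR s * cR t.
Proof. exact: rmorphM. Qed.
Lemma cR1 : cR 1 = 1. Proof. by []. Qed.
Lemma cI2 : cI * cI = -1.
Proof. by rewrite -expr2; exact: sqr_i. Qed.

Definition cE := (creD, cimD, creN, cimN, creM, cimM, creR, cimR, creI, cimI).

Lemma ceqP z w : cre z = cre w -> cim z = cim w -> z = w.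
Proof. by case: z w => a b [c d] /= -> ->. Qed.

Lemma cim_le z : `|cim z| <= cabs z.
Proof.
have := cre_le (cI * z); rewrite !cE cabsM mul0r mul1r sub0r normrN.
by rewrite (_ : cabs cI = 1) ?mul1r // /cabs/= expr0n expr1n add0r sqrtr1.
Qed.

Lemma cabs_cR t : cabs (cR t) = `|t|.
Proof. by rewrite /cabs /= expr0n addr0 sqrtr_sqr. Qed.

Lemma cabs_cI : cabs cI = 1.
Proof. by rewrite /cabs/= expr0n expr1n add0r sqrtr1. Qed.

Lemma cabs_le z : cabs z <= `|cre z| + `|cim z|.
Proof.
by rewrite {1}(cReIm z); apply: le_trans (cabsD _ _) _; rewrite cabsM cabs_cI mul1r !cabs_cR.
Qed.

Lemma cabs_lt_re z e : cabs z < e -> `|cre z| < e.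
Proof. exact: le_lt_trans (cre_le z). Qed.
Lemma cabs_lt_im z e : cabs z < e -> `|cim z| < e.
Proof. exact: le_lt_trans (cim_le z). Qed.

Definition cj z : C := z^*%C.

Lemma cre_cj z : cre (cj z) = cre z. Proof. by case: z. Qed.
Lemma cim_cj z : cim (cj z) = - cim z. Proof. by case: z. Qed.
Lemma cjK : involutive cj. Proof. exact: conjcK. Qed.
Lemma cjD z w : cj (z + w) = cj z + cj w. Proof. exact: rmorphD. Qed.
Lemma cjN z : cj (- z) = - cj z. Proof. exact: rmorphN. Qed.
Lemma cjM z w : cj (z * w) = cj z * cj w. Proof. exact: rmorphM. Qed.
Lemma cj0 : cj 0 = 0. Proof. exact: rmorph0. Qed.
(** The statement conjugates by the operation of a closed numeric field, [cj] by the one on pairs of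
    reals. Both are additive and multiplicative, fix the reals and send [cI] to its opposite. *)
Lemma cjE z : (z^*)%R = cj z.
Proof.
rewrite [in LHS](cReIm z) rmorphD rmorphM /=.
rewrite [(cI : C)^*%R](_ : _ = - cI); last by rewrite -[cI]complexiE conjCi.
rewrite !conj_Creal; try by apply/complex_realP; eexists.
by apply: ceqP; rewrite !cE ?cre_cj ?cim_cj; ring.
Qed.

Lemma cabs_cj z : cabs (cj z) = cabs z.
Proof. by apply: (@complexI R); exact: (@normcJ R z). Qed.

Lemma ImE z : ('Im z)%R = cR (cim z).
Proof. by rewrite -complexIm. Qed.

Lemma Im_ge0 z : (0 <= 'Im z)%R = (0 <= cim z).
Proof. by rewrite ImE -(@lecR R). Qed.

Lemma Im_eq0 z : ('Im z = 0)%R <-> cim z = 0.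
Proof. by rewrite ImE; split => [/(@complexI R)|->]. Qed.

(** Norms and radii live in [C] itself; a positive element of [C] is real, so radii may be taken in
    [R]. *)
Lemma nbhsC z (P : set C) :
  nbhs z P <-> exists2 e : R, 0 < e & forall w, cabs (w - z) < e -> P w.
Proof.
split.
  move=> /nbhs_normP [e /= e0 H]; exists (cre e).
    by move: e0; rewrite ltcE => /andP[].
  move=> w wz; apply: H => /=; rewrite normE cabsB.
  have -> : e = cR (cre e).
    by apply: ceqP; rewrite ?cE //; move: e0; rewrite ltcE => /andP[/eqP].
  by rewrite /cR ltcR.
move=> [e e0 H]; apply/nbhs_normP; exists (cR e).
  by rewrite /= -[0]/(cR 0) /cR ltcR.
by move=> w /=; rewrite normE cabsB /cR ltcR; exact: H.
Qed.

Lemma openC (U : set C) :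
  open U <-> forall z, U z -> exists2 e : R, 0 < e & forall w, cabs (w - z) < e -> U w.
Proof.
by rewrite openE; split => H z Uz; apply/nbhsC; exact: H.
Qed.

Lemma open_cball z (e : R) : open [set w | cabs (w - z) < e].
Proof.
apply/openC => w /= wz; exists (e - cabs (w - z)); first by rewrite subr_gt0.
by move=> x xw; apply: le_lt_trans (cabs_dist _ _ w) _; lra.
Qed.

Lemma nbhs_cball z (e : R) : 0 < e -> nbhs z [set w | cabs (w - z) < e].
Proof. by move=> e0; apply/nbhsC; exists e. Qed.

Lemma cvgC (T : Type) (F : set_system T) (f : T -> C) (l : C) : Filter F ->
  f @ F --> l <-> forall e : R, 0 < e -> \forall t \near F, cabs (f t - l) < e.
Proof.
move=> FF; split=> [H e e0|H A /nbhsC [e e0 eA]].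
  by apply: (H _ (nbhs_cball l e0)).
by apply: filterS (H e e0) => t; exact: eA.
Qed.

Lemma cvgRe (T : Type) (F : set_system T) (h : T -> R) (l : R) :
  Filter F ->
  h @ F --> l <-> forall e : R, 0 < e -> \forall t \near F, `|h t - l| < e.
Proof.
move=> FF; split=> [H e e0|H].
  by move/cvgrPdist_lt : H => /(_ e e0); apply: filterS => t; rewrite distrC.
by apply/cvgrPdist_lt => e e0; apply: filterS (H e e0) => t; rewrite distrC.
Qed.

Lemma cabs_cvg (T : Type) (F : set_system T) (f : T -> C) (l : C) : Filter F ->
  f @ F --> l -> (fun t => cabs (f t)) @ F --> cabs l.
Proof.
move=> FF /cvgC H; apply/cvgRe => // e /H; apply: filterS => t.
apply: le_lt_trans; rewrite ler_norml.
have := cabsD (f t - l) l; have := cabsD (l - f t) (f t).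
rewrite !subrK (cabsB l); lra.
Qed.

Definition cont g z := forall e : R, 0 < e ->
  exists2 d : R, 0 < d & forall w, cabs (w - z) < d -> cabs (g w - g z) < e.

Lemma contP g z : cont g z <-> g @ z --> g z.
Proof.
split=> [H|/cvgC H e e0]; last by have /nbhsC := H _ e0.
by apply/(@cvgC _ (nbhs z)) => e e0; apply/nbhsC; exact: H.
Qed.

Lemma cont_near g z (e : R) : cont g z -> 0 < e ->
  \forall w \near z, cabs (g w - g z) < e.
Proof. by move=> gz e0; apply/nbhsC; exact: gz. Qed.

Lemma cont_eq g h z : (\forall w \near z, g w = h w) -> cont g z -> cont h z.
Proof.
move=> gh gc e e0; have gz := nbhs_singleton gh.
have : \forall w \near z, cabs (h w - h z) < e.
  by near=> w; rewrite -gz -(near gh w) //; near: w; exact: cont_near.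
by move=> /nbhsC.
Unshelve. all: by end_near. Qed.

Lemma cont_cst (c : C) z : cont (fun=> c) z.
Proof. by move=> e e0; exists 1 => // w _; rewrite subrr cabs0. Qed.

Lemma cont_id z : cont id z.
Proof. by move=> e e0; exists e. Qed.

Lemma contD g h z : cont g z -> cont h z -> cont (fun w => g w + h w) z.
Proof.
move=> gc hc e e0; have e2 : 0 < e / 2 by rewrite divr_gt0.
apply/nbhsC; near=> w.
rewrite (_ : _ - _ = (g w - g z) + (h w - h z)); last by ring.
apply: le_lt_trans (cabsD _ _) _; rewrite [ltRHS]splitr ltrD //.
  by near: w; exact: cont_near.
by near: w; exact: cont_near.
Unshelve. all: by end_near. Qed.

Lemma contM g h z : cont g z -> cont h z -> cont (fun w => g w * h w) z.
Proof.
move=> gc hc e e0.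
have M0 : 0 < 1 + cabs (g z) + cabs (h z).
  by have := cabs_ge0 (g z); have := cabs_ge0 (h z); lra.
pose d := Num.min 1 (e / (1 + cabs (g z) + cabs (h z))).
have d0 : 0 < d by rewrite lt_min ltr01 divr_gt0.
have dM : d * (1 + cabs (g z) + cabs (h z)) <= e.
  by rewrite -ler_pdivlMr // ge_min lexx orbT.
have d1 : d <= 1 by rewrite ge_min lexx.
apply/nbhsC; near=> w.
have A : cabs (g w - g z) < d by near: w; exact: cont_near.
have B : cabs (h w - h z) < d by near: w; exact: cont_near.
rewrite (_ : _ - _ = (g w - g z) * (h w - h z) + (g z * (h w - h z) + h z * (g w - g z))); last by ring.
apply: le_lt_trans (cabsD _ _) _.
apply: le_lt_trans (lerD (lexx _) (cabsD _ _)) _; rewrite !cabsM.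
move: A B (cabs_ge0 (g z)) (cabs_ge0 (h z)) (cabs_ge0 (g w - g z)) (cabs_ge0 (h w - h z)).
set a := cabs (g w - g z); set b := cabs (h w - h z) => A B p0 q0 a0 b0.
apply: lt_le_trans dM; nra.
Unshelve. all: by end_near. Qed.

Lemma contN g z : cont g z -> cont (fun w => - g w) z.
Proof. by move=> /contP gz; apply/contP; exact: (@cvgN _ C _ (nbhs z)). Qed.

Lemma contB g h z : cont g z -> cont h z -> cont (fun w => g w - h w) z.
Proof. by move=> ? /contN; exact: contD. Qed.

Lemma contV g z : g z != 0 -> cont g z -> cont (fun w => (g w)^-1) z.
Proof. by move=> g0 /contP gz; apply/contP; exact: (@cvgV C _ (nbhs z)). Qed.

Lemma cont_comp g h z : cont g z -> cont h (g z) -> cont (h \o g) z.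
Proof.
move=> gc hc e /hc[d /gc[d' d'0 H] H']; exists d' => // w /H.
exact: H'.
Qed.

Lemma cont_cj g z : cont g (cj z) -> cont (fun w => cj (g (cj w))) z.
Proof.
move=> gc e /gc[d d0 H]; exists d => // w wz.
by rewrite -cjN -cjD cabs_cj H // -cjN -cjD cabs_cj.
Qed.

Lemma cont_neq0 g z : cont g z -> g z != 0 -> \forall w \near z, g w != 0.
Proof.
move=> gc; rewrite -cabs_gt0 => g0; apply: filterS (cont_near gc g0) => w.
by case: (g w =P 0) => // ->; rewrite sub0r cabsN ltxx.
Qed.

(* Carathéodory's form of complex differentiability. *)
Definition cdiff g z := exists2 p : C -> C, cont p z &
  forall w, g w = g z + p w * (w - z).

Lemma cdiffP g z : cdiff g z <-> derivable (g : C^o -> C^o) z 1.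
Proof.
split.
  move=> [p pc gE]; apply/cvg_ex; exists (p z).
  apply/cvgC => e e0; have [d d0 H] := pc e e0.
  apply/nbhsC; exists d => // h; rewrite subr0 => cdiff h0 /=.
  rewrite gE /GRing.scale /= mulr1 (addrC (g z)) addrK addrK mulrC.
  by rewrite mulfK //; apply: H; rewrite addrK.
move=> /cvg_ex[/= l /cvgC H].
exists (fun w => if w == z then l else (g w - g z) / (w - z)).
  rewrite /cont eqxx => e e0; have /nbhsC[d d0 {}H] := H _ e0.
  exists d => // w wz; case: eqVneq => [_|nwz].
    by rewrite subrr cabs0.
  have := H (w - z); rewrite subr0 subr_eq0 => /(_ wz nwz) /=.
  by rewrite /GRing.scale /= mulr1 subrK mulrC.
move=> w; case: eqVneq => [->|nwz]; first by rewrite subrr mulr0 addr0.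
by rewrite mulfVK ?subr_eq0 // addrC subrK.
Qed.

Lemma cdiff_cont g z : cdiff g z -> cont g z.
Proof.
move=> [p pc gE].
apply: (@cont_eq (fun w => g z + p w * (w - z))); first by near=> w; rewrite -gE.
apply: contD; first exact: cont_cst.
by apply: contM => //; apply: contB; [exact: cont_id|exact: cont_cst].
Unshelve. all: by end_near. Qed.

Lemma cdiff_near g h z : (\forall w \near z, g w = h w) -> cdiff g z -> cdiff h z.
Proof.
move=> gh [p pc gE]; have gz := nbhs_singleton gh.
(* Where the two functions agree the slope of [g] serves [h]; elsewhere the difference quotient
   makes the identity hold for every [w] without affecting continuity at [z]. *)
exists (fun w => if g w == h w then p w else (h w - h z) / (w - z)).
  apply: cont_eq pc; apply: filterS gh => w /= ->.
  by rewrite eqxx.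
move=> w; case: eqP => [<-|ne]; first by rewrite gE gz.
rewrite mulfVK ?subr_eq0; first by rewrite addrC subrK.
by apply/eqP => wz; apply: ne; rewrite wz.
Qed.

Lemma cdiff_cst (c : C) z : cdiff (fun=> c) z.
Proof.
by exists (fun=> 0); [exact: cont_cst | move=> w; rewrite mul0r addr0].
Qed.

Lemma cdiff_id z : cdiff id z.
Proof.
by exists (fun=> 1); [exact: cont_cst | move=> w; rewrite mul1r addrC subrK].
Qed.

Lemma cdiffD g h z : cdiff g z -> cdiff h z -> cdiff (fun w => g w + h w) z.
Proof.
move=> [p pc gE] [q qc hE]; exists (fun w => p w + q w); first exact: contD.
by move=> w; rewrite gE hE; ring.
Qed.

Lemma cdiffM g h z : cdiff g z -> cdiff h z -> cdiff (fun w => g w * h w) z.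
Proof.
move=> gz [q qc hE]; have gc := cdiff_cont gz; case: gz => p pc gE.
exists (fun w => p w * h z + g w * q w).
  by apply: contD; apply: contM => //; exact: cont_cst.
by move=> w; rewrite hE mulrDr {1}gE; ring.
Qed.

Lemma cdiffN g z : cdiff g z -> cdiff (fun w => - g w) z.
Proof.
move=> [p pc gE]; exists (fun w => - p w); first exact: contN.
by move=> w; rewrite gE; ring.
Qed.

Lemma cdiffB g h z : cdiff g z -> cdiff h z -> cdiff (fun w => g w - h w) z.
Proof. by move=> ? /cdiffN; exact: cdiffD. Qed.

Lemma cdiffV g z : g z != 0 -> cdiff g z -> cdiff (fun w => (g w)^-1) z.
Proof.
move=> gz0 gz; have gc := cdiff_cont gz; case: gz => p pc gE.
have gn := cont_neq0 gc gz0.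
(* The slope equation must hold for all [w]. Away from [z], where [g] may vanish, the inverse is
   replaced by the constant [(g z)^-1], with slope 0. *)
suff : cdiff (fun w => if g w == 0 then (g z)^-1 else (g w)^-1) z.
  by apply: cdiff_near; apply: filterS gn => w /negbTE ->.
exists (fun w => if g w == 0 then 0 else - p w / (g w * g z)).
  have : cont (fun w => - p w / (g w * g z)) z.
    apply: contM; first exact: contN.
    by apply: contV; [rewrite mulf_neq0|apply: contM => //; exact: cont_cst].
  by apply: cont_eq; apply: filterS gn => w /negbTE ->.
move=> w; rewrite (negbTE gz0); case: eqVneq => [|gw0].
  by rewrite mul0r addr0.
have wE : p w * (w - z) = g w - g z by rewrite (gE w); ring.
rewrite mulrAC mulNr wE; field.
by rewrite gz0.
Qed.

Lemma cdiff_comp g h z : cdiff g z -> cdiff h (g z) -> cdiff (h \o g) z.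
Proof.
move=> gz [q qc hE]; have gc := cdiff_cont gz; case: gz => p pc gE.
exists (fun w => q (g w) * p w).
  by apply: contM => //; apply: (@cont_comp g q).
by move=> w; rewrite /= hE [in X in _ + _ * X]gE; ring.
Qed.

Lemma cdiff_cj g z : cdiff g (cj z) -> cdiff (fun w => cj (g (cj w))) z.
Proof.
move=> [p pc gE]; exists (fun w => cj (p (cj w))); first exact: cont_cj.
by move=> w; rewrite gE cjD cjM (cjD (cj w)) cjN !cjK.
Qed.

Lemma cdiff_shift g (c z : C) : cdiff g (z + c) -> cdiff (fun w => g (w + c)) z.
Proof.
move=> H; apply: (@cdiff_comp (fun w => w + c)) => //.
by apply: cdiffD; [exact: cdiff_id|exact: cdiff_cst].
Qed.

End ComplexBasics.

(** * Integrals along rectangles *)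

Section RectangleIntegrals.
Variable R : realType.
Local Notation C := (Cplx R).
Local Notation mu := (@lebesgue_measure R).
Implicit Types (h : R -> R) (p q : R -> C) (f g : C -> C).

Definition ri h (a b : R) : R := \int[mu]_(x in `[a, b]) h x.

Definition rcon h (a b : R) := forall t, a <= t <= b -> {for t, continuous h}.

Lemma rcon_within h a b : rcon h a b -> {within `[a, b], continuous h}.
Proof.
move=> H; apply: continuous_in_subspaceT => x.
by rewrite inE /= in_itv /=; exact: H.
Qed.

Lemma rcon_integrable h a b : rcon h a b ->
  mu.-integrable `[a, b] (EFin \o h).
Proof.
by move=> /rcon_within; apply: continuous_compact_integrable; exact: segment_compact.
Qed.

Lemma ri_split h a m b : a <= m -> m <= b -> rcon h a b ->
  ri h a b = ri h a m + ri h m b.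
Proof.
move=> am mb /rcon_integrable hi.
have := @Rintegral_itvB R h (BLeft a) (BRight b) m hi.
rewrite !bnd_simp => /(_ am mb) E.
rewrite /ri -(@Rintegral_itv_obnd_cbnd _ m).
  by rewrite -E; ring.
by apply: integrableS hi => //; apply: subset_itv; rewrite bnd_simp.
Qed.

Lemma riD h1 h2 a b : rcon h1 a b -> rcon h2 a b ->
  ri (fun t => h1 t + h2 t) a b = ri h1 a b + ri h2 a b.
Proof. by move=> /rcon_integrable ? /rcon_integrable ?; exact: RintegralD. Qed.

Lemma riZ k h a b : rcon h a b -> ri (fun t => k * h t) a b = k * ri h a b.
Proof. by move=> /rcon_integrable ?; exact: RintegralZl. Qed.

Lemma ri_cst k a b : a <= b -> ri (fun=> k) a b = k * (b - a).
Proof.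
move=> ab; rewrite /ri Rintegral_cst //= lebesgue_measure_itv /= lte_fin.
case: ltP => //= ba; have -> : a = b by lra.
by rewrite subrr.
Qed.

Lemma rcon_cst (k : R) a b : rcon (fun=> k) a b.
Proof. by move=> t _; exact: cvg_cst. Qed.

Lemma ri_le h1 h2 a b : rcon h1 a b -> rcon h2 a b ->
  (forall t, a <= t <= b -> h1 t <= h2 t) -> ri h1 a b <= ri h2 a b.
Proof.
move=> /rcon_integrable i1 /rcon_integrable i2 H.
by apply: le_Rintegral => // x; rewrite /= in_itv /=; exact: H.
Qed.

Lemma ri_bound h a b (M : R) : a <= b -> rcon h a b ->
  (forall t, a <= t <= b -> `|h t| <= M) -> `|ri h a b| <= M * (b - a).
Proof.
move=> ab hc hM; rewrite ler_norml -mulNr -!(ri_cst _ ab).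
by apply/andP; split; apply: ri_le; (try exact: rcon_cst) => // t /hM;
  rewrite ler_norml => /andP[].
Qed.

Lemma ri_id a b : a <= b -> ri id a b = (b - a) * (a + b) / 2.
Proof.
rewrite le_eqVlt => /orP[/eqP->|ab].
  by rewrite /ri set_itv1 Rintegral_set1 subrr !mul0r.
pose F (x : R) : R := 2^-1 * (x * x).
have dF (x : R) : is_derive x (1 : R) (F : R -> R) x.
  apply: is_derive_eq; rewrite /GRing.scale /=.
  by field.
have FE : (F^`())%classic = id by apply/funext => y; rewrite derive1E; exact: derive_val.
rewrite /ri /Rintegral (@continuous_FTC2 R id F a b ab) //=.
- by rewrite /F; field.
- by apply: rcon_within => t _; exact: cvg_id.
- have Fc : continuous (F : R -> R).
    move=> x; apply: differentiable_continuous; apply/derivable1_diffP.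
    exact: ex_derive.
  split; first by move=> x _; exact: ex_derive.
  + exact: cvg_at_right_filter (Fc a).
  + exact: cvg_at_left_filter (Fc b).
- by move=> x _; rewrite FE.
Qed.

Definition rcont p t := forall e : R, 0 < e ->
  exists2 d : R, 0 < d & forall s, `|s - t| < d -> cabs (p s - p t) < e.

Definition pcon p (a b : R) := forall t, a <= t <= b -> rcont p t.

Lemma rcont_re p t : rcont p t -> {for t, continuous (fun s => cre (p s))}.
Proof.
move=> pt; apply/(@cvgrPdist_lt R R) => e /pt[d d0 H]; apply/nbhs_normP; exists d => //= s.
by rewrite /= distrC => /H /cabs_lt_re; rewrite !cE distrC.
Qed.

Lemma rcont_im p t : rcont p t -> {for t, continuous (fun s => cim (p s))}.
Proof.
move=> pt; apply/(@cvgrPdist_lt R R) => e /pt[d d0 H]; apply/nbhs_normP; exists d => //= s.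
by rewrite /= distrC => /H /cabs_lt_im; rewrite !cE distrC.
Qed.

Lemma pcon_re p a b : pcon p a b -> rcon (fun s => cre (p s)) a b.
Proof. by move=> H t /H; exact: rcont_re. Qed.
Lemma pcon_im p a b : pcon p a b -> rcon (fun s => cim (p s)) a b.
Proof. by move=> H t /H; exact: rcont_im. Qed.

Definition cint p (a b : R) : C :=
  cR (ri (fun t => cre (p t)) a b) + cI R * cR (ri (fun t => cim (p t)) a b).

Lemma cint_split p a m b : a <= m -> m <= b -> pcon p a b ->
  cint p a b = cint p a m + cint p m b.
Proof.
move=> am mb pc; rewrite /cint (ri_split am mb (pcon_re pc)).
by rewrite (ri_split am mb (pcon_im pc)) !cRD; ring.
Qed.

Lemma cintD p q a b : pcon p a b -> pcon q a b ->
  cint (fun t => p t + q t) a b = cint p a b + cint q a b.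
Proof.
move=> pc qc; rewrite /cint.
have -> : (fun t => cre (p t + q t)) = (fun t => cre (p t) + cre (q t)).
  by apply/funext => t; rewrite cE.
have -> : (fun t => cim (p t + q t)) = (fun t => cim (p t) + cim (q t)).
  by apply/funext => t; rewrite cE.
rewrite riD; try exact: pcon_re.
by rewrite riD; [rewrite !cRD; ring|exact: pcon_im..].
Qed.

Lemma rconZ k h a b : rcon h a b -> rcon (fun t => k * h t) a b.
Proof.
by move=> hc t /hc ht; apply: cvgM => //; exact: cvg_cst.
Qed.

Lemma cintZ k p a b : pcon p a b -> cint (fun t => k * p t) a b = k * cint p a b.
Proof.
move=> pc; rewrite /cint; have rc := pcon_re pc; have ic := pcon_im pc.
have -> : (fun t => cre (k * p t)) =
    (fun t => cre k * cre (p t) + (- cim k) * cim (p t)).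
  by apply/funext => t; rewrite cE mulNr.
have -> : (fun t => cim (k * p t)) =
    (fun t => cre k * cim (p t) + cim k * cre (p t)).
  by apply/funext => t; rewrite cE.
rewrite !riD; try exact: rconZ.
rewrite !riZ // !cRD !cRM cRN.
set u := cR (ri _ a b); set v := cR (ri _ a b).
rewrite [in RHS](cReIm k); transitivity
  (cR (cre k) * u + cI R * cI R * cR (cim k) * v +
    cI R * (cR (cre k) * v + cR (cim k) * u)); last by ring.
by rewrite cI2; ring.
Qed.

(** Real and imaginary parts are bounded separately, whence the factor 2. *)
Lemma cint_bound p a b (M : R) : a <= b -> pcon p a b ->
  (forall t, a <= t <= b -> cabs (p t) <= M) -> cabs (cint p a b) <= 2 * M * (b - a).
Proof.
move=> ab pc pM; apply: le_trans (cabs_le _) _.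
rewrite /cint !cE !(mul0r, mul1r, mulr0, subr0, addr0, add0r).
rewrite -mulrA mulr2n mulrDl !mul1r; apply: lerD; apply: ri_bound => //.
- exact: pcon_re.
- by move=> t /pM; exact: le_trans (cre_le _).
- exact: pcon_im.
- by move=> t /pM; exact: le_trans (cim_le _).
Qed.

Lemma cint_affine (u v : C) a b : a <= b ->
  cint (fun t => u + v * cR t) a b = cR (b - a) * (u + v * cR ((a + b) / 2)).
Proof.
move=> ab; rewrite /cint.
have rid : rcon id a b by move=> t _; exact: cvg_id.
have E (x y : R) : ri (fun t => x + y * t) a b = (b - a) * (x + y * ((a + b) / 2)).
  rewrite riD ?riZ ?ri_cst ?ri_id //; first by field.
  - exact: rcon_cst.
  - exact: rconZ.
have -> : (fun t => cre (u + v * cR t)) = (fun t => cre u + cre v * t).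
  by apply/funext => t; rewrite !cE mulr0 subr0.
have -> : (fun t => cim (u + v * cR t)) = (fun t => cim u + cim v * t).
  by apply/funext => t; rewrite !cE mulr0 add0r.
by rewrite !E; apply: ceqP; rewrite !cE; ring.
Qed.

Definition pt (x y : R) : C := cR x + cI R * cR y.

Lemma cre_pt x y : cre (pt x y) = x.
Proof. by rewrite /pt !cE; ring. Qed.
Lemma cim_pt x y : cim (pt x y) = y.
Proof. by rewrite /pt !cE; ring. Qed.
Lemma ptE z : z = pt (cre z) (cim z).
Proof. exact: cReIm. Qed.

Definition hcon f (a b y : R) := forall x, a <= x <= b -> cont f (pt x y).
Definition vcon f (x c d : R) := forall y, c <= y <= d -> cont f (pt x y).

Lemma hcon_pcon f a b y : hcon f a b y -> pcon (fun t => f (pt t y)) a b.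
Proof.
move=> H t /H fc e /fc[d d0 {}H]; exists d => // s st; apply: H.
by rewrite (_ : _ - _ = cR (s - t)) ?cabs_cR // /pt cRD cRN; ring.
Qed.

Lemma vcon_pcon f x c d : vcon f x c d -> pcon (fun t => f (pt x t)) c d.
Proof.
move=> H t /H fc e /fc[r r0 {}H]; exists r => // s st; apply: H.
rewrite (_ : _ - _ = cI R * cR (s - t)) ?cabsM ?cabs_cI ?mul1r ?cabs_cR //.
by rewrite /pt cRD cRN; ring.
Qed.

Definition bcon f (a b c d : R) :=
  [/\ hcon f a b c, hcon f a b d, vcon f a c d & vcon f b c d].

(* The integral of f along the boundary of the rectangle [a, b] x [c, d]. *)
Definition J f (a b c d : R) : C :=
  cint (fun t => f (pt t c)) a b + cI R * cint (fun t => f (pt b t)) c d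
  - cint (fun t => f (pt t d)) a b - cI R * cint (fun t => f (pt a t)) c d.

Definition bd (a b c d x y : R) :=
  [/\ a <= x <= b, c <= y <= d & [\/ x = a, x = b, y = c | y = d]].

Lemma J_bound f a b c d (M : R) : a <= b -> c <= d -> bcon f a b c d ->
  (forall x y, bd a b c d x y -> cabs (f (pt x y)) <= M) ->
  cabs (J f a b c d) <= 4 * M * ((b - a) + (d - c)).
Proof.
move=> ab cd [h1 h2 v1 v2] H.
have B1 : cabs (cint (fun t => f (pt t c)) a b) <= 2 * M * (b - a).
  apply: cint_bound => //; first exact: hcon_pcon.
  by move=> t tab; apply: H; split; rewrite ?lexx //; apply: Or43.
have B2 : cabs (cint (fun t => f (pt t d)) a b) <= 2 * M * (b - a).
  apply: cint_bound => //; first exact: hcon_pcon.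
  by move=> t tab; apply: H; split; rewrite ?lexx ?cd //; apply: Or44.
have B3 : cabs (cint (fun t => f (pt a t)) c d) <= 2 * M * (d - c).
  apply: cint_bound => //; first exact: vcon_pcon.
  by move=> t tab; apply: H; split; rewrite ?lexx ?ab //; apply: Or41.
have B4 : cabs (cint (fun t => f (pt b t)) c d) <= 2 * M * (d - c).
  apply: cint_bound => //; first exact: vcon_pcon.
  by move=> t tab; apply: H; split; rewrite ?lexx ?ab //; apply: Or42.
rewrite /J; have D := @cabsD R.
apply: le_trans (D _ _) _; rewrite cabsN cabsM cabs_cI mul1r.
apply: le_trans (lerD (D _ _) B3) _; rewrite cabsN.
apply: le_trans (lerD (lerD (D _ _) B2) (lexx _)) _; rewrite cabsM cabs_cI mul1r.
lra.
Qed.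

Lemma J_splitx f a m b c d : a <= m -> m <= b ->
  hcon f a b c -> hcon f a b d ->
  J f a b c d = J f a m c d + J f m b c d.
Proof.
move=> am mb h1 h2; rewrite /J.
rewrite (cint_split am mb (hcon_pcon h1)) (cint_split am mb (hcon_pcon h2)).
by do ![move: (cint _ _ _) => ?]; ring.
Qed.

Lemma J_splity f a b c m d : c <= m -> m <= d ->
  vcon f a c d -> vcon f b c d ->
  J f a b c d = J f a b c m + J f a b m d.
Proof.
move=> am mb h1 h2; rewrite /J.
rewrite (cint_split am mb (vcon_pcon h1)) (cint_split am mb (vcon_pcon h2)).
by do ![move: (cint _ _ _) => ?]; ring.
Qed.

Lemma JD f g a b c d : bcon f a b c d -> bcon g a b c d ->
  J (fun z => f z + g z) a b c d = J f a b c d + J g a b c d.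
Proof.
move=> [h1 h2 v1 v2] [h1' h2' v1' v2']; rewrite /J.
rewrite !cintD; try exact: hcon_pcon; try exact: vcon_pcon.
by do ![move: (cint _ _ _) => ?]; ring.
Qed.

Lemma JZ k f a b c d : bcon f a b c d ->
  J (fun z => k * f z) a b c d = k * J f a b c d.
Proof.
move=> [h1 h2 v1 v2]; rewrite /J.
rewrite !cintZ; try exact: hcon_pcon; try exact: vcon_pcon.
by do ![move: (cint _ _ _) => ?]; ring.
Qed.

Lemma eq_cint p q a b : (forall t, a <= t <= b -> p t = q t) -> cint p a b = cint q a b.
Proof.
by move=> pq; rewrite /cint /ri; congr (cR _ + _ * cR _); apply: eq_Rintegral => t;
  rewrite inE /= in_itv /= => /pq ->.
Qed.

Lemma eq_J f g a b c d : a <= b -> c <= d ->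
  (forall x y, bd a b c d x y -> f (pt x y) = g (pt x y)) ->
  J f a b c d = J g a b c d.
Proof.
move=> ab cd H; rewrite /J.
by congr (_ + _ * _ - _ - _ * _); apply: eq_cint => t tab; apply: H; split;
  rewrite ?lexx ?ab ?cd //; try exact: Or41; try exact: Or42; try exact: Or43; exact: Or44.
Qed.

(** The integral of an affine function over an interval is the length times the value at the
    midpoint ([cint_affine]), so the four sides can be computed exactly. *)
Lemma J_affine (u v : C) a b c d : a <= b -> c <= d ->
  J (fun z => u + v * z) a b c d = 0.
Proof.
move=> ab cd; rewrite /J.
have E1 y : (fun t => u + v * pt t y) = fun t => (u + v * (cI R * cR y)) + v * cR t.
  by apply/funext => t; rewrite /pt; ring.
have E2 x : (fun t => u + v * pt x t) = fun t => (u + v * cR x) + (v * cI R) * cR t.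
  by apply/funext => t; rewrite /pt; ring.
rewrite !E1 !E2 !cint_affine //.
by apply: ceqP; rewrite !cE; field.
Qed.

End RectangleIntegrals.

(** * Goursat's lemma *)

Ltac qlra := repeat match goal with H : forall _, _ |- _ => clear H end; lra.

Section Goursat.
Variable R : realType.
Local Notation C := (Cplx R).
Implicit Types (f g : C -> C).

Lemma half_powers (w e : R) : 0 < e -> exists n, w / 2 ^+ n < e.
Proof.
move=> e0; have := @near_infty_natSinv_expn_lt R (PosNum (divr_gt0 e0 (ltr_pwDr ltr01 (normr_ge0 w)))).
move=> [n _ /(_ n (leqnn n))] /= H; exists n.
have w1 : 0 < `|w| + 1 by rewrite ltr_pwDr.
have p0 : 0 < (2 ^+ n : R)^-1 by rewrite invr_gt0 exprn_gt0.
move: H; rewrite div1r ltr_pdivlMr // => H.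
apply: le_lt_trans H; rewrite mulrC ler_wpM2l ?(ltW p0) //.
by have := ler_norm w; lra.
Qed.

(* Cousin's lemma for quartering: a property that passes from the four quarters
   to the whole and holds for the small rectangles around each point holds. *)
Lemma cousin (Q : R -> R -> nat -> Prop) (a c w h : R) : 0 <= w -> 0 <= h ->
  (forall x y n, Q x y n.+1 -> Q (x + w / 2 ^+ n.+1) y n.+1 ->
     Q x (y + h / 2 ^+ n.+1) n.+1 ->
     Q (x + w / 2 ^+ n.+1) (y + h / 2 ^+ n.+1) n.+1 -> Q x y n) ->
  (forall x y, a <= x <= a + w -> c <= y <= c + h ->
     exists2 e : R, 0 < e & forall x' y' n, a <= x' -> x' <= x <= x' + w / 2 ^+ n ->
       x' + w / 2 ^+ n <= a + w -> c <= y' -> y' <= y <= y' + h / 2 ^+ n ->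
       y' + h / 2 ^+ n <= c + h ->
       w / 2 ^+ n < e -> h / 2 ^+ n < e -> Q x' y' n) ->
  Q a c 0%N.
Proof.
move=> w0 h0 Hq Hloc; apply: contrapT => nQ.
(* [r] is the lower left corner of a rectangle of level [n]; if [Q] fails on it, [s] is the corner
   of a quarter on which [Q] still fails. *)
have step (n : nat) (r : R * R) : exists s : R * R,
   ~ Q r.1 r.2 n -> ~ Q s.1 s.2 n.+1 /\
   (s.1 = r.1 \/ s.1 = r.1 + w / 2 ^+ n.+1) /\
   (s.2 = r.2 \/ s.2 = r.2 + h / 2 ^+ n.+1).
  case: (pselect (Q r.1 r.2 n.+1)) => [q1|]; last by exists r; split=> //; split; left.
  case: (pselect (Q (r.1 + w / 2 ^+ n.+1) r.2 n.+1)) => [q2|]; last first.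
    by exists (r.1 + w / 2 ^+ n.+1, r.2); split=> //=; split; [right|left].
  case: (pselect (Q r.1 (r.2 + h / 2 ^+ n.+1) n.+1)) => [q3|]; last first.
    by exists (r.1, r.2 + h / 2 ^+ n.+1); split=> //=; split; [left|right].
  exists (r.1 + w / 2 ^+ n.+1, r.2 + h / 2 ^+ n.+1) => /= nq.
  split; last by split; right.
  by move=> q4; apply: nq; exact: Hq.
pose nxt n r := projT1 (cid (step n r)).
have nxtP n r := projT2 (cid (step n r)).
pose u := fix u n : R * R := if n is m.+1 then nxt m (u m) else (a, c).
have uQ n : ~ Q (u n).1 (u n).2 n.
  by elim: n => [//|n IH]; have [] := nxtP n (u n) IH.
have p0 n : 0 < (2 ^+ n : R)^-1 by rewrite invr_gt0 exprn_gt0.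
have pS n : (2 ^+ n : R)^-1 = 2 * (2 ^+ n.+1)^-1 by rewrite exprS invfM mulrA mulfV ?mul1r.
(* Nested intervals, to be applied to each coordinate of the corners: the common point is the
   supremum of the left ends. *)
have lim (v : nat -> R) (k : R) : 0 <= k ->
    (forall n, v n.+1 = v n \/ v n.+1 = v n + k / 2 ^+ n.+1) ->
    (forall n, v 0%N <= v n /\ v n + k / 2 ^+ n <= v 0%N + k) /\
    exists x, forall n, v n <= x <= v n + k / 2 ^+ n.
  move=> k0 vS.
  have kS n : k / 2 ^+ n = k / 2 ^+ n.+1 + k / 2 ^+ n.+1 by rewrite pS; ring.
  have kp n : 0 <= k / 2 ^+ n by rewrite mulr_ge0 // ltW.
  have inc n m : (n <= m)%N -> v n <= v m /\ v m + k / 2 ^+ m <= v n + k / 2 ^+ n.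
    elim: m => [|m IH]; first by rewrite leqn0 => /eqP ->.
    rewrite leq_eqVlt => /orP[/eqP->//|]; rewrite ltnS => /IH[].
    have := kS m; have := kp m.+1; case: (vS m) => ->; lra.
  split.
    by move=> n; have [] := inc 0%N n (leq0n n); rewrite expr0 divr1.
  exists (sup (range v)) => n.
  have ub : ubound (range v) (v n + k / 2 ^+ n).
    move=> _ [m _ <-]; have := kp m; have := kp n.
    by case/orP: (leq_total n m) => /inc[]; lra.
  apply/andP; split.
    by apply: sup_upper_bound; [split; [exists (v n), n|exists (v n + k / 2 ^+ n)]|exists n].
  by apply: ge_sup => //; exists (v n), n.
have [bx [x xP]] := lim (fun n => (u n).1) w w0 (fun n => (nxtP n _ (uQ n)).2.1).
have [by_ [y yP]] := lim (fun n => (u n).2) h h0 (fun n => (nxtP n _ (uQ n)).2.2).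
have xr : a <= x <= a + w by have := xP 0%N; rewrite expr0 divr1.
have yr : c <= y <= c + h by have := yP 0%N; rewrite expr0 divr1.
have [e e0 H] := Hloc x y xr yr.
have [n nP] := half_powers (w + h) e0.
have wn : 0 <= w / 2 ^+ n by rewrite mulr_ge0 // ltW.
have hn : 0 <= h / 2 ^+ n by rewrite mulr_ge0 // ltW.
have [? ?] := bx n; have [? ?] := by_ n.
apply: (uQ n); apply: H => //; move: nP; rewrite mulrDl; lra.
Qed.

Definition rhd f (a b c d : R) :=
  forall x y, a <= x <= b -> c <= y <= d -> cdiff f (pt x y).

Lemma pt_dist (x y x' y' : R) : cabs (pt x y - pt x' y') <= `|x - x'| + `|y - y'|.
Proof.
by apply: le_trans (cabs_le _) _; rewrite !cE !(mul0r, mul1r, mulr0, subr0, addr0, add0r).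
Qed.

Lemma J_quarter f (x y u v : R) : 0 <= u -> 0 <= v ->
  (forall s t, x <= s <= x + u + u -> y <= t <= y + v + v -> cont f (pt s t)) ->
  J f x (x + u + u) y (y + v + v) =
  (J f x (x + u) y (y + v) + J f x (x + u) (y + v) (y + v + v)) +
  (J f (x + u) (x + u + u) y (y + v) + J f (x + u) (x + u + u) (y + v) (y + v + v)).
Proof.
move=> u0 v0 fc.
rewrite (@J_splitx _ _ x (x + u)); [|lra|lra|by move=> t ?; apply: fc; lra..].
by congr (_ + _); apply: J_splity; try lra; move=> t ?; apply: fc; lra.
Qed.

(* Near its point of differentiability, f is affine up to a small error. *)
Lemma J_local f (x y k : R) : cdiff f (pt x y) -> 0 < k ->
  exists2 e : R, 0 < e & forall x' y' u v, 0 <= u -> 0 <= v -> u < e -> v < e ->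
    x' <= x <= x' + u -> y' <= y <= y' + v ->
    (forall s t, x' <= s <= x' + u -> y' <= t <= y' + v -> cont f (pt s t)) ->
    cabs (J f x' (x' + u) y' (y' + v)) <= k * (u + v) ^+ 2.
Proof.
move=> [p pc pE] k0.
(* The error term [B] below is at most [k / 4 * (u + v)] on the boundary, and [J_bound] multiplies
   this by [4 * (u + v)]. Sides shorter than [r / 2] keep the boundary within [r] of the point. *)
have [r r0 rP] := pc (k / 4) ltac:(lra); exists (r / 2); first by rewrite divr_gt0.
move=> x' y' u v u0 v0 ur vr xx yy fc.
pose z0 := pt x y.
pose A z := (f z0 - p z0 * z0) + p z0 * z; pose B z := (p z - p z0) * (z - z0).
have fE : f = fun z => A z + B z by apply/funext => z; rewrite pE /A /B /z0; ring.
have Ac z : cont A z.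
  by apply: contD; [exact: cont_cst|apply: contM; [exact: cont_cst|exact: cont_id]].
have Bc z : cont f z -> cont B z.
  move=> fz; have -> : B = fun z => f z - A z by rewrite {1}fE; apply/funext => t; rewrite addrC addKr.
  exact: contB.
have Abc : bcon A x' (x' + u) y' (y' + v) by split => t ?; exact: Ac.
have Bbc : bcon B x' (x' + u) y' (y' + v) by split => t ?; apply/Bc/fc; lra.
rewrite {1}fE (JD Abc Bbc) J_affine ?add0r; try lra.
have -> : k * (u + v) ^+ 2 = 4 * (k / 4 * (u + v)) * ((x' + u - x') + (y' + v - y')) by field.
apply: J_bound => //; try lra.
move=> s t [sr tr _]; have zd : cabs (pt s t - z0) <= u + v.
  apply: le_trans (pt_dist _ _ _ _) _; apply: lerD; rewrite ler_norml; apply/andP; split; lra.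
rewrite cabsM; apply: ler_pM; rewrite ?cabs_ge0 //.
by apply/ltW/rP; apply: le_lt_trans zd _; lra.
Qed.

(** A bound by [k] times the square of width plus height passes from the quarters to the whole: the
    sides are halved, and there are four quarters. Hence [cousin] extends the local bound of
    [J_local] to the full rectangle, with [k] arbitrarily small. *)
Theorem goursat f (a b c d : R) : a <= b -> c <= d -> rhd f a b c d ->
  J f a b c d = 0.
Proof.
move=> ab cd fd; apply/eqP; rewrite -cabs_eq0 eq_le cabs_ge0 andbT.
have fc x y : a <= x <= b -> c <= y <= d -> cont f (pt x y).
  by move=> ? ?; apply: cdiff_cont; exact: fd.
have [w wE] : exists w, a + w = b by exists (b - a); rewrite addrC subrK.
have [h hE] : exists h, c + h = d by exists (d - c); rewrite addrC subrK.
have w0 : 0 <= w by lra.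
have h0 : 0 <= h by lra.
apply/ler_addgt0Pr => e e0; rewrite add0r.
have [k k0 kP] : exists2 k, 0 < k & k * (w + h) ^+ 2 <= e.
  have wh : 0 < (w + h + 1) ^+ 2 by rewrite exprn_gt0 //; lra.
  exists (e / (w + h + 1) ^+ 2); first by rewrite divr_gt0.
  rewrite mulrAC ler_pdivrMr //.
  rewrite ler_wpM2l ?(ltW e0) // ler_sqr ?nnegrE; lra.
have p0 n : 0 < (2 ^+ n : R)^-1 by rewrite invr_gt0 exprn_gt0.
have pS n : (2 ^+ n : R)^-1 = 2 * (2 ^+ n.+1)^-1 by rewrite exprS invfM mulrA mulfV ?mul1r.
have wp n : 0 <= w / 2 ^+ n by rewrite mulr_ge0 // ltW.
have hp n : 0 <= h / 2 ^+ n by rewrite mulr_ge0 // ltW.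
pose Q x y n := a <= x -> x + w / 2 ^+ n <= b -> c <= y -> y + h / 2 ^+ n <= d ->
  cabs (J f x (x + w / 2 ^+ n) y (y + h / 2 ^+ n)) <= k * (w / 2 ^+ n + h / 2 ^+ n) ^+ 2.
suff : Q a c 0%N.
  by rewrite /Q expr0 !divr1 wE hE !lexx => H; apply: le_trans kP; exact: H.
apply: (@cousin Q a c w h) => //.
  move=> x y n; rewrite /Q; move: (wp n.+1) (hp n.+1).
  rewrite (pS n) !(mulrCA _ 2); move: (w / _) (h / _) => u v u0 v0 q1 q2 q3 q4 ax.
  rewrite !(mulr_natl, mulr2n) !addrA => xb cy yd.
  have [A1 A2 A3 A4] : [/\ x + u <= b, a <= x + u, y + v <= d & c <= y + v].
    by clear q1 q2 q3 q4; split; qlra.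
  rewrite J_quarter //; last first.
    by move=> s t ? ?; apply: fc; clear q1 q2 q3 q4; qlra.
  have D := @cabsD R.
  apply: le_trans (D _ _) _; apply: le_trans (lerD (D _ _) (D _ _)) _.
  have {}q1 := q1 ax A1 cy A3.
  have {}q2 := q2 A2 xb cy A3.
  have {}q3 := q3 ax A1 A4 yd.
  have {}q4 := q4 A2 xb A4 yd.
  have -> : k * (u + u + v + v) ^+ 2 = 4 * (k * (u + v) ^+ 2) by ring.
  move: q1 q2 q3 q4; move: (k * _) (cabs _) (cabs _) (cabs _) (cabs _); clear.
  by move=> *; lra.
move=> x y xr yr; have fxy : cdiff f (pt x y) by apply: fd; rewrite -?wE -?hE.
have [r r0 rP] := J_local fxy k0; exists r => // x' y' n ax xx xb cy yy yd ur vr _ _ _ _.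
apply: rP => //; move: (w / _) (h / _) ax xx xb cy yy yd => u v ax xx xb cy yy yd s t st tt.
by apply: fc; rewrite -?wE -?hE; lra.
Qed.

End Goursat.

(** * The Cauchy formula on a square *)

Section Cauchy.
Variable R : realType.
Local Notation C := (Cplx R).
Implicit Types (f g p q : C -> C) (z w : C).

Lemma cdiff_intro g p z : cont p z ->
  (\forall w \near z, g w = g z + p w * (w - z)) -> cdiff g z.
Proof.
move=> pc H; apply: (@cdiff_near _ (fun w => g z + p w * (w - z))).
  by apply: filterS H => w ->.
by exists p => // w; rewrite subrr mulr0 addr0.
Qed.

Lemma near_ptP z (P : set C) : (\forall w \near z, P w) ->
  exists2 r : R, 0 < r & forall x y, cre z - r <= x <= cre z + r ->
    cim z - r <= y <= cim z + r -> P (pt x y).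
Proof.
move=> /nbhsC[e e0 H]; exists (e / 4); first by rewrite divr_gt0.
move=> x y xr yr; apply: H; rewrite [z in _ - z]ptE.
apply: le_lt_trans (pt_dist _ _ _ _) _.
apply: (@le_lt_trans _ _ (e / 4 + e / 4)); last by lra.
by apply: lerD; rewrite ler_norml; apply/andP; split; lra.
Qed.

(** A square of half-side [s] around [z] is cut out. The surrounding rectangles contribute nothing
    by [goursat], and the square at most [16 * M * s], where [M] bounds the continuous [p] near
    [z]. *)
Lemma goursat_except p (a b c d : R) z : a < cre z < b -> c < cim z < d ->
  (forall x y, a <= x <= b -> c <= y <= d -> cont p (pt x y)) ->
  (forall x y, a <= x <= b -> c <= y <= d -> pt x y != z -> cdiff p (pt x y)) ->
  J p a b c d = 0.
Proof.
set x0 := cre z; set y0 := cim z => xr yr pc ph.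
have zE : z = pt x0 y0 by exact: ptE.
apply/eqP; rewrite -cabs_eq0 eq_le cabs_ge0 andbT.
apply/ler_addgt0Pr => e e0; rewrite add0r.
have pz : cont p z by rewrite zE; apply: pc; apply/andP; split; apply: ltW; lra.
have /near_ptP[r r0 rP] := cont_near pz (@ltr01 R).
set M := cabs (p z) + 1.
have M0 : 0 < M by have := cabs_ge0 (p z); rewrite /M; lra.
have [s [[s0 sr sa sb] [sc sd' se]]] : exists s, [/\ 0 < s, s <= r, a <= x0 - s & x0 + s <= b]
    /\ [/\ c <= y0 - s, y0 + s <= d & 16 * M * s <= e].
  pose s := Num.min r (Num.min (x0 - a) (Num.min (b - x0) (Num.min (y0 - c) (Num.min (d - y0) (e / (16 * M)))))).
  have s0 : 0 < s by rewrite !lt_min r0 divr_gt0 ?mulr_gt0 // !subr_gt0 !andbT; do !(apply/andP; split); lra.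
  have : s <= s by []; rewrite {2}/s !le_min => /andP[? /andP[? /andP[? /andP[? /andP[? es]]]]].
  exists s; split; split=> //; try qlra.
  by move: es; rewrite ler_pdivlMr ?mulr_gt0 // mulrC.
have Jz a' b' c' d' : a <= a' -> a' <= b' -> b' <= b -> c <= c' -> c' <= d' -> d' <= d ->
    [\/ x0 < a', b' < x0, y0 < c' | d' < y0] -> J p a' b' c' d' = 0.
  move=> A1 A2 A3 A4 A5 A6 A7; apply: goursat => // x y xy1 xy2; apply: ph; try lra.
  apply/eqP => xyz; have xE : x = x0 by rewrite -(cre_pt x y) xyz.
  have yE : y = y0 by rewrite -(cim_pt x y) xyz.
  by rewrite xE in xy1; rewrite yE in xy2; case: A7 => A7; qlra.
rewrite (@J_splitx _ _ a (x0 - s)); [|lra|lra|by move=> t ?; apply: pc; lra..].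
rewrite (Jz a); try lra; last by apply: Or42; lra.
rewrite (@J_splitx _ _ (x0 - s) (x0 + s)); [|lra|lra|by move=> t ?; apply: pc; lra..].
rewrite (Jz (x0 + s)); try lra; last by apply: Or41; lra.
rewrite (@J_splity _ _ _ _ _ (y0 - s)); [|lra|lra|by move=> t ?; apply: pc; lra..].
rewrite (Jz _ _ _ (y0 - s)); try lra; last by apply: Or44; lra.
rewrite (@J_splity _ _ _ _ _ (y0 + s)); [|lra|lra|by move=> t ?; apply: pc; lra..].
rewrite (Jz _ _ (y0 + s)); try lra; last by apply: Or43; lra.
rewrite !(add0r, addr0).
apply: le_trans (_ : 4 * M * ((x0 + s - (x0 - s)) + (y0 + s - (y0 - s))) <= _); last by lra.
apply: J_bound; try lra; first by split => t ?; apply: pc; lra.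
move=> x y [xr' yr' _]; have := rP x y; rewrite -/x0 -/y0 => H.
have {}H := H ltac:(lra) ltac:(lra).
by have := cabsD (p (pt x y) - p z) (p z); rewrite subrK /M; lra.
Qed.

(** * The Cauchy transform over a centred square *)

Section Square.
Variable r : R.
Hypothesis r0 : 0 < r.

Lemma rr : - r <= r.
Proof. by move: r0; lra. Qed.
Lemma rr2 : 0 < r / 2.
Proof. by rewrite divr_gt0. Qed.

Definition scon p := forall x y, bd (- r) r (- r) r x y -> cont p (pt x y).

Lemma scon_bcon p : scon p -> bcon p (- r) r (- r) r.
Proof.
by move=> pc; split => t tr; apply: pc; split => //; try lra;
  [apply: Or43|apply: Or44|apply: Or41|apply: Or42].
Qed.

Lemma bd_le x y z : bd (- r) r (- r) r x y -> cabs z < r / 2 ->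
  r / 2 <= cabs (pt x y - z).
Proof.
move=> [_ _ H] zr; have : r <= cabs (pt x y).
  have h := cre_le (pt x y); have v := cim_le (pt x y).
  rewrite cre_pt in h; rewrite cim_pt in v.
  by case: H => E; [move: h|move: h|move: v|move: v]; rewrite E ?normrN gtr0_norm.
by have := cabsD (pt x y - z) z; rewrite subrK; lra.
Qed.

Lemma bd_neq0 x y z : bd (- r) r (- r) r x y -> cabs z < r / 2 -> pt x y - z != 0.
Proof.
move=> xy zr; rewrite -cabs_gt0; apply: lt_le_trans (bd_le xy zr).
by rewrite divr_gt0.
Qed.

Lemma scon_div p z : cabs z < r / 2 -> scon p -> scon (fun w => p w / (w - z)).
Proof.
move=> zr pc x y xy; apply: contM; first exact: pc.
apply: contV; first exact: bd_neq0.
by apply: contB; [exact: cont_id|exact: cont_cst].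
Qed.

Lemma sconM p q : scon p -> scon q -> scon (fun w => p w * q w).
Proof. by move=> pc qc x y xy; apply: contM; [exact: pc|exact: qc]. Qed.

Lemma scon_bound p : scon p ->
  exists M : R, forall x y, bd (- r) r (- r) r x y -> cabs (p (pt x y)) <= M.
Proof.
move=> /scon_bcon [h1 h2 v1 v2].
have S (q : R -> C) : pcon q (- r) r ->
    exists2 m : R, 0 <= m & forall t, - r <= t <= r -> cabs (q t) <= m.
  move=> qc; have : {within `[- r, r], continuous (fun t => cabs (q t))}.
    apply: rcon_within => t /qc qt; apply: (@cabs_cvg R _ (nbhs t)).
    apply/(@cvgC _ _ (nbhs t)) => e /qt[d d0 H]; apply/nbhs_normP; exists d => //= s.
    by rewrite /= distrC => /H.
  move=> /(EVT_max rr)[m _ H].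
  by exists (cabs (q m)) => [|t tr]; [exact: cabs_ge0|apply: H; rewrite in_itv].
have [m1 ? H1] := S _ (hcon_pcon h1); have [m2 ? H2] := S _ (hcon_pcon h2).
have [m3 ? H3] := S _ (vcon_pcon v1); have [m4 ? H4] := S _ (vcon_pcon v2).
exists (m1 + m2 + m3 + m4) => x y [xr yr [->|->|->|->]].
- by have := H3 y yr; lra.
- by have := H4 y yr; lra.
- by have := H1 x xr; lra.
- by have := H2 x xr; lra.
Qed.

Definition SJ p := J p (- r) r (- r) r.
(** The Cauchy transform; [T2], with the squared kernel, is its derivative. Points with
    [cabs z < r / 2] are at distance at least [r / 2] from the boundary, which makes the bounds
    uniform. *)
Definition T p z := SJ (fun w => p w / (w - z)).
Definition T2 p z := SJ (fun w => p w / (w - z) / (w - z)).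

Lemma eq_SJ p q : (forall x y, bd (- r) r (- r) r x y -> p (pt x y) = q (pt x y)) ->
  SJ p = SJ q.
Proof. by move=> H; apply: eq_J H; exact: rr. Qed.

Lemma SJD p q : scon p -> scon q -> SJ (fun w => p w + q w) = SJ p + SJ q.
Proof. by move=> /scon_bcon ? /scon_bcon ?; exact: JD. Qed.

Lemma SJZ k p : scon p -> SJ (fun w => k * p w) = k * SJ p.
Proof. by move=> /scon_bcon ?; exact: JZ. Qed.

Lemma SJ_bound p (M : R) : scon p ->
  (forall x y, bd (- r) r (- r) r x y -> cabs (p (pt x y)) <= M) ->
  cabs (SJ p) <= 16 * r * M.
Proof.
move=> pc H; by apply: le_trans (J_bound rr rr (scon_bcon pc) H) _; rewrite le_eqVlt; apply/orP; left; apply/eqP; ring.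
Qed.

Lemma T_bound p (M : R) z : cabs z < r / 2 -> scon p ->
  (forall x y, bd (- r) r (- r) r x y -> cabs (p (pt x y)) <= M) ->
  cabs (T p z) <= 32 * M.
Proof.
move=> zr pc H; have -> : 32 * M = 16 * r * (M / (r / 2)) by field; rewrite gt_eqF.
apply: SJ_bound; first exact: scon_div.
move=> x y xy; rewrite cabsM cabsV; apply: ler_pM; rewrite ?cabs_ge0 ?invr_ge0 ?cabs_ge0 ?H //.
rewrite lef_pV2 ?bd_le // posrE; first by rewrite cabs_gt0 bd_neq0.
by rewrite divr_gt0.
Qed.

Lemma T2_eq p z : T2 p z = T (fun w => p w / (w - z)) z.
Proof. by []. Qed.

Lemma T2_bound p (M : R) z : cabs z < r / 2 -> scon p ->
  (forall x y, bd (- r) r (- r) r x y -> cabs (p (pt x y)) <= M) ->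
  cabs (T2 p z) <= 32 * (M / (r / 2)).
Proof.
move=> zr pc H; rewrite T2_eq; apply: T_bound => //; first exact: scon_div.
move=> x y xy; rewrite cabsM cabsV; apply: ler_pM; rewrite ?cabs_ge0 ?invr_ge0 ?cabs_ge0 ?H //.
rewrite lef_pV2 ?bd_le // posrE; first by rewrite cabs_gt0 bd_neq0.
by rewrite divr_gt0.
Qed.

(** By partial fractions, the slope of [T p] at [z0] is again a Cauchy transform of a function
    continuous on the boundary. Once transforms are known to be continuous, they are
    differentiable. *)
Lemma T_diff p z z0 : cabs z < r / 2 -> cabs z0 < r / 2 -> scon p ->
  T p z = T p z0 + T (fun w => p w / (w - z0)) z * (z - z0).
Proof.
move=> zr z0r pc; rewrite /T mulrC -SJZ; last by do 2![apply: scon_div => //].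
rewrite -SJD; [|exact: scon_div|]; last first.
  by apply: sconM; [move=> x y _; exact: cont_cst|do 2![apply: scon_div => //]].
apply: eq_SJ => x y xy; field.
by rewrite !bd_neq0.
Qed.

Lemma T2_diff p z z0 : cabs z < r / 2 -> cabs z0 < r / 2 -> scon p ->
  T2 p z = T2 p z0 +
    (T2 (fun w => p w / (w - z0)) z + T (fun w => p w / (w - z0) / (w - z0)) z) * (z - z0).
Proof.
move=> zr z0r pc; rewrite /T2 /T mulrC -SJD; try by do 3![apply: scon_div => //].
have S1 : scon (fun w => p w / (w - z0) / (w - z) / (w - z) + p w / (w - z0) / (w - z0) / (w - z)).
  by move=> x y xy; apply: contD; do 3![apply: scon_div => //].
rewrite -SJZ // -SJD; [|by do 2![apply: scon_div => //]|]; last first.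
  by apply: sconM => // x y _; exact: cont_cst.
apply: eq_SJ => x y xy; field.
by rewrite !bd_neq0.
Qed.

Lemma lip_cont g z (M : R) : (\forall w \near z, cabs (g w - g z) <= M * cabs (w - z)) -> cont g z.
Proof.
move=> /nbhsC[d d0 H] e e0.
have M0 : 0 < `|M| + 1 by rewrite ltr_pwDr.
exists (Num.min d (e / (`|M| + 1))); first by rewrite lt_min d0 divr_gt0.
move=> w; rewrite lt_min => /andP[/H wd]; rewrite ltr_pdivlMr // => we.
apply: le_lt_trans wd _; apply: le_lt_trans we; rewrite mulrC.
by rewrite ler_wpM2l ?cabs_ge0 //; have := ler_norm M; lra.
Qed.

Lemma near_small z : cabs z < r / 2 -> \forall w \near z, cabs w < r / 2.
Proof.
move=> zr; have := @open_cball R 0 (r / 2); rewrite openE => /(_ z).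
by rewrite /= subr0 => /(_ zr); apply: filterS => w /=; rewrite subr0.
Qed.

Lemma T_cont p z : cabs z < r / 2 -> scon p -> cont (T p) z.
Proof.
move=> zr pc; have qc := scon_div zr pc; have [M H] := scon_bound qc.
apply: (@lip_cont _ _ (32 * M)); apply: filterS (near_small zr) => w wr.
rewrite (T_diff wr zr pc) addrC addKr cabsM ler_wpM2r ?cabs_ge0 //.
exact: T_bound.
Qed.

Lemma T2_cont p z : cabs z < r / 2 -> scon p -> cont (T2 p) z.
Proof.
move=> zr pc; have qc := scon_div zr pc; have [M H] := scon_bound qc.
have qc2 := scon_div zr qc; have [M2 H2] := scon_bound qc2.
apply: (@lip_cont _ _ (32 * (M / (r / 2)) + 32 * M2)); apply: filterS (near_small zr) => w wr.
rewrite (T2_diff wr zr pc) addrC addKr cabsM ler_wpM2r ?cabs_ge0 //.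
by apply: le_trans (cabsD _ _) _; apply: lerD; [exact: T2_bound|exact: T_bound].
Qed.

Lemma T2_cdiff p z : cabs z < r / 2 -> scon p -> cdiff (T2 p) z.
Proof.
move=> zr pc; apply: (@cdiff_intro _ (fun w => T2 (fun w => p w / (w - z)) w +
  T (fun w => p w / (w - z) / (w - z)) w)).
  by apply: contD; [apply: T2_cont|apply: T_cont] => //; do 2?[apply: scon_div => //].
by apply: filterS (near_small zr) => w wr; exact: T2_diff.
Qed.

(* 2 i pi times the winding number of the square around z. *)
Definition kap z := T (fun=> 1) z.

Lemma scon1 : scon (fun=> 1).
Proof. by move=> x y _; exact: cont_cst. Qed.

(** The slope [p] of [f] at [z] is holomorphic off [z] and continuous at [z], so its integral
    vanishes by [goursat_except]; on the boundary [f w / (w - z)] is [p w + f z / (w - z)]. *)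
Lemma cauchy f z : (forall x y, - r <= x <= r -> - r <= y <= r -> cdiff f (pt x y)) ->
  cabs z < r / 2 -> T f z = f z * kap z.
Proof.
move=> fh zr.
have rz := cre_le z; have iz := cim_le z.
have [p pc pE] : cdiff f z by rewrite [z]ptE; apply: fh; move: rz iz; rewrite !ler_norml; lra.
have pc' w : w != z -> cdiff f w -> cdiff p w.
  move=> wz fw; have wz0 : w - z != 0 by rewrite subr_eq0.
  have : cdiff (fun v => (f v - f z) / (v - z)) w.
    apply: cdiffM; first by apply: cdiffB => //; exact: cdiff_cst.
    by apply: cdiffV => //; apply: cdiffB; [exact: cdiff_id|exact: cdiff_cst].
  apply: cdiff_near; have : cont (fun v => v - z) w.
    by apply: contB; [exact: cont_id|exact: cont_cst].
  move=> /cont_neq0 /(_ wz0); apply: filterS => v vz.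
  by rewrite {1}pE addrC addKr mulfK.
have pC w : cdiff f w -> cont p w.
  by move=> fw; have [->//|wz] := eqVneq w z; apply/cdiff_cont/pc'.
have Jp : SJ p = 0.
  apply: (@goursat_except _ _ _ _ _ z).
  - by move: rz; rewrite ler_norml; lra.
  - by move: iz; rewrite ler_norml; lra.
  - by move=> x y xr yr; apply/pC/fh.
  - by move=> x y xr yr xyz; apply: pc' => //; exact: fh.
have ps : scon p by move=> x y [xr yr _]; apply/pC/fh.
rewrite /kap /T -SJZ; last exact: scon_div zr scon1.
rewrite -[RHS]add0r -Jp -SJD //; last first.
  by apply: sconM; [move=> x y _; exact: cont_cst|exact: scon_div zr scon1].
apply: eq_SJ => x y xy; rewrite {1}(pE (pt x y)); field.
exact: bd_neq0.
Qed.

(** All four sides are parametrised by the same interval, on which the integrands add up to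
    [cI R * cR (4 * r / (t ^+ 2 + r ^+ 2))]. Its imaginary part is at least [2 / r], so that of the
    integral is positive. *)
Lemma kap0 : kap 0 != 0.
Proof.
have zr : cabs (0 : C) < r / 2 by rewrite cabs0 divr_gt0.
rewrite /kap /T /SJ /J.
have [h1 h2 v1 v2] := scon_bcon (scon_div zr scon1).
set p1 := fun t => _ / (pt t (- r) - 0).
set p2 := fun t => _ / (pt r t - 0).
set p3 := fun t => _ / (pt t r - 0).
set p4 := fun t => _ / (pt (- r) t - 0).
have c1 : pcon p1 (- r) r by exact: hcon_pcon h1.
have c3 : pcon p3 (- r) r by exact: hcon_pcon h2.
have c4 : pcon p4 (- r) r by exact: vcon_pcon v1.
have c2 : pcon p2 (- r) r by exact: vcon_pcon v2.
have ccst k : pcon (fun=> k) (- r) r by move=> t _ e e0; exists 1 => // s _; rewrite subrr cabs0.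
have cM k (q : R -> C) : pcon q (- r) r -> pcon (fun t => k * q t) (- r) r.
  move=> qc t /qc qt e e0; have k0 : 0 < cabs k + 1 by rewrite ltr_wpDl ?cabs_ge0.
  have [d d0 H] := qt (e / (cabs k + 1)) (divr_gt0 e0 k0); exists d => // s /H.
  rewrite ltr_pdivlMr // => qe; apply: le_lt_trans qe; rewrite -mulrBr cabsM mulrC.
  by rewrite ler_wpM2l ?cabs_ge0 //; lra.
have cD (q q' : R -> C) : pcon q (- r) r -> pcon q' (- r) r -> pcon (fun t => q t + q' t) (- r) r.
  move=> qc qc' t tr e e0; have [d d0 H] := qc t tr (e / 2) ltac:(lra).
  have [d' d'0 H'] := qc' t tr (e / 2) ltac:(lra).
  exists (Num.min d d'); first by rewrite lt_min d0.
  move=> s; rewrite lt_min => /andP[/H sd /H' sd'].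
  rewrite (_ : _ - _ = (q s - q t) + (q' s - q' t)); last by ring.
  by apply: le_lt_trans (cabsD _ _) _; lra.
rewrite -[- cint p3 _ _]mulN1r -[- (cI R * _)]mulN1r mulrA -!cintZ //.
have d2 := cD _ _ c1 (cM (cI R) _ c2); have d3 := cD _ _ d2 (cM (-1) _ c3).
have qc := cD _ _ d3 (cM (-1 * cI R) _ c4).
rewrite -(cintD c1 (cM _ _ c2)) -(cintD d2 (cM _ _ c3)) -(cintD d3 (cM _ _ c4)).
move: qc; set q := fun t => _; move=> qc; have qE t : - r <= t <= r -> q t = cI R * cR (4 * r / (t ^+ 2 + r ^+ 2)).
  move=> tr; have tr0 : t ^+ 2 + r ^+ 2 != 0.
    by rewrite paddr_eq0 ?sqr_ge0 // negb_and (expf_neq0 _ (lt0r_neq0 r0)) orbT.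
  have inv x y : x ^+ 2 + y ^+ 2 != 0 -> (pt x y - 0)^-1 = cR (x / (x ^+ 2 + y ^+ 2)) - cI R * cR (y / (x ^+ 2 + y ^+ 2)) :> C.
    move=> xy; have pn0 : pt x y != 0.
      apply: contra xy => /eqP pt0; have -> : x = 0 by rewrite -(cre_pt x y) pt0.
      by have -> : y = 0 by [rewrite -(cim_pt x y) pt0]; rewrite expr0n addr0.
    rewrite subr0; apply: (mulfI pn0); rewrite divff //.
    by apply: ceqP; rewrite /pt !cE; field.
  rewrite /q /p1 /p2 /p3 /p4 !div1r !inv ?sqrrN //; try by rewrite addrC.
  by apply: ceqP; rewrite !cE; field; rewrite // addrC.
apply/eqP => /(congr1 (@cim R)); rewrite /cint !cE !(mul0r, mul1r, add0r, addr0) => /eqP.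
apply/negP; rewrite gt_eqF //.
apply: (@lt_le_trans _ _ (ri (fun=> 2 / r) (- r) r)).
  by rewrite ri_cst ?rr // mulr_gt0 ?divr_gt0 //; move: r0; lra.
apply: ri_le; [exact: rcon_cst|exact: pcon_im|move=> t tr].
rewrite qE // !cE !(mul0r, mul1r, add0r, addr0) ler_pdivlMr; last first.
  by rewrite ltr_wpDl ?sqr_ge0 // exprn_gt0.
by rewrite mulrAC ler_pdivrMr //; move: r0 tr; clear; nra.
Qed.

Lemma kap_near : exists2 d : R, 0 < d <= r / 2 & forall z, cabs z < d -> kap z != 0.
Proof.
have zr : cabs (0 : C) < r / 2 by rewrite cabs0 divr_gt0.
have /nbhsC[d d0 H] := cont_neq0 (T_cont zr scon1) kap0.
exists (Num.min d (r / 2)); first by rewrite lt_min ge_min lexx d0 orbT divr_gt0.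
by move=> z; rewrite lt_min => /andP[zd _]; apply: H; rewrite subr0.
Qed.

End Square.

End Cauchy.

(** * Local theory of holomorphic functions *)

Section LocalTheory.
Variable R : realType.
Local Notation C := (Cplx R).
Implicit Types (f g p q : C -> C) (z w : C).

Definition holo f z := \forall w \near z, cdiff f w.

Lemma holo_cdiff f z : holo f z -> cdiff f z.
Proof. exact: nbhs_singleton. Qed.

Lemma holo_holo f z : holo f z -> \forall w \near z, holo f w.
Proof. by move/near_join. Qed.

Lemma holoD f g z : holo f z -> holo g z -> holo (fun w => f w + g w) z.
Proof. by move=> fz gz; apply: filterS2 fz gz => w; exact: cdiffD. Qed.

Lemma holoM f g z : holo f z -> holo g z -> holo (fun w => f w * g w) z.
Proof. by move=> fz gz; apply: filterS2 fz gz => w; exact: cdiffM. Qed.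

Lemma holoN f z : holo f z -> holo (fun w => - f w) z.
Proof. by move=> fz; apply: filterS fz => w; exact: cdiffN. Qed.

Lemma holo_cst (c : C) z : holo (fun=> c) z.
Proof. by apply: (@filterE _ (nbhs z)) => w; exact: cdiff_cst. Qed.

Lemma holo_id z : holo id z.
Proof. by apply: (@filterE _ (nbhs z)) => w; exact: cdiff_id. Qed.

Lemma holo_near f g z : (\forall w \near z, f w = g w) -> holo f z -> holo g z.
Proof.
by move=> /near_join fg fz; apply: filterS2 fg fz => w; exact: cdiff_near.
Qed.

Lemma cont_nbhs f z (P : set C) : cont f z -> (\forall w \near f z, P w) ->
  \forall w \near z, P (f w).
Proof. by move=> /contP; apply. Qed.

Lemma holo_comp f g z : holo f z -> holo g (f z) -> holo (g \o f) z.
Proof.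
move=> fz gz; have := cont_nbhs (cdiff_cont (holo_cdiff fz)) gz.
by apply: filterS2 fz => w; exact: cdiff_comp.
Qed.

Lemma near_cj z (P : set C) : (\forall w \near cj z, P w) -> \forall w \near z, P (cj w).
Proof.
move=> /nbhsC[e e0 H]; apply/nbhsC; exists e => // w wz; apply: H.
by rewrite -cjN -cjD cabs_cj.
Qed.

Lemma holo_cj f z : holo f (cj z) -> holo (fun w => cj (f (cj w))) z.
Proof. by move=> /near_cj; apply: filterS => w; exact: cdiff_cj. Qed.

Lemma cont_shift f (c z : C) : cont f (z + c) -> cont (fun w => f (w + c)) z.
Proof.
by move=> fc e /fc[d d0 H]; exists d => // w wz; apply: H; rewrite opprD addrACA subrr addr0.
Qed.

Lemma near_shift z (P : set C) : (\forall w \near z, P w) <-> \forall w \near 0, P (w + z).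
Proof.
split=> /nbhsC[e e0 H]; apply/nbhsC; exists e => // w wz; first by apply: H; rewrite addrK -[w]subr0.
by rewrite -(subrK z w); apply: H; rewrite subr0.
Qed.

Lemma holo_shift f z : holo f z -> holo (fun w => f (w + z)) 0.
Proof. by move=> /near_shift; apply: filterS => w; exact: cdiff_shift. Qed.

Lemma cdiff_unshift f z : cdiff (fun w => f (w + z)) 0 -> cdiff f z.
Proof.
move=> H; have : cdiff (fun w => f (w + - z + z)) z by apply: (@cdiff_shift _ (fun w => f (w + z))); rewrite subrr.
by under [X in cdiff X]funext do rewrite subrK.
Qed.

Lemma cont_unique f g z : cont f z -> cont g z ->
  (\forall w \near z, w != z -> f w = g w) -> f z = g z.
Proof.
move=> fc gc fg; apply/eqP; rewrite -subr_eq0 -cabs_eq0 eq_le cabs_ge0 andbT.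
apply/ler_addgt0Pr => e e0; rewrite add0r; have e2 : 0 < e / 2 by rewrite divr_gt0.
have /nbhsC[d d0 H] : \forall w \near z, [/\ cabs (f w - f z) < e / 2, cabs (g w - g z) < e / 2
    & w != z -> f w = g w].
  near=> w; split; last by near: w.
    by near: w; exact: cont_near.
  by near: w; exact: cont_near.
have dn : cR (d / 2) != 0 :> C by rewrite -cabs_gt0 cabs_cR gtr0_norm divr_gt0.
have [|A B E] := H (z + cR (d / 2)).
  by rewrite addrC addKr cabs_cR gtr0_norm; lra.
rewrite E in A; last by rewrite -subr_eq0 addrC addKr.
apply: le_trans (cabs_dist _ _ (g (z + cR (d / 2)))) _; rewrite cabsB; lra.
Unshelve. all: by end_near. Qed.

Lemma near_square f z : holo f z -> exists2 r : R, 0 < r &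
  forall x y, - r <= x <= r -> - r <= y <= r -> cdiff (fun w => f (w + z)) (pt x y).
Proof.
move=> /holo_shift/near_ptP[r r0 H]; exists r => // x y xr yr.
by apply: H; rewrite /cre /cim /= ?sub0r ?add0r.
Qed.

Lemma near0_cabs (P : set C) (e : R) : 0 < e -> (forall w, cabs w < e -> P w) ->
  \forall w \near 0, P w.
Proof. by move=> e0 H; apply/nbhsC; exists e => // w; rewrite subr0; exact: H. Qed.

Lemma square_scon f (r : R) :
  (forall x y, - r <= x <= r -> - r <= y <= r -> cdiff f (pt x y)) -> scon r f.
Proof. by move=> H x y [xr yr _]; apply/cdiff_cont/H. Qed.

(* Riemann's theorem for continuous functions: (w - z) f(w) is differentiable
   at z, and the Cauchy formula divides it by w - z. *)
Theorem removable f z : cont f z -> (\forall w \near z, w != z -> cdiff f w) -> holo f z.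
Proof.
move=> fc fh; suff : cdiff f z.
  by move=> fz; apply: filterS fh => w H; have [->//|/H] := eqVneq w z.
pose h w := (w - z) * f w.
have hh : holo h z.
  apply: filterS fh => w H; have [->|/H fw] := eqVneq w z.
    by exists f => // v; rewrite /h subrr mul0r add0r mulrC.
  by apply: cdiffM => //; apply: cdiffB; [exact: cdiff_id|exact: cdiff_cst].
have [r r0 hr] := near_square hh.
pose g w := h (w + z).
have gs : scon r g by exact: square_scon.
have [d /andP[d0 dr] kd] := kap_near r0.
have r2 := rr2 r0.
have z0 : cabs (0 : C) < r / 2 by rewrite cabs0.
have gE w : g w = w * f (w + z) by rewrite /g /h addrK.
have cg w (wr : cabs w < r / 2) : T r g w = g w * kap r w := cauchy r0 hr wr.
(* Since [g 0 = 0], [T_diff] at 0 shows that [g w * kap r w] is [w] times a Cauchy transform. The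
   right-hand side also makes sense at [w = 0] and is differentiable there. *)
have E w : cabs w < d -> w != 0 -> f (w + z) = T r (fun v => g v / (v - 0)) w / kap r w.
  move=> wd w0; have wr : cabs w < r / 2 by lra.
  have g0 : g 0 = 0 by rewrite gE mul0r.
  have := T_diff r0 wr z0 gs; rewrite (cg w wr) (cg 0 z0) g0 mul0r add0r subr0 => H.
  apply: (mulIf (kd _ wd)); rewrite mulfVK ?kd //; apply: (mulfI w0).
  by rewrite mulrA -gE H mulrC.
have gs0 := scon_div r0 z0 gs.
have Th : cdiff (fun w => T r (fun v => g v / (v - 0)) w / kap r w) 0.
  have hT p : scon r p -> cdiff (T r p) 0.
    move=> ps; apply: (@cdiff_intro _ _ (T r (fun w => p w / (w - 0)))).
      by apply: T_cont => //; exact: scon_div.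
    by apply: filterS (near_small z0) => w wr; exact: T_diff.
  apply: cdiffM; first exact: hT.
  by apply: cdiffV; [apply: kd; rewrite cabs0|exact/hT/scon1].
apply: cdiff_unshift; apply: cdiff_near (Th); apply: (near0_cabs d0) => w wd.
have [->|/(E _ wd)->//] := eqVneq w 0.
apply: (@cont_unique (fun w => T r (fun v => g v / (v - 0)) w / kap r w)
  (fun w => f (w + z)) 0); first exact: (cdiff_cont Th).
  by apply: cont_shift; rewrite add0r.
by apply: (near0_cabs d0) => v vd v0; rewrite E.
Qed.

(* f has derivative d at z. *)
Definition dv f z d := exists2 p : C -> C, cont p z & p z = d /\ forall w, f w = f z + p w * (w - z).

Lemma dv_unique f z d d' : dv f z d -> dv f z d' -> d = d'.
Proof.
move=> [p pc [<- pE]] [q qc [<- qE]]; apply: cont_unique => //.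
apply/nbhsC; exists 1 => // w _ wz; have wz0 : w - z != 0 by rewrite subr_eq0.
by apply: (mulIf wz0); apply: (addrI (f z)); rewrite -pE -qE.
Qed.

(** Differentiating the Cauchy formula [T f = f * kap] turns [T] into [T2] on the left and gives a
    product rule on the right, where [kap] has as derivative the [T2] of the constant 1. Solving for
    the derivative of [f] leaves an expression in functions known to be differentiable. *)
Lemma cdiff_derivative f z : holo f z ->
  exists f' : C -> C, \forall w \near z, dv f w (f' w) /\ cdiff f' w.
Proof.
move=> fh; have [r r0 hr] := near_square fh; pose g w := f (w + z).
have gs : scon r g by exact: square_scon.
have [d /andP[d0 dr] kd] := kap_near r0; have r2 := rr2 r0.
have s1 := @scon1 R r.
pose g' w := (T2 r g w - g w * T2 r (fun=> 1) w) / kap r w.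
exists (fun w => g' (w - z)); apply/near_shift; apply: (near0_cabs d0) => w wd.
have wr : cabs w < r / 2 by lra.
have wi := cre_le w; have wi' := cim_le w.
have gw : cdiff g w.
  by rewrite [w]ptE; apply: hr; move: wi wi'; rewrite !ler_norml; lra.
rewrite addrK; split; last first.
  apply: (@cdiff_shift _ g'); rewrite addrK; apply: cdiffM; last first.
    apply: cdiffV; first exact: kd.
    apply: (@cdiff_intro _ _ (T r (fun v => 1 / (v - w)))).
      by apply: T_cont => //; exact: scon_div.
    by apply: filterS (near_small wr) => v vr; exact: T_diff.
  by apply: cdiffB; [exact: T2_cdiff|apply: cdiffM => //; exact: T2_cdiff].
case: gw => p pc pE.
suff <- : p w = g' w.
  exists (fun v => p (v - z)); first by apply: cont_shift; rewrite addrK.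
  by rewrite addrK; split=> // v; have := pE (v - z); rewrite /g subrK opprD addrA (addrAC _ (- z)).
apply: (mulIf (kd _ wd)); rewrite /g' mulfVK ?kd //.
(* The derivative of [g * kap] is found twice, from [T_diff] and from the product rule, and compared
   by [dv_unique]. The explicit slopes are valid only for [cabs v < r / 2]; difference quotients
   complete them elsewhere. *)
have A : dv (fun v => g v * kap r v) w (T2 r g w).
  pose q v := if cabs v < r / 2 then T r (fun u => g u / (u - w)) v else (g v * kap r v - g w * kap r w) / (v - w).
  have near_q : \forall v \near w, T r (fun u => g u / (u - w)) v = q v.
    by apply: filterS (near_small wr) => v vr; rewrite /q vr.
  exists q; first by apply: cont_eq near_q _; apply: T_cont => //; exact: scon_div.
  split; first by rewrite -(nbhs_singleton near_q).
  move=> v; rewrite /q; case: ifP => vr; first by rewrite -!(cauchy r0) //; exact: T_diff.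
  rewrite mulfVK; first by rewrite [RHS]addrC subrK.
  by rewrite subr_eq0; apply: contraFN vr => /eqP ->.
suff B : dv (fun v => g v * kap r v) w (p w * kap r w + g w * T2 r (fun=> 1) w).
  by rewrite (dv_unique A B); ring.
pose q v := if cabs v < r / 2 then p v * kap r v + g w * T r (fun u => 1 / (u - w)) v
  else (g v * kap r v - g w * kap r w) / (v - w).
have near_q : \forall v \near w, p v * kap r v + g w * T r (fun u => 1 / (u - w)) v = q v.
  by apply: filterS (near_small wr) => v vr; rewrite /q vr.
exists q.
  apply: cont_eq near_q _; apply: contD; first by apply: contM => //; exact: T_cont.
  by apply: contM; [exact: cont_cst|apply: T_cont => //; exact: scon_div].
split; first by rewrite -(nbhs_singleton near_q).
move=> v; rewrite /q; case: ifP => vr; last first.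
  rewrite mulfVK; first by rewrite [RHS]addrC subrK.
  by rewrite subr_eq0; apply: contraFN vr => /eqP ->.
have := T_diff r0 vr wr s1; rewrite -!/(kap _ _) => kE.
by rewrite (pE v) [in LHS]mulrDl {1}kE; ring.
Qed.


(** If [f] has no finite order at [z], dividing by [w - z] again and again gives
    [F w = w ^+ k * g w] for every [k], with [g] holomorphic on one fixed square. On its boundary
    [g] is at most [M / r ^+ k], so for [cabs w < r / 2] the Cauchy formula bounds [F w * kap r w]
    by [32 * M / 2 ^+ k]. *)
Lemma order_vanish f z : holo f z -> (\forall w \near z, f w = 0) \/
  exists k g, [/\ holo g z, g z != 0 & forall w, f w = (w - z) ^+ k * g w].
Proof.
move=> fz; have [fb|nf] := EM (exists k g, [/\ holo g z, g z != 0 & forall w, f w = (w - z) ^+ k * g w]).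
  by right.
left; have [r r0 hr] := near_square fz; pose F w := f (w + z).
have fk k : exists2 g, (forall x y, - r <= x <= r -> - r <= y <= r -> cdiff g (pt x y)) &
    forall w, F w = w ^+ k * g w.
  elim: k => [|k [g gh gE]]; first by exists F => // w; rewrite expr0 mul1r.
  have gn : holo g 0.
    apply: (@near0_cabs _ r) => // w wr; rewrite [w]ptE.
    by have wi := cre_le w; have wi' := cim_le w; apply: gh; move: wi wi'; rewrite !ler_norml; lra.
  have g0 : g 0 = 0.
    apply/eqP/negP => /negP g0; apply: nf; exists k, (fun w => g (w - z)); split.
    - apply: (@holo_comp (fun w => w - z) g); last by rewrite subrr.
      by apply: holoD; [exact: holo_id|exact: holo_cst].
    - by rewrite subrr.
    - by move=> w; rewrite -gE /F subrK.
  have [p pc pE] := holo_cdiff gn.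
  have gpE w : g w = w * p w by rewrite pE g0 add0r subr0 mulrC.
  have ph w : w != 0 -> cdiff g w -> cdiff p w.
    move=> w0 gw; have : cdiff (fun v => g v / v) w by apply: cdiffM => //; apply: cdiffV => //; exact: cdiff_id.
    apply: cdiff_near; have := cont_neq0 (@cont_id _ w) w0; apply: filterS => v v0.
    by rewrite gpE mulrC mulKf.
  exists p; last by move=> w; rewrite gE gpE exprSr mulrA.
  move=> x y xr yr; have [->|xy0] := eqVneq (pt x y) 0; last by apply: ph => //; exact: gh.
  apply: holo_cdiff; apply: removable => //.
  by apply: filterS gn => w gw w0; exact: ph.
have [d /andP[d0 dr] kd] := kap_near r0; have r2 := rr2 r0.
have [M MP] := scon_bound r0 (square_scon hr).
apply/near_shift; apply: (near0_cabs d0) => w wd.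
have wr : cabs w < r / 2 by lra.
apply/eqP; rewrite -cabs_eq0 eq_le cabs_ge0 andbT -/(F w).
have kp : 0 < cabs (kap r w) by rewrite cabs_gt0 kd.
have M0 : 0 <= M.
  apply: le_trans (MP r 0 _); first exact: cabs_ge0.
  by split; [rewrite lexx rr //|rewrite oppr_le0 ltW|apply: Or42].
have B k : cabs (F w) * cabs (kap r w) <= 32 * M * (2^-1) ^+ k.
  have [g gh gE] := fk k; rewrite gE cabsM cabsX -mulrA -cabsM -cauchy //.
  have gs := square_scon gh.
  have bg x y : bd (- r) r (- r) r x y -> cabs (g (pt x y)) <= M / r ^+ k.
    move=> xy; rewrite ler_pdivlMr ?exprn_gt0 //; apply: le_trans (MP x y xy).
    rewrite -/(F _) gE cabsM cabsX mulrC ler_wpM2r ?cabs_ge0 // lerXn2r ?nnegrE ?cabs_ge0 ?(ltW r0) //.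
    have h := cre_le (pt x y); have v := cim_le (pt x y).
    rewrite cre_pt in h; rewrite cim_pt in v.
    by case: xy => _ _ [] E; [move: h|move: h|move: v|move: v]; rewrite E ?normrN gtr0_norm.
  have Tb := T_bound r0 wr gs bg.
  have wk : cabs w ^+ k <= (r / 2) ^+ k by rewrite lerXn2r ?nnegrE ?cabs_ge0 ?(ltW r2) ?(ltW wr).
  apply: le_trans (ler_pM _ _ wk Tb) _; rewrite ?exprn_ge0 ?cabs_ge0 //.
  rewrite le_eqVlt; apply/orP; left; apply/eqP.
  rewrite exprMn; field; rewrite expf_neq0 // gt_eqF //.
rewrite -(pmulr_lle0 _ kp); apply/ler_addgt0Pr => e e0; rewrite add0r.
have [n nP] := half_powers (32 * M) e0.
by apply: le_trans (B n) _; rewrite exprVn ltW.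
Qed.

Lemma isolated f z : holo f z -> (\forall w \near z, f w = f z) \/
  (\forall w \near z, w != z -> f w != f z).
Proof.
move=> fz; have [|H|[k [g [gh g0 gE]]]] := @order_vanish (fun w => f w - f z) z.
- by apply: holoD => //; exact: holo_cst.
- by left; apply: filterS H => w /eqP; rewrite subr_eq0 => /eqP.
right; apply: filterS (cont_neq0 (cdiff_cont (holo_cdiff gh)) g0) => w gw wz.
by rewrite -subr_eq0 gE mulf_neq0 // expf_neq0 // subr_eq0.
Qed.

(** Suppose [f - f z] has finite order [k] and cofactor [g]. A root [u] of [u ^+ k * g z = - cI R]
    gives a ray on which the leading term is a positive multiple of [- cI R], so the imaginary part
    becomes negative there. *)
Lemma min_principle f z : holo f z -> (\forall w \near z, 0 <= cim (f w)) ->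
  cim (f z) = 0 -> \forall w \near z, f w = f z.
Proof.
move=> fz fp f0; have [|H|[k [g [gh g0 gE]]]] := @order_vanish (fun w => f w - f z) z.
- by apply: holoD => //; exact: holo_cst.
- by apply: filterS H => w /eqP; rewrite subr_eq0 => /eqP.
exfalso; have k0 : (0 < k)%N.
  case: k gE => // gE; have := gE z; rewrite subrr expr0 mul1r => g0'.
  by rewrite -g0' eqxx in g0.
pose u : C := k.-root (- cI R / g z).
have uk : u ^+ k * g z = - cI R by rewrite rootCK // mulfVK.
have uN : 0 < cabs (u ^+ k) + 1 by rewrite ltr_wpDl ?cabs_ge0.
have := cont_near (cdiff_cont (holo_cdiff gh)) (divr_gt0 ltr01 uN).
move=> /(filterI fp)/nbhsC[d d0 H].
have un : 0 < cabs u + 1 by rewrite ltr_wpDl ?cabs_ge0.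
pose t := d / (cabs u + 1) / 2; have t0 : 0 < t by rewrite !divr_gt0.
have tu : t * cabs u < d.
  rewrite /t mulrAC ltr_pdivrMr // mulrAC ltr_pdivrMr //; have := cabs_ge0 u; nra.
pose w := z + cR t * u.
have wz : w - z = cR t * u by rewrite /w addrC addKr.
have [|fw gw] := H w; first by rewrite wz cabsM cabs_cR gtr0_norm.
have : cim (f w - f z) < 0.
  rewrite gE wz exprMn -mulrA (_ : g w = g z + (g w - g z)); last by ring.
  rewrite mulrDr uk (_ : cR t ^+ k = cR (t ^+ k)); last by rewrite -rmorphXn.
  rewrite !cE mul0r addr0 pmulr_rlt0 ?exprn_gt0 //.
  have := cim_le (u ^+ k * (g w - g z)); rewrite cabsM !cE ler_norml.
  move: gw; rewrite ltr_pdivlMr // => gw; have := cabs_ge0 (g w - g z); lra.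
by rewrite cimD cimN f0 subr0 ltNge fw.
Qed.

Lemma real_const f z : holo f z -> (\forall w \near z, cim (f w) = 0) ->
  \forall w \near z, f w = f z.
Proof.
move=> fz fr; apply: min_principle => //; last exact: (nbhs_singleton fr).
by apply: filterS fr => w ->.
Qed.

(** [f + cj f] and [cI R * (f - cj f)] are holomorphic with real values, hence constant by the
    minimum principle. *)
Lemma conj_const f z : holo f z -> holo (fun w => cj (f w)) z ->
  \forall w \near z, f w = f z.
Proof.
move=> fz cfz.
have A := @real_const (fun w => f w + cj (f w)) z (holoD fz cfz).
have B := @real_const (fun w => cI R * (f w + - cj (f w))) z
  (holoM (holo_cst _ _) (holoD fz (holoN cfz))).
have {}A := A ltac:(by apply: (@filterE _ (nbhs z)) => w; rewrite !cE cim_cj subrr).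
have {}B := B ltac:(by apply: (@filterE _ (nbhs z)) => w; rewrite !cE cre_cj cim_cj; ring).
apply: filterS2 A B => w A /mulfI B.
have I0 : cI R != 0 by rewrite -cabs_gt0 cabs_cI.
have {}B := B I0; move: (cj (f w)) (cj (f z)) A B => a b A B.
have : f w *+ 2 = f z *+ 2.
  have -> : f w *+ 2 = (f w + a) + (f w - a) by ring.
  by rewrite A B; ring.
by move=> /eqP; rewrite eqrMn2r /= => /eqP.
Qed.

(** Where the derivative vanishes, the conjugate of [f] is differentiable too: its slope is the
    conjugate slope of [f] times a factor of modulus at most 1, and tends to 0. Then [conj_const]
    applies. *)
Lemma zero_derivative_const f f' z : (\forall w \near z, dv f w (f' w)) ->
  (\forall w \near z, f' w = 0) -> \forall w \near z, f w = f z.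
Proof.
move=> fd f0; apply: conj_const; first by apply: filterS fd => w [p pc [_ pE]]; exists p.
apply: filterS2 fd f0 => w [p pc [pw pE]] f'w.
exists (fun v => cj (p v) * (cj (v - w) / (v - w))).
  move=> e e0; have [d d0 H] := pc e e0; exists d => // v vw.
  rewrite pw f'w cj0 mul0r subr0 !cabsM cabsV !cabs_cj.
  have [->|vw0] := eqVneq (v - w) 0; first by rewrite cabs0 !(mul0r, mulr0).
  rewrite divff ?cabs_eq0 // mulr1.
  by have := H v vw; rewrite pw f'w subr0.
move=> v; rewrite pE cjD cjM; have [E|vw0] := eqVneq (v - w) 0.
  by rewrite E cj0 !(mul0r, mulr0).
by rewrite -[in RHS]mulrA mulfVK.
Qed.

(* A continuous right inverse of a holomorphic function is differentiable where
   the derivative does not vanish, and the exceptional points are isolated. *)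
Lemma right_inverse f g z : holo f (g z) -> (\forall w \near z, cont g w) ->
  (\forall w \near z, f (g w) = w) -> holo g z.
Proof.
move=> fz gc fg; have [f' f'P] := cdiff_derivative fz.
have gz := nbhs_singleton gc; have fgz := nbhs_singleton fg.
have fP : \forall w \near g z, dv f w (f' w) by apply: filterS f'P => w [].
have f'h : holo f' (g z) by apply: filterS f'P => w [].
(* Zeros of [f'] are isolated unless [f'] vanishes identically near [g z]; in that case [f] would be
   constant there, against [f (g w) = w]. *)
have nz : \forall w \near g z, w != g z -> f' w != 0.
  have [H|H] := isolated f'h; last first.
    have [E|E] := eqVneq (f' (g z)) 0; first by rewrite -E.
    by apply: filterS (cont_neq0 (cdiff_cont (holo_cdiff f'h)) E).
  have [E|E] := eqVneq (f' (g z)) 0; last by apply: filterS H => w ->.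
  exfalso; rewrite E in H; have := cont_nbhs gz (zero_derivative_const fP H).
  move=> /(filterI fg)/nbhsC[d d0 {}H].
  have [|A B] := H (z + cR (d / 2)).
    by rewrite addrC addKr cabs_cR gtr0_norm; lra.
  move: A; rewrite B fgz => /eqP; rewrite -subr_eq0 opprD addrA subrr add0r oppr_eq0.
  by rewrite -cabs_eq0 cabs_cR gtr0_norm ?gt_eqF //; lra.
apply: removable => //; near=> w => wz.
have fgw : \forall v \near w, f (g v) = v by near: w; exact: (near_join fg).
have gw : cont g w by near: w.
have fgw' : f (g w) = w by near: w.
have nzw : g w != g z -> f' (g w) != 0 by near: w; exact: (cont_nbhs gz nz).
have [p pc [pE fE]] : dv f (g w) (f' (g w)) by near: w; exact: (cont_nbhs gz fP).
have p0 : p (g w) != 0.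
  by rewrite pE; apply: nzw; apply: contra wz => /eqP E; rewrite -fgw' E fgz.
apply: (@cdiff_intro _ _ (fun v => (p (g v))^-1)).
  by apply: contV => //; exact: (@cont_comp _ g p).
apply: filterS2 fgw (cont_neq0 (cont_comp gw pc) p0) => v fgv pv0.
have := fE (g v); rewrite fgv fgw' => E.
have -> : v - w = p (g v) * (g v - g w) by rewrite {1}E addrC addKr.
by rewrite mulrA mulVf // mul1r addrC subrK.
Unshelve. all: by end_near. Qed.

End LocalTheory.

(** * Holomorphic functions on a half-plane *)

Section HalfPlane.
Variable R : realType.
Local Notation C := (Cplx R).
Implicit Types (f g h p q G : C -> C) (z w t : C).

Lemma star_connected (T : topologicalType) (A : set T) (c : T) : A c ->
  (forall x, A x -> exists2 p : R -> T, continuous p & [/\ p 0 = c, p 1 = x &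
     forall s, 0 <= s <= 1 -> A (p s)]) -> connected A.
Proof.
move=> Ac H; suff -> : A = connected_component A c by exact: component_connected.
apply/seteqP; split; last exact: connected_component_sub.
move=> x /H[p pc [p0 p1 pA]].
have pI : connected (p @` `[0, 1]).
  apply: connected_continuous_connected; first exact: segment_connected.
  exact: continuous_subspaceT.
apply: (connected_component_max _ _ pI).
- by exists 0 => //=; rewrite in_itv /= lexx ler01.
- by move=> _ [s /= s01 <-]; apply: pA; move: s01; rewrite in_itv.
- by exists 1 => //=; rewrite in_itv /= lexx ler01.
Qed.

(** The points near which [f] and [g] agree form an open set, and by [isolated] applied to [f - g]
    every other point of [W] has a neighbourhood free of them. *)
Lemma identity_theorem (W : set C) f g z : open W -> connected W ->
  (forall w, W w -> cdiff f w) -> (forall w, W w -> cdiff g w) ->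
  W z -> (\forall w \near z, f w = g w) -> forall w, W w -> f w = g w.
Proof.
move=> Wo Wc fh gh Wz fgz; pose B : set C := [set w | W w /\ \forall v \near w, f v = g v].
suff : B = W by move=> BW w; rewrite -BW => -[_ /nbhs_singleton].
have nW w : W w -> \forall v \near w, W v by move: Wo; rewrite openE; apply.
apply: Wc; first by exists z.
  exists [set w | \forall v \near w, f v = g v] => //.
  by rewrite openE => w H; exact: (near_join H).
pose O : set C := [set w | \forall v \near w, W v -> ~ (\forall u \near v, f u = g u)].
exists (~` O); first by apply: open_closedC; rewrite openE => w H; exact: (near_join H).
apply/seteqP; split=> w /=.
  by move=> [Ww fgw]; split=> // /nbhs_singleton /(_ Ww).
move=> [Ww nO]; split; first exact: Ww.
apply: contrapT => nfg; apply: nO.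
have [|H|H] := @isolated _ (fun v => f v - g v) w.
- by apply: filterS (nW w Ww) => v Wv; apply: cdiffB; [exact: fh|exact: gh].
- have [E|E] := EM (f w = g w).
    by exfalso; apply: nfg; apply: filterS H => v /eqP; rewrite E subrr subr_eq0 => /eqP.
  apply: filterS H => v Hv _ /nbhs_singleton /eqP; rewrite -subr_eq0 Hv subr_eq0.
  by move/eqP.
- have [E|E] := EM (f w = g w).
    apply: filterS H => v Hv _; have [->//|/Hv] := eqVneq v w.
    by rewrite E subrr => /eqP n /nbhs_singleton e; apply: n; rewrite e subrr.
  have fc : cont (fun v => f v - g v) w by apply: contB; apply: cdiff_cont; [exact: fh|exact: gh].
  have /(cont_neq0 fc) : f w - g w != 0 by rewrite subr_eq0; apply/eqP.
  apply: filterS => v; rewrite subr_eq0 => /eqP n _ /nbhs_singleton //.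
Qed.

(* The closed upper half-plane, or the plane if b is false. *)
Definition inH (b : bool) t := b -> 0 <= cim t.

(* The local form of [analytic_on] for subsets of the closed half-plane (or of
   the plane, if b is false). *)
Definition hholo (b : bool) h t :=
  exists2 G, holo G t & \forall w \near t, inH b w -> G w = h w.

Definition conH (b : bool) h t := forall e : R, 0 < e ->
  \forall w \near t, inH b w -> cabs (h w - h t) < e.

Lemma holo_hholo b h t : holo h t -> hholo b h t.
Proof. by move=> ht; exists h => //; apply: (@filterE _ (nbhs t)). Qed.

Lemma near_inH2 b t : inH b t -> (b -> cim t != 0) ->
  \forall w \near t, inH b w /\ (b -> cim w != 0).
Proof.
case: b => [|_ _]; last by apply: (@filterE _ (nbhs t)).
move=> /(_ isT) t0 /(_ isT) tn0; have {t0 tn0} t0 : 0 < cim t by rewrite lt_def tn0.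
apply: filterS (nbhs_cball t t0) => w /= /cabs_lt_im; rewrite !cE ltr_norml => H.
have w0 : 0 < cim w by lra.
by split=> _; [exact: ltW|rewrite gt_eqF].
Qed.

Lemma near_inH b t : inH b t -> (b -> cim t != 0) -> \forall w \near t, inH b w.
Proof. by move=> tH tn; apply: filterS (near_inH2 tH tn) => w []. Qed.

Lemma hholo_holo b h t : inH b t -> (b -> cim t != 0) -> hholo b h t -> holo h t.
Proof.
move=> tH tn [G Gt E]; apply: holo_near Gt.
by apply: filterS2 E (near_inH tH tn) => w E wH; exact: E.
Qed.

Lemma hholo_near b h t : hholo b h t -> \forall w \near t, hholo b h w.
Proof.
move=> [G /holo_holo Gt /near_join E].
by apply: filterS2 Gt E => w Gw Ew; exists G.
Qed.

Lemma near_cball t w (r : R) : cabs (w - t) < r -> \forall v \near w, cabs (v - t) < r.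
Proof. by move=> wt; have := @open_cball R t r; rewrite openE => /(_ w wt). Qed.

(** Reflecting a common point that lies below the real axis brings it no further from centres in the
    closed half-plane, and a small move upwards stays in both discs. In the open half-plane two
    extensions of one function can be compared. *)
Lemma inH_ball_up (t t' : C) (r r' : R) w : 0 <= cim t -> 0 <= cim t' ->
  cabs (w - t) < r -> cabs (w - t') < r' ->
  exists u, [/\ cabs (u - t) < r, cabs (u - t') < r' & 0 < cim u].
Proof.
move=> t0 t'0 wt wt'.
have [v [vt vt' v0]] : exists v, [/\ cabs (v - t) < r, cabs (v - t') < r' & 0 <= cim v].
  have [w0|w0] := leP 0 (cim w); first by exists w.
  have L (s : C) : 0 <= cim s -> cabs (cj w - s) <= cabs (w - s).
    move=> s0; case: w s w0 s0 {wt wt'} => a b [c d]; rewrite /cim /= => b0 d0.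
    rewrite /cabs /= ler_sqrt ?addr_ge0 ?sqr_ge0 // lerD2l; nra.
  exists (cj w); rewrite cim_cj oppr_ge0 ltW //; split=> //.
    exact: le_lt_trans (L _ t0) wt.
  exact: le_lt_trans (L _ t'0) wt'.
pose e := Num.min (r - cabs (v - t)) (r' - cabs (v - t')) / 2.
have e0 : 0 < e by rewrite divr_gt0 // lt_min !subr_gt0 vt.
have er : e < r - cabs (v - t).
  have : Num.min (r - cabs (v - t)) (r' - cabs (v - t')) <= r - cabs (v - t) by rewrite ge_min lexx.
  by move: e0; rewrite /e; lra.
have er' : e < r' - cabs (v - t').
  have : Num.min (r - cabs (v - t)) (r' - cabs (v - t')) <= r' - cabs (v - t') by rewrite ge_min lexx orbT.
  by move: e0; rewrite /e; lra.
have ie : cabs (cI R * cR e) = e by rewrite cabsM cabs_cI mul1r cabs_cR gtr0_norm.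
exists (v + cI R * cR e); split.
- by rewrite addrAC; apply: le_lt_trans (cabsD _ _) _; rewrite ie; lra.
- by rewrite addrAC; apply: le_lt_trans (cabsD _ _) _; rewrite ie; lra.
- by rewrite !cE mul0r mul1r add0r; lra.
Qed.

Lemma seg_continuous (u v : C) : continuous (fun s : R => u + cR s * v).
Proof.
move=> s; apply/(@cvgC _ _ (nbhs s)) => e e0.
have v0 : 0 < cabs v + 1 by rewrite ltr_wpDl ?cabs_ge0.
apply/nbhs_normP; exists (e / (cabs v + 1)); first by rewrite /= divr_gt0.
move=> s' /=; rewrite ltr_pdivlMr // => ss.
rewrite (_ : _ - _ = cR (s' - s) * v); last by rewrite cRD cRN; ring.
rewrite cabsM cabs_cR distrC; apply: le_lt_trans ss.
by rewrite ler_wpM2l //; lra.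
Qed.

Lemma convex_connected (W : set C) (u : C) : W u ->
  (forall v s, W v -> 0 <= s <= 1 -> W (u + cR s * (v - u))) -> connected W.
Proof.
move=> Wu H; apply: (star_connected Wu) => v Wv.
exists (fun s => u + cR s * (v - u)); first exact: seg_continuous.
split; rewrite ?mul0r ?addr0 ?mul1r ?[u + _]addrC ?subrK //.
by move=> s s01; apply: H.
Qed.

Lemma cball_seg (t u v : C) (r s : R) : cabs (u - t) < r -> cabs (v - t) < r ->
  0 <= s <= 1 -> cabs (u + cR s * (v - u) - t) < r.
Proof.
move=> ur vr s01; have -> : u + cR s * (v - u) - t = cR (1 - s) * (u - t) + cR s * (v - t).
  by rewrite cRD cRN cR1; ring.
apply: le_lt_trans (cabsD _ _) _; rewrite !cabsM !cabs_cR !ger0_norm; [|lra|lra].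
by have [->|sn0] := eqVneq s 0; [lra|have : 0 < s by lra]; nra.
Qed.

(** [analytic_on] asks for one extension to one open set, while [hholo] gives an extension on a disc
    around each point. Two discs that meet do so in a convex set containing a point with a
    neighbourhood in the half-plane, where both extensions equal [g]; hence they agree on the
    overlap. *)
Lemma glue (b : bool) (D : set C) g : (forall t, D t -> inH b t /\ hholo b g t) ->
  analytic_on D g.
Proof.
move=> DH.
have H (t : C) : exists Gr : (C -> C) * R, D t -> [/\ 0 < Gr.2,
    (forall w, cabs (w - t) < Gr.2 -> cdiff Gr.1 w) &
    forall w, cabs (w - t) < Gr.2 -> inH b w -> Gr.1 w = g w].
  have [Dt|nD] := EM (D t); last by exists (id, 0).
  have [_ [G Gt E]] := DH t Dt; move: E => /(filterI Gt)/nbhsC[r r0 rP].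
  by exists (G, r) => _; split=> // w /rP[].
have [Gr GP] := choice H; pose G t := (Gr t).1; pose r t := (Gr t).2.
have compat t t' w : D t -> D t' -> cabs (w - t) < r t -> cabs (w - t') < r t' ->
    G t w = G t' w.
  move=> Dt Dt' wt wt'; have [r0 Gh GE] := GP t Dt; have [r0' Gh' GE'] := GP t' Dt'.
  have [u [ut ut' u0]] : exists u, [/\ cabs (u - t) < r t, cabs (u - t') < r t' &
      \forall v \near u, inH b v].
    case: b DH {H GP GE GE'} => DH; last by exists w; split=> //; apply: (@filterE _ (nbhs w)).
    have [u [? ? u0]] := inH_ball_up ((DH t Dt).1 isT) ((DH t' Dt').1 isT) wt wt'.
    exists u; split=> //; apply: near_inH => _; first exact: ltW.
    by rewrite gt_eqF.
  pose W := [set v : C | cabs (v - t) < r t] `&` [set v | cabs (v - t') < r t'].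
  have Wo : open W by apply: openI; exact: open_cball.
  apply: (@identity_theorem W _ _ u) => //.
  - apply: (@convex_connected _ u) => // v s [vt vt'] s01; split; exact: cball_seg.
  - by move=> v [/Gh].
  - by move=> v [_ /Gh'].
  - have Wu : \forall v \near u, W v by move: Wo; rewrite openE; apply.
    by apply: filterS2 u0 Wu => v vH [vt vt']; rewrite /G GE // GE'.
(* Each point of the union of the discs selects a disc containing it; by [compat] the value does not
   depend on the selection. *)
have H' (w : C) : exists s : C, (exists2 t, D t & cabs (w - t) < r t) ->
    D s /\ cabs (w - s) < r s.
  have [[t Dt wt]|n] := EM (exists2 t, D t & cabs (w - t) < r t); last by exists w.
  by exists t.
have [tau tauP] := choice H'.
exists [set w | exists2 t, D t & cabs (w - t) < r t], (fun w => G (tau w) w); split.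
- by rewrite openE => w [t Dt wt]; apply: filterS (near_cball wt) => v vt; exists t.
- by move=> t Dt; exists t => //; rewrite subrr cabs0; have [] := GP t Dt.
- move=> w [t Dt wt]; apply/cdiffP; have [r0 Gh GE] := GP t Dt.
  apply: cdiff_near (Gh w wt); apply: filterS (near_cball wt) => v vt; have [] := tauP v; first by exists t.
  by move=> ? ?; exact: compat.
- move=> t; rewrite inE => Dt; have [r0 Gh GE] := GP t Dt.
  have tt : cabs (t - t) < r t by rewrite subrr cabs0.
  have [] := tauP t; first by exists t.
  move=> Dtau ttau; rewrite (compat _ t) // -[RHS]GE //.
  by have [] := DH t Dt.
Qed.

(* Schwarz reflection. *)
Definition refl h t := if 0 <= cim t then h t else cj (h (cj t)).

Lemma refl_conH h t : (cim t = 0 -> cim (h t) = 0) ->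
  0 <= cim t -> conH true h t -> cont (refl h) t.
Proof.
move=> tr t0 hc e e0; apply/nbhsC; rewrite /refl t0.
have [ti|tn] := eqVneq (cim t) 0; last first.
  apply: filterS2 (hc e e0) (near_inH (b := true) (fun _ => t0) (fun _ => tn)) => w.
  by move=> hw wH; rewrite (wH isT) hw.
have tj : cj t = t by apply: ceqP; rewrite ?cre_cj ?cim_cj ?ti ?oppr0.
have hj : cj (h t) = h t by apply: ceqP; rewrite ?cre_cj ?cim_cj ?tr ?oppr0.
have H := hc e e0; have H' : \forall w \near t, inH true (cj w) -> cabs (h (cj w) - h t) < e.
  by apply: (@near_cj _ t (fun w => inH true w -> cabs (h w - h t) < e)); rewrite tj.
apply: filterS2 H H' => w hw hw'; case: ifP => [w0|/negbT]; first by apply: hw.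
rewrite -ltNge => w0; rewrite -{1}hj -cjN -cjD cabs_cj; apply: hw' => _.
by rewrite cim_cj oppr_ge0 ltW.
Qed.

Lemma refl_cj h t : cim t != 0 -> refl h t = cj (refl h (cj t)).
Proof.
rewrite /refl cim_cj oppr_ge0 => t0; case: ltgtP t0 => // t0 _; rewrite ?cjK //.
Qed.

Lemma near_cim_lt0 t : cim t < 0 -> \forall w \near t, cim w < 0.
Proof.
rewrite -oppr_gt0 => t0.
apply: filterS (nbhs_cball t t0) => w /= /cabs_lt_im; rewrite !cE ltr_norml; lra.
Qed.

(** At a real point the slope [p] of the extension [G] is real, being a limit of real difference
    quotients along the axis. Its reflection is therefore a continuous slope for [refl h]. *)
Lemma refl_cdiff h t : 0 <= cim t -> hholo true h t ->
  (cim t = 0 -> \forall w \near t, cim w = 0 -> cim (h w) = 0) -> cdiff (refl h) t.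
Proof.
move=> t0 cholo hr; have [ti|tn] := eqVneq (cim t) 0; last first.
  have tH : inH true t by [].
  apply: cdiff_near (holo_cdiff (hholo_holo tH (fun _ => tn) cholo)).
  apply: filterS (near_inH tH (fun _ => tn)) => w wH.
  by rewrite /refl (wH isT).
have {}hr := hr ti; have [G Gt E] := cholo.
have tj : cj t = t by apply: ceqP; rewrite ?cre_cj ?cim_cj ?ti ?oppr0.
have hti : cim (h t) = 0 by exact: (nbhs_singleton hr).
have Gt0 : G t = h t by apply: (nbhs_singleton E) => _.
have hj : cj (h t) = h t by apply: ceqP; rewrite ?cre_cj ?cim_cj ?hti ?oppr0.
have [p pc pE] := holo_cdiff Gt.
have pr : cim (p t) = 0.
  apply/eqP; rewrite -normr_eq0 eq_le normr_ge0 andbT.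
  apply/ler_addgt0Pr => e e0; rewrite add0r.
  have := hr; move=> /(filterI E)/(filterI (cont_near pc e0))/nbhsC[d d0 H].
  have d2 : 0 < d / 2 by rewrite divr_gt0.
  have [|A [B D]] := H (t + cR (d / 2)).
    by rewrite addrC addKr cabs_cR gtr0_norm; lra.
  have wi : cim (t + cR (d / 2)) = 0 by rewrite !cE ti addr0.
  have Gi : cim (G (t + cR (d / 2))) = 0.
    by rewrite B ?D // => _; rewrite wi.
  have pi : cim (p (t + cR (d / 2))) = 0.
    move: Gi; rewrite pE cimD Gt0 hti add0r addrAC subrr add0r cimM cimR mulr0 add0r creR.
    by move/eqP; rewrite mulf_eq0 (gt_eqF d2) orbF => /eqP.
  by have /ltW := le_lt_trans (cim_le _) A; rewrite !cE pi sub0r normrN.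
pose P w := if 0 <= cim w then p w else cj (p (cj w)).
apply: (@cdiff_intro _ _ P).
  apply: (@refl_conH p) => //.
  by move=> e e0; apply: filterS (cont_near pc e0) => w.
have E' : \forall w \near t, inH true (cj w) -> G (cj w) = h (cj w).
  by apply: (@near_cj _ t (fun w => inH true w -> G w = h w)); rewrite tj.
apply: filterS2 E E' => w Ew Ew'; rewrite /refl /P t0; case: ifP => [w0|/negbT].
  by rewrite -Ew // -Gt0 -pE.
rewrite -ltNge => w0; rewrite -Ew'; last by move=> _; rewrite cim_cj oppr_ge0 ltW.
by rewrite pE Gt0 cjD cjM hj cjD cjN cjK tj.
Qed.

Lemma refl_holo h t : 0 <= cim t -> hholo true h t ->
  (cim t = 0 -> \forall w \near t, cim w = 0 -> cim (h w) = 0) -> holo (refl h) t.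
Proof.
move=> t0 cholo hr; have tH : inH true t by [].
have [ti|tn] := eqVneq (cim t) 0; last first.
  apply: holo_near (hholo_holo tH (fun _ => tn) cholo).
  apply: filterS (near_inH tH (fun _ => tn)) => w wH.
  by rewrite /refl (wH isT).
have tj : cj t = t by apply: ceqP; rewrite ?cre_cj ?cim_cj ?ti ?oppr0.
have K : \forall w \near t, 0 <= cim w -> cdiff (refl h) w.
  apply: filterS2 (hholo_near cholo) (near_join (hr ti)) => w hw rw w0.
  by apply: refl_cdiff => // _; exact: rw.
have K' : \forall w \near t, 0 <= cim (cj w) -> cdiff (refl h) (cj w).
  by apply: (@near_cj _ t (fun w => 0 <= cim w -> cdiff (refl h) w)); rewrite tj.
apply: filterS2 K K' => w Kw Kw'; have [w0|w0] := leP 0 (cim w); first exact: Kw.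
have := cdiff_cj (Kw' _); rewrite cim_cj oppr_ge0 (ltW w0) => /(_ isT).
apply: cdiff_near; apply: filterS (near_cim_lt0 w0) => v v0.
by rewrite [RHS]refl_cj // lt_eqF.
Qed.

(** Away from the axis this is [removable]. At a real point the reflection of [h] is continuous at
    [t] and differentiable at all nearby points other than [t]; with its singularity removed it is
    the required extension. *)
Lemma removable_hholo (b : bool) h t : inH b t -> conH b h t ->
  (\forall w \near t, inH b w -> w != t -> hholo b h w) ->
  (b -> cim t = 0 -> \forall w \near t, cim w = 0 -> cim (h w) = 0) -> hholo b h t.
Proof.
move=> tH hc cholo hr.
have [/andP[bT /eqP t0]|/negP bt] := boolP (b && (cim t == 0)); last first.
  have tn : b -> cim t != 0 by move=> b1; apply/negP => t0; apply: bt; rewrite b1.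
  apply: holo_hholo; apply: removable.
    by move=> e e0; apply/nbhsC; apply: filterS2 (hc e e0) (near_inH tH tn) => w + wH; apply.
  apply: filterS2 cholo (near_inH2 tH tn) => w H [wH wn] wt.
  exact: (holo_cdiff (hholo_holo wH wn (H wH wt))).
rewrite bT in tH hc cholo *; have {}hr := hr bT t0; have tp := tH isT.
have tj : cj t = t by apply: ceqP; rewrite ?cre_cj ?cim_cj ?t0 ?oppr0.
have K : \forall w \near t, 0 <= cim w -> w != t -> cdiff (refl h) w.
  apply: filterS2 cholo (near_join hr) => w hw rw w0 wt.
  by apply: refl_cdiff => //; apply: hw.
have K' : \forall w \near t, 0 <= cim (cj w) -> cj w != t -> cdiff (refl h) (cj w).
  by apply: (@near_cj _ t (fun w => 0 <= cim w -> w != t -> cdiff (refl h) w)); rewrite tj.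
exists (refl h); last by apply: (@filterE _ (nbhs t)) => w /(_ isT); rewrite /refl => ->.
apply: removable; first by apply: refl_conH => // _; exact: (nbhs_singleton hr).
apply: filterS2 K K' => w Kw Kw' wt; have [w0|w0] := leP 0 (cim w); first exact: Kw.
have /cdiff_cj := Kw' ltac:(by rewrite cim_cj oppr_ge0 ltW)
  ltac:(by apply: contra wt => /eqP wt; rewrite -(cjK w) wt tj).
apply: cdiff_near; apply: filterS (near_cim_lt0 w0) => v v0.
by rewrite [RHS]refl_cj // lt_eqF.
Qed.

(* A right inverse defined on a half-disc extends by reflection. *)
Lemma right_inverse_hholo (b : bool) f g t : inH b t -> hholo b f (g t) ->
  (\forall w \near t, inH b w -> [/\ inH b (g w), conH b g w & f (g w) = w]) ->
  (b -> cim t = 0 -> \forall w \near t, cim w = 0 -> cim (g w) = 0) ->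
  (b -> cim t = 0 -> \forall w \near g t, cim w = 0 -> cim (f w) = 0) ->
  (b -> cim t != 0 -> cim (g t) != 0) ->
  hholo b g t.
Proof.
move=> tH fl gP gr fr gi; have [gtH gct fgt] := nbhs_singleton gP tH.
have [/andP[bT /eqP t0]|/negP bt] := boolP (b && (cim t == 0)); last first.
  have tn : b -> cim t != 0 by move=> b1; apply/negP => t0; apply: bt; rewrite b1.
  apply: holo_hholo; apply: (@right_inverse _ f).
  - by apply: hholo_holo fl => // b1; apply: gi => //; exact: tn.
  - have := near_inH tH tn; move=> /near_join; apply: filterS2 gP => w gPw wH e e0.
    have [_ gc _] := gPw (nbhs_singleton wH); apply/nbhsC.
    by apply: filterS2 (gc e e0) wH => v + vH; apply.
  - by apply: filterS2 gP (near_inH tH tn) => w + wH => /(_ wH) [].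
rewrite bT in tH gP gtH gct fl *; have {}gr := gr bT t0; have {}fr := fr bT t0.
have tp := tH isT; have gtp := gtH isT.
have tj : cj t = t by apply: ceqP; rewrite ?cre_cj ?cim_cj ?t0 ?oppr0.
have gt0 : cim (g t) = 0 by exact: (nbhs_singleton gr).
have rgt : refl g t = g t by rewrite /refl tp.
have K : \forall w \near t, 0 <= cim w -> [/\ 0 <= cim (g w), cont (refl g) w, f (g w) = w
    & cim (g w) = 0 -> cim (f (g w)) = 0].
  have fr' : \forall w \near t, inH true w -> cim (g w) = 0 -> cim (f (g w)) = 0.
    have /nbhsC[e e0 H] := fr; apply: filterS (gct e e0) => w Hw wH.
    by apply: H; exact: Hw.
  apply: filterS2 (filterI gP fr') (near_join gr) => w [gPw frw] grw w0.
  have [gH gc fg] := gPw (fun _ => w0); split; [exact: gH| |by []|exact: frw].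
  by apply: refl_conH => // ww0; exact: (nbhs_singleton grw).
have K' : \forall w \near t, 0 <= cim (cj w) -> [/\ 0 <= cim (g (cj w)), cont (refl g) (cj w),
    f (g (cj w)) = cj w & cim (g (cj w)) = 0 -> cim (f (g (cj w))) = 0].
  by apply: (@near_cj _ t (fun w => 0 <= cim w -> [/\ 0 <= cim (g w), cont (refl g) w, f (g w) = w
    & cim (g w) = 0 -> cim (f (g w)) = 0])); rewrite tj.
exists (refl g); last by apply: (@filterE _ (nbhs t)) => w /(_ isT); rewrite /refl => ->.
apply: (@right_inverse _ (refl f)); first by rewrite rgt; apply: refl_holo.
  apply: filterS2 K K' => w Kw Kw'; have [w0|w0] := leP 0 (cim w).
    by have [] := Kw w0.
  have w0' : 0 <= cim (cj w) by rewrite cim_cj oppr_ge0 ltW.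
  have [_ /cont_cj gc _ _] := Kw' w0'; apply: cont_eq gc.
  by apply: filterS (near_cim_lt0 w0) => v v0; rewrite [RHS]refl_cj // lt_eqF.
apply: filterS2 K K' => w Kw Kw'; have [w0|w0] := leP 0 (cim w).
  by have [gp _ fg _] := Kw w0; rewrite /refl w0 gp.
have w0' : 0 < cim (cj w) by rewrite cim_cj oppr_gt0.
have [gp _ fg fr0] := Kw' (ltW w0'); have gn : cim (g (cj w)) != 0.
  by apply/eqP => /fr0; rewrite fg => E; rewrite E ltxx in w0'.
have w0n : (0 <= cim w) = false by apply/negbTE; rewrite -ltNge.
have gnn : (0 <= cim (cj (g (cj w)))) = false.
  by apply/negbTE; rewrite -ltNge cim_cj oppr_lt0 lt_def gn gp.
by rewrite /refl w0n gnn cjK fg cjK.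
Qed.

(** A nearby point of local constancy can be moved into the open half-plane. There the extension is
    constant, hence constant on its whole disc by the identity theorem. *)
Lemma hholo_loc_const (b : bool) h t : inH b t -> hholo b h t ->
  (forall e : R, 0 < e -> exists w, [/\ inH b w, cabs (w - t) < e &
     \forall v \near w, inH b v -> h v = h w]) ->
  \forall v \near t, inH b v -> h v = h t.
Proof.
move=> tH [G Gt E] H; have := E; move=> /(filterI Gt)/nbhsC[r r0 rP].
have [w [wH wt hw]] := H r r0.
have [u [ut uH uc]] : exists u, [/\ cabs (u - t) < r, \forall v \near u, inH b v &
    \forall v \near u, h v = h w].
  have [bT|/negP bF] := boolP b; last first.
    exists w; split=> //; first by apply: (@filterE _ (nbhs w)) => v.
    by apply: filterS hw => v; apply => bT; case: (bF bT).
  have := hw; move=> /nbhsC[d d0 dP].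
  have ww : cabs (w - w) < d by rewrite subrr cabs0.
  have [u [ut uw u0]] := inH_ball_up (tH bT) (wH bT) wt ww.
  have uH : \forall v \near u, inH b v.
    by apply: near_inH => _; rewrite ?gt_eqF //; exact: ltW.
  exists u; split=> //; first by apply: filterS uH => v vH _; exact: vH.
  by apply: filterS2 uH (near_cball uw) => v vH vw; apply: dP.
have ob := @open_cball R t r; have tt : cabs (t - t) < r by rewrite subrr cabs0.
have bc : connected [set v : C | cabs (v - t) < r].
  by apply: (@convex_connected _ t) => // v s vr s01; exact: cball_seg.
have Gc : forall v, cabs (v - t) < r -> G v = h w.
  apply: (@identity_theorem _ _ (fun=> h w) u ob bc _ _ ut).
  - by move=> v /rP[].
  - by move=> v _; exact: cdiff_cst.
  by apply: filterS2 (filterI uH (near_cball ut)) uc => v [vH vt] <-; apply: (rP v vt).2.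
apply: filterS (nbhs_cball t r0) => v vt vH.
by rewrite -(rP v vt).2 // -(rP t tt).2 // !Gc.
Qed.

(** [conj_const] works on full neighbourhoods, which points of the open half-plane have;
    [hholo_loc_const] carries constancy from such points back to [t]. *)
Lemma hholo_conj_const (b : bool) h t : inH b t -> hholo b h t -> hholo b (fun w => cj (h w)) t ->
  \forall v \near t, inH b v -> h v = h t.
Proof.
move=> tH ht cht; apply: hholo_loc_const => // e e0.
have := hholo_near cht; move=> /(filterI (hholo_near ht))/(filterI (nbhs_cball t e0))/nbhsC[d d0 dP].
have tt : cabs (t - t) < d by rewrite subrr cabs0.
have [u [ut un uH]] : exists u, [/\ cabs (u - t) < d, b -> cim u != 0 & inH b u].
  have [bT|/negP bF] := boolP b; last by exists t.
  have [u [ut _ u0]] := inH_ball_up (tH bT) (tH bT) tt tt.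
  by exists u; split=> // _; [rewrite gt_eqF|exact: ltW].
have [ue [hu chu]] := dP u ut; exists u; split=> //.
have := conj_const (hholo_holo uH un hu) (hholo_holo uH un chu).
by apply: filterS => v ->.
Qed.

Lemma hholo_isolated (b : bool) h t : inH b t -> hholo b h t ->
  (\forall w \near t, inH b w -> h w = h t) \/
  (\forall w \near t, inH b w -> w != t -> h w != h t).
Proof.
move=> tH [G Gt E]; have Et := nbhs_singleton E tH.
have [H|H] := isolated Gt; [left|right]; apply: filterS2 H E => w Hw Ew wH.
  by rewrite -Ew // -Et.
by move=> wt; rewrite -Ew // -Et Hw.
Qed.

End HalfPlane.

(** * Holomorphic functions in charts *)

Section ChartPoints.
Variable R : realType.
Local Notation C := (Cplx R).
Implicit Types (k : point_kind) (z : C * C) (t : C).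

(* Whether the model k is bordered. *)
Definition bdk k := if k is InteriorNode then false else true.
Definition ax (i : bool) t : C * C := if i then (0, t) else (t, 0).
(* The scalar coordinate: z.1 or z.2, whichever axis z lies on. *)
Definition sc z : C := z.1 + z.2.
(** Off the node a point lies on exactly one axis, and so do its neighbours in the model; this is
    what lets one scalar coordinate describe the surface there. *)
Definition onax k (i : bool) z :=
  [/\ z = ax i (sc z), k = Smooth -> i = false & k <> Smooth -> sc z <> 0].

Lemma sc_ax i t : sc (ax i t) = t.
Proof. by case: i; rewrite /sc /= ?add0r ?addr0. Qed.

Lemma model_ax k z : model k z -> (k <> Smooth -> z <> (0, 0)) ->
  exists i, onax k i z /\ inH (bdk k) (sc z).
Proof.
case: z => a b; case: k => /=.
- move=> [a0 /= ->] _; exists false; split; last by rewrite /sc /= addr0 => _; rewrite -Im_ge0.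
  by split=> //; rewrite /sc /= addr0.
- move=> [/= a0 b0 /eqP]; rewrite mulf_eq0 => /orP[]/eqP E n; subst.
    exists true; rewrite /onax /sc /= add0r; split; last by move=> _; rewrite -Im_ge0.
    by split=> // _ E; apply: n => //; rewrite E.
  exists false; rewrite /onax /sc /= addr0; split; last by move=> _; rewrite -Im_ge0.
  by split=> // _ E; apply: n => //; rewrite E.
- move=> /= /eqP; rewrite mulf_eq0 => /orP[]/eqP E n; subst.
    exists true; rewrite /onax /sc /= add0r; split=> //.
    by split=> // _ E; apply: n => //; rewrite E.
  exists false; rewrite /onax /sc /= addr0; split=> //.
  by split=> // _ E; apply: n => //; rewrite E.
Qed.

Lemma ax_model k i t : (k = Smooth -> i = false) -> inH (bdk k) t -> model k (ax i t).
Proof.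
case: k => /= ki tH.
- by rewrite ki //=; split => //; rewrite Im_ge0; exact: tH.
- by case: i {ki}; split; rewrite /= ?(mul0r, mulr0) // Im_ge0 //; apply: tH.
- by case: i {ki}; rewrite /= ?(mul0r, mulr0).
Qed.

Lemma bdry_ax k i t : (k = Smooth -> i = false) -> inH (bdk k) t ->
  model_boundary k (ax i t) <-> bdk k /\ cim t = 0.
Proof.
move=> ki tH; have m := ax_model ki tH.
have I0 : cim (0 : C) = 0 by [].
case: k ki tH m => /= ki tH m.
- rewrite (ki erefl) /=; rewrite (ki erefl) in m; split; first by move=> [_ [/= /Im_eq0 ? _]].
  by move=> [_ t0]; split=> //; split; apply/Im_eq0.
- case: i ki m => ki m; split; try by move=> [_ [/= /Im_eq0 ? /Im_eq0 ?]].
    by move=> [_ t0]; split=> //; split; apply/Im_eq0.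
  by move=> [_ t0]; split=> //; split; apply/Im_eq0.
- by split=> // -[].
Qed.

Lemma nbhsCC z (P : set (C * C)) : nbhs z P <-> exists2 e : R, 0 < e &
  forall w, cabs (w.1 - z.1) < e -> cabs (w.2 - z.2) < e -> P w.
Proof.
split.
  move=> [[A B] /= [/nbhsC[a a0 Aa] /nbhsC[b b0 Bb]] AB].
  exists (Num.min a b); first by rewrite lt_min a0.
  move=> w; rewrite !lt_min => /andP[wa _] /andP[_ wb]; apply: AB; split=> /=.
    exact: Aa.
  exact: Bb.
move=> [e e0 H]; exists ([set w | cabs (w - z.1) < e], [set w | cabs (w - z.2) < e]).
  by split; exact: nbhs_cball.
by move=> w [/= ? ?]; exact: H.
Qed.

Lemma sc_near z (P : set C) : (\forall w \near sc z, P w) -> \forall w \near z, P (sc w).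
Proof.
move=> /nbhsC[e e0 H]; apply/nbhsCC; exists (e / 2); first by rewrite divr_gt0.
move=> w w1 w2; apply: H; rewrite /sc opprD addrACA; apply: le_lt_trans (cabsD _ _) _; lra.
Qed.

Lemma onax_near k i z : onax k i z -> \forall w \near z, model k w -> onax k i w.
Proof.
move=> [zE ki zn].
have N : k <> Smooth -> \forall w \near z, w.1 * w.2 = 0 -> onax k i w.
  move=> kn; have sn : sc z != 0 by apply/eqP/zn.
  apply/nbhsCC; exists (cabs (sc z)); first by rewrite cabs_gt0.
  move=> [a b] /=; rewrite zE /sc => aw bw /eqP; rewrite mulf_eq0.
  case: i zE ki aw bw => zE ki /= aw bw ab; split=> //.
  + have b0 : b != 0 by apply: contraTN bw => /eqP ->; rewrite sub0r cabsN add0r ltxx.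
    by move: ab; rewrite (negbTE b0) orbF => /eqP ->; rewrite /sc /= add0r.
  + have b0 : b != 0 by apply: contraTN bw => /eqP ->; rewrite sub0r cabsN add0r ltxx.
    by move: ab; rewrite (negbTE b0) orbF => /eqP -> _; rewrite /sc /= add0r; apply/eqP.
  + have b0 : a != 0 by apply: contraTN aw => /eqP ->; rewrite sub0r cabsN addr0 ltxx.
    by move: ab; rewrite (negbTE b0) => /eqP ->; rewrite /sc /= addr0.
  + have b0 : a != 0 by apply: contraTN aw => /eqP ->; rewrite sub0r cabsN addr0 ltxx.
    by move: ab; rewrite (negbTE b0) => /eqP -> _; rewrite /sc /= addr0; apply/eqP.
case: k ki zn N => ki zn N.
- have i0 := ki erefl; subst i; apply: (@filterE _ (nbhs z)) => -[a b] [_ /= ->].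
  by split=> //; rewrite /sc /= addr0.
- by have := N (fun e => ltac:(discriminate)); apply: filterS => w Nw [_ _ /Nw].
- by have := N (fun e => ltac:(discriminate)); apply: filterS => w Nw /Nw.
Qed.

(** The nodal models are not convex, but they are star-shaped about the origin, and their part on
    each axis is convex. *)
Lemma model_seg k z w (s : R) : model k z -> model k w -> 0 <= s <= 1 ->
  (k <> Smooth -> z = (0, 0) \/ exists i, onax k i z /\ onax k i w) ->
  model k (z.1 + cR s * (w.1 - z.1), z.2 + cR s * (w.2 - z.2)).
Proof.
have I (a b : C) : 0 <= cim a -> 0 <= cim b -> 0 <= s <= 1 -> 0 <= cim (a + cR s * (b - a)).
  by move=> a0 b0 s01; rewrite !cE mul0r addr0; nra.
have P : k <> Smooth -> model k w ->
    (z = (0, 0) \/ exists i, onax k i z /\ onax k i w) ->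
    (z.1 + cR s * (w.1 - z.1)) * (z.2 + cR s * (w.2 - z.2)) = 0.
  move=> kn mw; case: k kn mw => // _ mw.
    case=> [->/=|[i [[-> _ _] [-> _ _]]]]; last by case: i; rewrite /= subrr mulr0 addr0 ?(mul0r, mulr0).
    by case: mw => _ _ mw; rewrite !add0r !subr0 mulrACA mw mulr0.
  case=> [->/=|[i [[-> _ _] [-> _ _]]]]; last by case: i; rewrite /= subrr mulr0 addr0 ?(mul0r, mulr0).
  by rewrite !add0r !subr0 mulrACA mw mulr0.
case: k P => P mz mw s01 H.
- case: mz mw => a1 a2 [b1 b2]; split=> /=; last by rewrite a2 b2 subrr mulr0 addr0.
  by rewrite Im_ge0; apply: I; rewrite -?Im_ge0.
- case: (mz) (mw) => a1 a2 _ [b1 b2 _]; split; try by rewrite Im_ge0; apply: I; rewrite -?Im_ge0.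
  by apply: P => //; exact: H.
- by apply: P => //; exact: H.
Qed.

Section OneChart.
Variables (X : topologicalType) (N : set X) (phi : chart R X).
Hypothesis phiP : is_chart N phi.
Local Notation k := (chart_kind phi).
Local Notation dom := (chart_dom phi).
Local Notation m := (chart_map phi).
Local Notation inv := (chart_inv phi).

Lemma ch_open : open dom. Proof. by case: phiP => -[]. Qed.

Lemma ch_dom x : dom x -> \forall y \near x, dom y.
Proof. by have := ch_open; rewrite openE; apply. Qed.

Lemma ch_K x : dom x -> inv (m x) = x.
Proof. by case: phiP => _ _ _ K _ dx; apply: K; rewrite inE. Qed.

Lemma ch_inj x y : dom x -> dom y -> m x = m y -> x = y.
Proof. by move=> dx dy E; rewrite -(ch_K dx) E ch_K. Qed.

Lemma ch_cont x (P : set (C * C)) : dom x -> (\forall z \near m x, P z) ->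
  \forall y \near x, P (m y).
Proof.
case: phiP => _ mc _ _ _ dx Pz; move: mc; rewrite continuous_open_subspace; last exact: ch_open.
by move=> /(_ x); rewrite inE => /(_ dx); apply.
Qed.

Lemma ch_model x : dom x -> model k (m x).
Proof.
case: phiP => -[_ [V _ E]] _ _ _ _ dx; have : (V `&` model k) (m x) by rewrite -E; exists x.
by case.
Qed.

Lemma ch_inv x (U : set X) : dom x -> (\forall y \near x, U y) ->
  \forall z \near m x, model k z -> [/\ U (inv z), dom (inv z) & m (inv z) = z].
Proof.
case: phiP => -[_ [V Vo E]] _ ic _ _ dx Ux.
have Vx : V (m x) by have : (V `&` model k) (m x); [rewrite -E; exists x|case].
move: ic => /subspace_continuousP/(_ (m x)) ic.
have {ic}/ic cv : (m @` dom) (m x) by exists x.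
have H : \forall z \near m x, (m @` dom) z -> U (inv z).
  by apply: cv; change (nbhs (inv (m x)) U); rewrite ch_K.
have nV : \forall z \near m x, V z by move: Vo; rewrite openE; apply.
apply: filterS2 H nV => z Hz Vz mz.
have imz : (m @` dom) z by rewrite E.
by case: (imz) => y dy yz; split; [exact: Hz|rewrite -yz ch_K|rewrite -yz ch_K].
Qed.

Lemma ch_node x : dom x -> k <> Smooth -> (m x = (0, 0) <-> N x).
Proof.
case: phiP => _ _ _ _ + dx kn.
have -> : match k with Smooth => dom `&` N = set0 |
   _ => exists p, m p = (0, 0) /\ dom `&` N = [set p] end =
   (exists p, m p = (0, 0) /\ dom `&` N = [set p]) by case: k kn.
move=> [p [mp dN]]; have [dp Np] : (dom `&` N) p by rewrite dN.
split=> [mx|Nx]; first by rewrite (@ch_inj x p) // mx.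
by have : (dom `&` N) x by []; rewrite dN => ->.
Qed.

Lemma ch_smooth x : dom x -> k = Smooth -> ~ N x.
Proof.
case: phiP => _ _ _ _ + dx kS; rewrite kS => E Nx.
by have : (dom `&` N) x by []; rewrite E.
Qed.

(* [e] parametrises X near x by the scalar coordinate. *)
Definition lpar (e : C -> X) x := let t := sc (m x) in
  [/\ [/\ inH (bdk k) t, dom x, ~ N x & e t = x],
     \forall y \near x, [/\ dom y, ~ N y, inH (bdk k) (sc (m y)) & e (sc (m y)) = y],
     forall U : set X, (\forall y \near x, U y) -> \forall w \near t, inH (bdk k) w -> U (e w),
     \forall w \near t, inH (bdk k) w -> sc (m (e w)) = w &
     forall P : set C, (\forall w \near t, P w) -> \forall y \near x, P (sc (m y))].

Lemma onax_nonnode i x : dom x -> onax k i (m x) -> ~ N x.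
Proof.
move=> dx [mE _ sn]; have [kS|kn] := pselect (k = Smooth); first exact: ch_smooth.
move=> /(ch_node dx kn) mx; apply: (sn kn); rewrite mx /sc /= addr0 //.
Qed.

Lemma lpar_ax i x : dom x -> onax k i (m x) -> lpar (inv \o ax i) x.
Proof.
move=> dx xi; have xE : m x = ax i (sc (m x)) by case: xi.
have ki : k = Smooth -> i = false by case: xi.
have inHm y : dom y -> onax k i (m y) -> inH (bdk k) (sc (m y)).
  move=> dy yi; have [|j [[jE _ _]]] := @model_ax k (m y) (ch_model dy); last by [].
  move=> kn my; apply: (@onax_nonnode i y dy yi); exact/(ch_node dy kn).
have nax : \forall y \near x, onax k i (m y).
  by apply: filterS2 (ch_dom dx) (ch_cont dx (onax_near xi)) => y dy; apply; exact: ch_model.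
have Ke y : dom y -> onax k i (m y) -> (inv \o ax i) (sc (m y)) = y.
  by move=> dy [yE _ _]; rewrite /= -yE ch_K.
have nearax (P : set (C * C)) : (\forall z \near m x, P z) -> \forall w \near sc (m x), P (ax i w).
  rewrite {1}xE => /nbhsCC[e e0 H]; apply/nbhsC; exists e => // w we.
  by apply: H; rewrite /ax; case: (i) => //=; rewrite subrr -[X in X < _]/(cabs (0 : C)) cabs0.
split.
- by split; [exact: inHm| |exact: (@onax_nonnode i)|exact: Ke].
- apply: filterS2 (ch_dom dx) nax => y dy yi.
  by split; [|exact: (@onax_nonnode i)|exact: inHm|exact: Ke].
- move=> U Ux; apply: filterS (nearax _ (ch_inv dx Ux)) => w H wH.
  by case: (H (ax_model ki wH)).
- apply: filterS (nearax _ (ch_inv dx (ch_dom dx))) => w H wH.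
  by case: (H (ax_model ki wH)) => _ _ /= ->; rewrite sc_ax.
- by move=> P Pt; exact: (ch_cont dx (sc_near Pt)).
Qed.

Lemma lparP x : dom x -> ~ N x -> exists i, onax k i (m x) /\
  \forall y \near x, [/\ dom y, onax k i (m y) & lpar (inv \o ax i) y].
Proof.
move=> dx nx; have [|i [xi _]] := model_ax (ch_model dx).
  by move=> kn mx; apply: nx; exact/(ch_node dx kn).
exists i; split=> //.
apply: filterS2 (ch_dom dx) (ch_cont dx (onax_near xi)) => y dy yi.
have {}yi := yi (ch_model dy).
by split=> //; exact: lpar_ax.
Qed.

(* h is analytic at the non-nodal point x, as read in the chart. *)
Definition cholo (h : X -> C) x := exists2 G : C -> C, holo G (sc (m x)) &
  \forall y \near x, h y = G (sc (m y)).

Lemma cholo_hholo e h x : lpar e x -> cholo h x <-> hholo (bdk k) (h \o e) (sc (m x)).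
Proof.
move=> [[tH dx nx ex] near_e eU em mc]; split=> -[G Gt E]; exists G => //.
  by apply: filterS2 (eU _ E) em => w Ew ew wH; rewrite /= Ew // ew.
by apply: filterS2 near_e (mc _ E) => y [_ _ yH ey] Ey; rewrite Ey // /= ey.
Qed.

Lemma cholo_eq h h' x : (\forall y \near x, h y = h' y) -> cholo h x -> cholo h' x.
Proof.
by move=> hh [G Gt E]; exists G => //; apply: filterS2 hh E => y <-.
Qed.

Lemma cholo_sc x : cholo (sc \o m) x.
Proof. by exists id; [exact: holo_id|near=> y]. Unshelve. all: by end_near. Qed.

Lemma choloD h h' x : cholo h x -> cholo h' x -> cholo (fun y => h y + h' y) x.
Proof.
move=> [G Gt E] [G' Gt' E']; exists (fun w => G w + G' w); first exact: holoD.
by apply: filterS2 E E' => y -> ->.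
Qed.

Lemma lpar_const e (h : X -> C) x : lpar e x ->
  (\forall y \near x, h y = h x) <->
  \forall w \near sc (m x), inH (bdk k) w -> (h \o e) w = (h \o e) (sc (m x)).
Proof.
move=> [[tH dx nx ex] near_e eU em mc]; split=> H.
  by apply: filterS (eU _ H) => w; rewrite /= ex.
by apply: filterS2 near_e (mc _ H) => y [_ _ yH ey]; rewrite /= ey ex; apply.
Qed.

Lemma cholo_isolated (h : X -> C) x : dom x -> ~ N x -> cholo h x ->
  (\forall y \near x, h y = h x) \/ (\forall y \near x, y <> x -> h y <> h x).
Proof.
move=> dx nx hx; have [i [_ ni]] := lparP dx nx; have [_ _ lx] := nbhs_singleton ni.
have [[tH _ _ ex] near_e eU em mc] := lx.
have [H|H] := hholo_isolated tH ((cholo_hholo _ lx).1 hx); first by left; exact/(lpar_const _ lx).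
right; apply: filterS2 near_e (mc _ H) => y [dy _ yH ey] /(_ yH) + yx.
have hy : (h \o (inv \o ax i)) (sc (m y)) = h y by rewrite -[in RHS]ey.
have hx' : (h \o (inv \o ax i)) (sc (m x)) = h x by rewrite -[in RHS]ex.
rewrite hy hx' => {}H; apply/eqP; apply: H; apply/eqP => E; apply: yx.
by rewrite -ey E.
Qed.

Lemma cholo_loc_const (h : X -> C) x : dom x -> ~ N x -> cholo h x ->
  (forall U : set X, (\forall y \near x, U y) ->
     exists y, [/\ U y & \forall v \near y, h v = h y]) ->
  \forall y \near x, h y = h x.
Proof.
move=> dx nx hx H; have [i [_ ni]] := lparP dx nx; have [_ _ lx] := nbhs_singleton ni.
have [[tH _ _ ex] near_e eU em mc] := lx.
apply/(lpar_const _ lx); apply: hholo_loc_const => //; first exact/(cholo_hholo _ lx).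
move=> d d0; have [y [[[dy _ ly] yd] yc]] := H _ (filterI ni (mc _ (nbhs_cball _ d0))).
have [[yH _ _ ey] _ _ _ _] := ly.
by exists (sc (m y)); split; [exact: yH|exact: yd|exact/(lpar_const h ly)].
Qed.

Lemma cholo_conj_const h x : dom x -> ~ N x -> cholo h x -> cholo (fun y => cj (h y)) x ->
  \forall y \near x, h y = h x.
Proof.
move=> dx nx hx chx; have [i [_ ni]] := lparP dx nx; have [_ _ lx] := nbhs_singleton ni.
have [[tH _ _ ex] near_e eU em mc] := lx.
apply/(lpar_const _ lx); apply: hholo_conj_const; first exact: tH.
  exact: ((cholo_hholo h lx).1 hx).
exact: ((cholo_hholo (fun y => cj (h y)) lx).1 chx).
Qed.

Lemma cholo_min h x : dom x -> ~ N x -> cholo h x -> ~ model_boundary k (m x) ->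
  (\forall y \near x, 0 <= cim (h y)) -> cim (h x) = 0 -> \forall y \near x, h y = h x.
Proof.
move=> dx nx hx nb hp h0; have [i [xi ni]] := lparP dx nx; have [_ _ lx] := nbhs_singleton ni.
have [[tH _ _ ex] near_e eU em mc] := lx.
have tn : bdk k -> cim (sc (m x)) != 0.
  move=> kb; apply/eqP => t0; apply: nb; have [-> ki _] := xi.
  by apply/bdry_ax => //; rewrite sc_ax.
apply/(lpar_const _ lx).
have := min_principle (hholo_holo tH tn ((cholo_hholo _ lx).1 hx)).
have nH := near_inH tH tn.
have hp' : \forall w \near sc (m x), 0 <= cim ((h \o (inv \o ax i)) w).
  by apply: filterS2 (eU _ hp) nH => w; apply.
have h0' : cim ((h \o (inv \o ax i)) (sc (m x))) = 0 by rewrite -[in RHS]h0 -[in RHS]ex.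
by move=> /(_ hp' h0'); apply: filterS => w ->.
Qed.

Lemma cholo_removable (h : X -> C) x : dom x -> ~ N x ->
  (forall P : set C, (\forall w \near h x, P w) -> \forall y \near x, P (h y)) ->
  (\forall y \near x, y <> x -> cholo h y) ->
  (\forall y \near x, model_boundary k (m y) -> cim (h y) = 0) ->
  cholo h x.
Proof.
move=> dx nx hc hh hb; have [i [xi ni]] := lparP dx nx; have [_ _ lx] := nbhs_singleton ni.
have [[tH _ _ ex] near_e eU em mc] := lx.
have ki : k = Smooth -> i = false by case: xi.
have hex : (h \o (inv \o ax i)) (sc (m x)) = h x by rewrite -[in RHS]ex.
apply/(cholo_hholo _ lx); apply: removable_hholo => //.
- move=> e e0; have := eU _ (hc _ (nbhs_cball _ e0)).
  by apply: filterS => w H wH; rewrite hex; exact: H.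
- apply: filterS2 (eU _ (filterI hh ni)) em => w Hw ew wH wt.
  have [{}Hw [dw wi lw]] := Hw wH.
  have := Hw _; rewrite [in X in hholo _ _ X](_ : w = sc (m ((inv \o ax i) w))); last by rewrite ew.
  move=> {}Hw; apply/(cholo_hholo _ lw)/Hw => E; move: wt; rewrite -(ew wH) E eqxx //.
- move=> kb t0; apply: filterS2 (eU _ (filterI hb ni)) em => w Hw ew w0.
  have wH : inH (bdk k) w by move=> _; rewrite w0.
  have [{}Hw [dw [wE _ _] lw]] := Hw wH; apply: Hw; rewrite wE; apply/bdry_ax => //.
    by rewrite ew.
  by split; rewrite ?ew.
Qed.

End OneChart.

Definition cjb (b : bool) t : C := if b then cj t else t.

Lemma cjbK b : involutive (cjb b).
Proof. by case: b => //; exact: cjK. Qed.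

Lemma cjb_addb b c t : cjb (b (+) c) t = cjb b (cjb c t).
Proof. by case: b c => [] [] //=; rewrite cjK. Qed.

Lemma cjbD b t t' : cjb b (t + t') = cjb b t + cjb b t'.
Proof. by case: b => //; exact: cjD. Qed.

(** Conjugating a holomorphic function on both sides leaves it holomorphic, so the conjugation that
    corrects [f] can be moved across [h]. *)
Lemma cholo_comp_cj (X Y : topologicalType) (phi : chart R X) (psi : chart R Y) (f : X -> Y)
    (h : Y -> C) b x :
  (forall P : set Y, (\forall y \near f x, P y) -> \forall y \near x, P (f y)) ->
  cholo phi (cjb b \o sc \o chart_map psi \o f) x -> cholo psi h (f x) ->
  cholo phi (cjb b \o h \o f) x.
Proof.
move=> fc [G Gt E] [G' Gt' E']; exists (cjb b \o G' \o cjb b \o G).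
  apply: (@holo_comp R G) => //; have <- := nbhs_singleton E; rewrite /= .
  case: b {E} => //=; apply: (@holo_cj R G'); by rewrite cjK.
by apply: filterS2 E (fc _ E') => y /= <- ->; rewrite cjbK.
Qed.

End ChartPoints.

(** * Analytic and antianalytic maps in charts *)

Section Bridge.
Variable R : realType.
Local Notation C := (Cplx R).

Definition pj (j : bool) (z : C * C) : C := if j then z.2 else z.1.
Definition cj2b (b : bool) (g : C * C -> C * C) : C * C -> C * C :=
  if b then @conj2 R \o g else g.

Lemma pj_cj2b b j g z : pj j (cj2b b g z) = cjb b (pj j (g z)).
Proof. by case: b j => [] []; rewrite /= ?cjE. Qed.

Lemma pj_eq (z w : C * C) : (forall j, pj j z = pj j w) -> z = w.
Proof. by case: z w => a b [c d] H; have /= -> := H true; have /= -> := H false. Qed.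

Lemma analyticE k S (g : C * C -> C * C) :
  analytic k S g <-> forall i j, analytic_on [set t | regular_part k S (ax i t)] (fun t => pj j (g (ax i t))).
Proof.
split; first by move=> [a b c d] [] [].
by move=> H; split; [exact: (H false false)|exact: (H false true)|exact: (H true false)|exact: (H true true)].
Qed.

Lemma regularP k S (z : C * C) : regular_part k S z <-> S z /\ (k <> Smooth -> z <> (0, 0)).
Proof.
case: k => /=; first by split=> [|[]].
  by split=> [[Sz nz]|[Sz nz]]; split=> //; exact: nz.
by split=> [[Sz nz]|[Sz nz]]; split=> //; exact: nz.
Qed.

(* The coordinate j of f in the chart psi, conjugated if b holds. *)
Definition crd (X Y : topologicalType) (b j : bool) (psi : chart R Y) (f : X -> Y) (x : X) : C :=
  cjb b (pj j (chart_map psi (f x))).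

Section Local.
Variables (X Y : topologicalType) (N : set X) (phi : chart R X) (psi : chart R Y) (f : X -> Y).
Hypothesis phiP : is_chart N phi.
Local Notation k := (chart_kind phi).
Local Notation dom := (chart_dom phi).
Local Notation m := (chart_map phi).
Local Notation inv := (chart_inv phi).

Lemma analytic_cholo b S x : dom x -> ~ N x -> (\forall y \near x, S (m y)) ->
  analytic k S (cj2b b (local_expr phi psi f)) -> forall j, cholo phi (crd b j psi f) x.
Proof.
move=> dx nx Sx /analyticE H j; have [i [[xE ki sn] ni]] := lparP phiP dx nx.
have [W [G [Wo DW Gh GE]]] := H i j.
have D y : dom y -> onax k i (m y) -> S (m y) -> regular_part k S (ax i (sc (m y))).
  move=> dy yi Sy; have [<- _ syn] := yi; apply/regularP; split=> // kn my.
  by apply: (syn kn); rewrite my /sc /= addr0.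
exists G.
  have Wx : W (sc (m x)) by apply: DW; apply: D => //; exact: (nbhs_singleton Sx).
  move: Wo; rewrite openE => /(_ _ Wx); apply: filterS => w Ww.
  by apply/cdiffP/Gh.
apply: filterS2 ni Sx => y [dy yi _] Sy; rewrite GE; last by rewrite inE; exact: D.
by case: yi => yE _ _; rewrite pj_cj2b /local_expr /crd /= -yE (ch_K phiP).
Qed.

Lemma cholo_analytic b S : S `<=` m @` dom ->
  (forall x, dom x -> ~ N x -> S (m x) -> forall j, cholo phi (crd b j psi f) x) ->
  analytic k S (cj2b b (local_expr phi psi f)).
Proof.
move=> Sd H; apply/analyticE => i j.
have Sm z : S z -> model k z by move=> /Sd[x dx <-]; exact: (ch_model phiP).
have [[kS i1]|ki] := pselect (k = Smooth /\ i = true).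
  exists setT, (fun=> pj j (cj2b b (local_expr phi psi f) (ax i 0))); split=> //.
  - exact: openT.
  move=> t; rewrite inE => /regularP[/Sm + _]; rewrite i1 kS /= => -[_ t0].
  by rewrite t0.
apply: (@glue R (bdk k)) => t /regularP[St tn].
have [x dx xE] := Sd _ St.
have nx : ~ N x.
  have [kS|kn] := pselect (k = Smooth); first exact: (ch_smooth phiP dx kS).
  by move=> Nx; apply: (tn kn); rewrite -xE; apply/(ch_node phiP dx kn).
have xi : onax k i (m x).
  rewrite /onax xE sc_ax; split=> //; first by case: (i) ki => // ki kS; case: ki.
  by move=> kn t0; apply: (tn kn); rewrite t0; case: (i).
have [l1 l2 l3 l4 l5] := lpar_ax phiP dx xi.
have [tH _ _ _] := l1; rewrite xE sc_ax in tH; split=> //.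
have := (cholo_hholo _ (lpar_ax phiP dx xi)).1 (H x dx nx ltac:(by rewrite xE) j).
rewrite xE sc_ax => -[G Gt E]; exists G => //.
by apply: filterS E => w Ew wH; rewrite Ew // pj_cj2b.
Qed.

Lemma pair_seg_continuous (z w : C * C) :
  continuous (fun s : R => (z.1 + cR s * (w.1 - z.1), z.2 + cR s * (w.2 - z.2))).
Proof.
move=> s A /nbhsCC[e e0 H].
have c1 : \forall t \near s, cabs ((z.1 + cR t * (w.1 - z.1)) - (z.1 + cR s * (w.1 - z.1))) < e.
  exact: (@seg_continuous R z.1 (w.1 - z.1) s _ (nbhs_cball _ e0)).
have c2 : \forall t \near s, cabs ((z.2 + cR t * (w.2 - z.2)) - (z.2 + cR s * (w.2 - z.2))) < e.
  exact: (@seg_continuous R z.2 (w.2 - z.2) s _ (nbhs_cball _ e0)).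
change (\forall t \near s, A (z.1 + cR t * (w.1 - z.1), z.2 + cR t * (w.2 - z.2))).
by apply: filterS2 c1 c2 => t t1 t2; apply: H.
Qed.

(** Short segments issuing from [m x] stay in the model, hence in [S]. At a node they enter both
    branches, which is how the two come to have the same sign. *)
Lemma near_component (S : set (C * C)) x : dom x -> (\forall y \near x, S (m y)) ->
  \forall y \near x, connected_component S (m x) (m y).
Proof.
move=> dx Sx; have := ch_inv phiP dx Sx; move=> /nbhsCC[e e0 H].
have HS z : model k z -> cabs (z.1 - (m x).1) < e -> cabs (z.2 - (m x).2) < e -> S z.
  by move=> mz z1 z2; have [+ _ <-] := H z z1 z2 mz.
have near_e : \forall y \near x, cabs ((m y).1 - (m x).1) < e /\ cabs ((m y).2 - (m x).2) < e.
  apply: (@ch_cont R X N phi phiP x (fun v => cabs (v.1 - (m x).1) < e /\ cabs (v.2 - (m x).2) < e) dx).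
  by apply/nbhsCC; exists e.
have near_ax : \forall y \near x, k <> Smooth -> m x = (0, 0) \/ exists i, onax k i (m x) /\ onax k i (m y).
  have [nx|nx] := pselect (N x).
    by near=> y => kn; left; apply/(ch_node phiP dx kn).
  have [i [xi ni]] := lparP phiP dx nx.
  by apply: filterS ni => y [dy yi _] kn; right; exists i.
apply: filterS2 (filterI near_e (ch_dom phiP dx)) near_ax => y [[y1 y2] dy] yax.
pose p (s : R) := ((m x).1 + cR s * ((m y).1 - (m x).1), (m x).2 + cR s * ((m y).2 - (m x).2)).
have p0 : p 0 = m x by rewrite /p !mul0r !addr0; case: (m x).
have p1 : p 1 = m y.
  by rewrite /p !mul1r ![_ + (_ - _)]addrC !subrK; case: (m y).
have pI : connected (p @` `[0, 1]).
  apply: connected_continuous_connected; first exact: segment_connected.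
  by apply: continuous_subspaceT; exact: pair_seg_continuous.
have I0 : (p @` `[0, 1]) (m x) by exists 0 => //=; rewrite in_itv /= lexx ler01.
have I1 : (p @` `[0, 1]) (m y) by exists 1 => //=; rewrite in_itv /= lexx ler01.
apply: (connected_component_max I0 _ pI) => // _ [s /= + <-]; rewrite in_itv /= => s01.
apply: HS; first by apply: model_seg => //; exact: (ch_model phiP).
  rewrite /= addrC addKr cabsM cabs_cR ger0_norm; last by case/andP: s01.
  apply: le_lt_trans y1; rewrite ler_piMl ?cabs_ge0 //; by case/andP: s01.
rewrite /= addrC addKr cabsM cabs_cR ger0_norm; last by case/andP: s01.
by apply: le_lt_trans y2; rewrite ler_piMl ?cabs_ge0 //; case/andP: s01.
Unshelve. all: by end_near. Qed.

(* f is analytic (b = false) or antianalytic (b = true) at all smooth points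
   near x. *)
Definition signed_at b (x : X) := \forall y \near x, ~ N y -> forall j, cholo phi (crd b j psi f) y.

Lemma signed_at_near b x : signed_at b x -> \forall y \near x, signed_at b y.
Proof. by move/near_join. Qed.

Hypothesis psio : open (chart_dom psi).
Hypothesis fc : continuous f.

Lemma near_dom x : dom x -> chart_dom psi (f x) -> \forall y \near x, dom y /\ chart_dom psi (f y).
Proof.
move=> dx dfx; apply: filterI; first exact: (ch_dom phiP).
by apply: fc; move: psio; rewrite openE; apply.
Qed.

Lemma near_local_dom x : dom x -> chart_dom psi (f x) ->
  \forall y \near x, local_dom phi psi f (m y).
Proof. by move=> dx /(near_dom dx); apply: filterS => y [dy dfy]; exists y. Qed.

Lemma analytic_signed_at b x : dom x -> chart_dom psi (f x) ->
  analytic k (local_dom phi psi f) (cj2b b (local_expr phi psi f)) -> signed_at b x.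
Proof.
move=> dx dfx H; apply: filterS2 (near_dom dx dfx) (near_join (near_local_dom dx dfx)).
by move=> y [dy dfy] Sy ny; exact: (@analytic_cholo b _ y dy ny Sy).
Qed.

Lemma dianalytic_signed_at x : dom x -> chart_dom psi (f x) ->
  dianalytic k (local_dom phi psi f) (local_expr phi psi f) -> exists b, signed_at b x.
Proof.
move=> dx dfx H; have Sx : local_dom phi psi f (m x) by exists x.
have near_c := near_join (near_component dx (near_local_dom dx dfx)).
suff K b : analytic k (connected_component (local_dom phi psi f) (m x))
    (cj2b b (local_expr phi psi f)) -> signed_at b x.
  by case: (H _ Sx) => ?; [exists false|exists true]; exact: K.
move=> Hb; apply: filterS2 (near_dom dx dfx) near_c => y [dy dfy] Sy ny.
exact: (@analytic_cholo b _ y dy ny Sy).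
Qed.

Lemma signed_at_analytic b : (forall x, dom x -> chart_dom psi (f x) -> signed_at b x) ->
  analytic k (local_dom phi psi f) (cj2b b (local_expr phi psi f)).
Proof.
move=> H; apply: cholo_analytic; first by move=> z [x [dx _] <-]; exists x.
move=> x dx nx [y [dy dfy] /(ch_inj phiP dy dx) xy]; rewrite xy in dfy.
exact: (nbhs_singleton (H x dx dfy)).
Qed.

(** The points of sign [b] are the trace of an open set [O b] on the domain. The two traces are
    disjoint and cover it, so the sign is constant on each connected component. *)
Lemma signed_at_dianalytic : (forall x, dom x -> chart_dom psi (f x) -> exists b, signed_at b x) ->
  (forall x b, dom x -> chart_dom psi (f x) -> signed_at b x -> signed_at (~~ b) x -> False) ->
  dianalytic k (local_dom phi psi f) (local_expr phi psi f).
Proof.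
move=> H1 H2 z Sz; have [x0 [dx0 dfx0] x0z] := Sz.
have [b0 AN0] := H1 x0 dx0 dfx0.
set S := local_dom phi psi f; set Cz := connected_component S z.
pose O (b : bool) : set (C * C) := [set w : C * C | \forall v \near w, model k v ->
  exists x, [/\ dom x, chart_dom psi (f x), m x = v & signed_at b x]].
have Oo b : open (O b) by rewrite openE => w Hw; exact: (near_join Hw).
have OP b x : dom x -> chart_dom psi (f x) -> signed_at b x -> O b (m x).
  move=> dx dfx Ax.
  have nx : \forall y \near x, (dom y /\ chart_dom psi (f y)) /\ signed_at b y.
    by apply: filterS2 (near_dom dx dfx) (signed_at_near Ax).
  by apply: filterS (ch_inv phiP dx nx) => v Hv mv; have [[[? ?] ?] ? ?] := Hv mv; exists (inv v).
have PO b x : dom x -> chart_dom psi (f x) -> O b (m x) -> signed_at b x.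
  move=> dx dfx /nbhs_singleton /(_ (ch_model phiP dx)) [y [dy _ yx Ay]].
  by rewrite (ch_inj phiP dx dy (esym yx)).
have CS : Cz `<=` S := @connected_component_sub _ _ _.
have E : Cz `&` O b0 = Cz.
  apply: (component_connected (A := S) (x := z)).
  - exists z; split; first exact: connected_component_refl.
    by rewrite -x0z; exact: OP.
  - by exists (O b0).
  exists (~` O (~~ b0)); first exact: open_closedC.
  apply/seteqP; split=> w [Cw Ow]; split=> //.
    move=> Ow'; have [x [dx dfx] xw] := CS _ Cw; rewrite -xw in Ow Ow'.
    by apply: (H2 x b0) => //; exact: PO.
  have [x [dx dfx] xw] := CS _ Cw; rewrite -xw in Ow *.
  have [b Ab] := H1 x dx dfx; have [<-|bb] := eqVneq b b0; first exact: OP.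
  by exfalso; apply: Ow; apply: OP => //; move: bb Ab; case: (b); case: (b0).
suff K : analytic k Cz (cj2b b0 (local_expr phi psi f)).
  by case: (b0) K => K; [right|left].
apply: cholo_analytic; first by move=> w /CS[x [dx _] <-]; exists x.
move=> x dx nx; rewrite -E => -[/CS[y [dy dfy] /(ch_inj phiP dy dx) xy] Ox].
by rewrite xy in dfy; exact: (nbhs_singleton (PO _ _ dx dfy Ox)).
Qed.

Lemma analytic_near_signed_at x : analytic_near phi psi f x <->
  [/\ dom x, chart_dom psi (f x) & signed_at false x].
Proof.
split.
  move=> [U [Uo Ux Ud H]]; have [dx dfx] := Ud _ Ux; split=> //.
  have nU y : U y -> \forall v \near y, U v by move: Uo; rewrite openE; apply.
  apply: filterS (nU x Ux) => y Uy ny j; have [dy dfy] := Ud _ Uy.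
  apply: (@analytic_cholo false _ y dy ny _ H).
  by apply: filterS (nU y Uy) => v Uv; exists v.
move=> [dx dfx Ax].
pose U := (dom `&` f @^-1` chart_dom psi) `&`
  [set y | \forall v \near y, ~ N v -> forall j, cholo phi (crd false j psi f) v].
exists U; split.
- apply: openI; first by apply: openI; [exact: (ch_open phiP)|exact: open_comp].
  by rewrite openE => y Hy; exact: (near_join Hy).
- by [].
- by move=> y [].
apply: (@cholo_analytic false); first by move=> _ [y [[dy _] _] <-]; exists y.
move=> y dy ny [v [[dv _] Uv] /(ch_inj phiP dv dy) vy].
by rewrite vy in Uv; exact: (nbhs_singleton Uv).
Qed.

End Local.
End Bridge.

(** * Maps between nodal surfaces *)

Arguments nodes {R} _ _.
Arguments atlas {R} _ _.
Arguments boundary {R} _ _.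
Section Surfaces.
Variable R : realType.
Local Notation C := (Cplx R).
Implicit Types (X Y Z : nodal_data R).

(* What Riemann and Klein surfaces have in common. *)
Definition presurf X :=
  [/\ hausdorff_space (points X), finite_set (nodes X), atlas X `<=` is_chart (nodes X),
     forall p : X, exists2 phi, atlas X phi & chart_dom phi p &
     in_charts (@dianalytic R) (atlas X) (atlas X) idfun].

(* The local form of [nonconstant]. *)
Definition nowhere_const X Y (f : X -> Y) := forall x : X, ~ nodes X x -> ~ (\forall y \near x, f y = f x).

Lemma near_map (X Y : topologicalType) (f : X -> Y) x (P : set Y) :
  {for x, continuous f} -> (\forall y \near f x, P y) -> \forall y \near x, P (f y).
Proof. by move=> fc Pf; exact: (fc P Pf). Qed.

Lemma crd_const (X Y : topologicalType) (N : set Y) (psi : chart R Y) (f : X -> Y) b x :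
  is_chart N psi -> {for x, continuous f} -> chart_dom psi (f x) ->
  (forall j, \forall y \near x, crd b j psi f y = crd b j psi f x) ->
  \forall y \near x, f y = f x.
Proof.
move=> psiP fc dfx H; have nd : \forall y \near x, chart_dom psi (f y).
  by apply: fc; exact: (ch_dom psiP).
apply: filterS2 nd (filterI (H true) (H false)) => y dfy [/(can_inj (cjbK b)) E1 /(can_inj (cjbK b)) E2].
by apply: (ch_inj psiP) => //; apply: pj_eq => -[].
Qed.

Lemma real_shift_near (t : C) (P : set C) : (\forall w \near t, P w) ->
  exists2 d : R, 0 < d & P (t + cR d).
Proof.
move=> /nbhsC[e e0 H]; exists (e / 2); first by rewrite divr_gt0.
apply: H; rewrite addrC addKr cabs_cR gtr0_norm ?divr_gt0 //; lra.
Qed.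

Lemma cabs_sub0 (e : R) : 0 < e -> cabs (0 - 0 : C) < e.
Proof. by move=> e0; rewrite subrr cabs0. Qed.

Lemma inH_shift b (t : C) (d : R) : inH b t -> inH b (t + cR d).
Proof. by move=> tH /tH; rewrite !cE addr0. Qed.

Section Pre.
Variable X : nodal_data R.
Hypothesis Xp : presurf X.
Local Notation N := (nodes X).

Lemma psC phi : atlas X phi -> is_chart N phi.
Proof. by case: Xp => _ _ + _ _ => /(_ phi). Qed.

Lemma ps_cov p : exists2 phi, atlas X phi & chart_dom phi p.
Proof. by case: Xp. Qed.

Lemma nodes_near (x : X) : \forall y \near x, y <> x -> ~ N y.
Proof.
have [Xh Nf _ _ _] := Xp.
have cl : closed (N `\ x).
  by apply: (accessible_finite_set_closed.1 (hausdorff_accessible Xh)); exact: finite_setD.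
have : open (~` (N `\ x)) by exact: closed_openC.
rewrite openE => /(_ x); have nx : (~` (N `\ x)) x by move=> [_ /=]; apply.
move=> /(_ nx); apply: filterS => y ny yx Ny; exact: ny.
Qed.

Lemma nonnode_near (x : X) : ~ N x -> \forall y \near x, ~ N y.
Proof.
move=> nx; apply: filterS (nodes_near x) => y H Ny.
by have [yx|yx] := pselect (y = x); [apply: nx; rewrite -yx|exact: H].
Qed.

Lemma nonnode_dense (x : X) (U : set X) : (\forall y \near x, U y) -> exists2 y, U y & ~ N y.
Proof.
move=> Ux; have [Nx|nx] := pselect (N x); last by exists x => //; exact: (nbhs_singleton Ux).
have [phi Aphi dx] := ps_cov x; have phiP := psC Aphi.
have kn : chart_kind phi <> Smooth by move=> /(ch_smooth phiP dx).
have mx := (ch_node phiP dx kn).2 Nx.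
have := ch_inv phiP dx Ux; rewrite mx => /nbhsCC[e e0 H].
have e2 : 0 < e / 2 by rewrite divr_gt0.
pose t : C := cR (e / 2); have te : cabs t < e by rewrite cabs_cR gtr0_norm //; lra.
have [||| Uy dy my] := H (ax false t).
- exact: (eq_ind_r (fun v => cabs v < e) te (subr0 t)).
- exact: cabs_sub0.
- apply: ax_model => // _; rewrite /t cimR //.
exists (chart_inv phi (ax false t)) => //.
move=> /(ch_node phiP dy kn); rewrite my => -[] t0.
by move: e2; rewrite t0 ltxx.
Qed.

Lemma nowhere_const_id : nowhere_const (idfun : X -> X).
Proof.
move=> x nx H; have [phi Aphi dx] := ps_cov x; have phiP := psC Aphi.
have [i [xi ni]] := lparP phiP dx nx; have [_ _ [[tH _ _ ex] ne eU em mc]] := nbhs_singleton ni.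
have [d d0 [H1 H2]] := real_shift_near (filterI (eU _ H) em).
have E : (chart_inv phi \o ax i) (sc (chart_map phi x) + cR d) = x := H1 (inH_shift _ tH).
have := H2 (inH_shift _ tH); rewrite E => /eqP.
by rewrite -subr_eq0 opprD addrA subrr add0r oppr_eq0 -cabs_eq0 cabs_cR normr_eq0 gt_eqF.
Qed.

End Pre.

Section Maps.
Variables X Y : nodal_data R.
Hypotheses (Xp : presurf X) (Yp : presurf Y).
Variable f : X -> Y.
Hypotheses (fc : continuous f) (fn : nowhere_const f).

Lemma near_charts phi psi x : atlas X phi -> atlas Y psi -> chart_dom phi x -> chart_dom psi (f x) ->
  \forall y \near x, chart_dom phi y /\ chart_dom psi (f y).
Proof.
by move=> Aphi Apsi dx dfx; apply: near_dom => //; [exact: psC|exact: (ch_open (psC Yp Apsi))].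
Qed.

Lemma signed_at_excl phi psi x b : atlas X phi -> atlas Y psi -> chart_dom phi x -> chart_dom psi (f x) ->
  signed_at (nodes X) phi psi f b x -> signed_at (nodes X) phi psi f (~~ b) x -> False.
Proof.
move=> Aphi Apsi dx dfx A1 A2.
have [y [[dy dfy] [h1 h2]] ny] := nonnode_dense Xp (filterI (near_charts Aphi Apsi dx dfx) (filterI A1 A2)).
apply: (fn ny); apply: (@crd_const _ _ _ psi f false y (psC Yp Apsi) (@fc y) dfy) => j.
have {}h1 := h1 ny j; have {}h2 := h2 ny j.
apply: (cholo_conj_const (psC Xp Aphi) dy ny).
  by case: b h1 h2 {A1 A2}.
by case: b h1 h2 {A1 A2}.
Qed.

Lemma im_ge0_psi psi x j : atlas Y psi -> chart_dom psi (f x) -> bdk (chart_kind psi) ->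
  0 <= cim (pj j (chart_map psi (f x))).
Proof.
move=> Apsi dfx; have := ch_model (psC Yp Apsi) dfx; case: (chart_kind psi) => //=.
  by case: j => -[m1 m2] _; rewrite /= ?m2 // -Im_ge0.
by case: j => -[m1 m2 _] _; rewrite /= -Im_ge0.
Qed.

Lemma model_boundary_im k (z : C * C) : model_boundary k z -> bdk k /\ forall j, cim (pj j z) = 0.
Proof.
by case: k => // -[_ /= [/Im_eq0 ? /Im_eq0 ?]]; split=> // -[].
Qed.

(* Normalisation of a possibly antianalytic coordinate to an analytic function
   with nonnegative imaginary part. *)
Definition ncj (b : bool) (z : C) : C := if b then - cj z else z.

Lemma ncj_inj b : injective (ncj b).
Proof.
by case: b => z w //=; move=> /oppr_inj /(can_inj (@cjK R)).
Qed.

Lemma cim_ncj b z : cim (ncj b z) = cim z.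
Proof. by case: b; rewrite //= cimN cim_cj opprK. Qed.

Lemma cholo_ncj phi psi x b j : cholo phi (crd b j psi f) x ->
  cholo phi (fun y => ncj b (pj j (chart_map psi (f y)))) x.
Proof.
rewrite /crd; case: b => //= -[G Gt E]; exists (fun w => - G w); first exact: holoN.
by apply: filterS E => y ->.
Qed.

Lemma ncj_const psi x b : (forall j, \forall y \near x,
    ncj b (pj j (chart_map psi (f y))) = ncj b (pj j (chart_map psi (f x)))) ->
  forall j, \forall y \near x, crd false j psi f y = crd false j psi f x.
Proof. by move=> H j; apply: filterS (H j) => y /ncj_inj. Qed.

(* By the minimum principle for the imaginary part, an interior point is not
   mapped to the boundary. *)
Lemma boundary_pull phi psi x b : atlas X phi -> atlas Y psi -> chart_dom phi x ->
  chart_dom psi (f x) -> signed_at (nodes X) phi psi f b x ->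
  model_boundary (chart_kind psi) (chart_map psi (f x)) ->
  model_boundary (chart_kind phi) (chart_map phi x).
Proof.
move=> Aphi Apsi dx dfx A /model_boundary_im[kb fx0].
have phiP := psC Xp Aphi; have psiP := psC Yp Apsi.
have nd := near_charts Aphi Apsi dx dfx.
pose h j y := ncj b (pj j (chart_map psi (f y))).
have hp j : \forall y \near x, 0 <= cim (h j y).
  by apply: filterS nd => y [_ dfy]; rewrite cim_ncj; exact: im_ge0_psi.
have h0 j : cim (h j x) = 0 by rewrite cim_ncj.
apply: contrapT => nb; have [Nx|nx] := pselect (nodes X x); last first.
  apply: (fn nx); apply: (@crd_const _ _ _ psi f false x psiP (@fc x) dfx).
  apply: (@ncj_const _ _ b) => j; apply: (cholo_min phiP dx nx _ nb (hp j) (h0 j)).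
  by apply: cholo_ncj; exact: (nbhs_singleton A).
(* A boundary node lies on the boundary, so [x] is an interior node. Along one branch the
   coordinates of [f] extend holomorphically over the node and are constant by the minimum
   principle, against [nowhere_const] at a nearby point of that branch. *)
have kn : chart_kind phi <> Smooth by move=> /(ch_smooth phiP dx).
have mx := (ch_node phiP dx kn).2 Nx.
have kI : chart_kind phi = InteriorNode.
  move: nb kn; rewrite mx; case: (chart_kind phi) => //= nb _; exfalso; apply: nb.
  have I0 : ('Im (0 : C) = 0)%R by apply/Im_eq0.
  by split; split=> //=; rewrite ?I0 ?mulr0.
pose e w := chart_inv phi (ax false w).
have e0 : e 0 = x by rewrite /e /ax -mx (ch_K phiP).
have ne (U : set X) : (\forall y \near x, U y) -> \forall w \near (0 : C), [/\ U (e w), chart_dom phi (e w)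
    & chart_map phi (e w) = ax false w].
  move=> Ux; have := ch_inv phiP dx Ux; rewrite mx => /nbhsCC[r r0 H].
  apply/nbhsC; exists r => // w; rewrite subr0 => wr; apply: H.
  - exact: (eq_ind_r (fun v => cabs v < r) wr (subr0 w)).
  - exact: cabs_sub0.
  - by apply: ax_model; rewrite kI.
have nw : \forall w \near (0 : C), w != 0 -> exists2 y : X, y = e w &
    [/\ chart_dom phi y, ~ nodes X y, lpar (nodes X) phi e y,
        sc (chart_map phi y) = w & chart_dom psi (f y) /\ forall j, cholo phi (h j) y].
  apply: filterS (ne _ (filterI (near_join A) nd)) => w [[Ay [dy dfy]] _ my] w0; exists (e w) => //.
  have yi : onax (chart_kind phi) false (chart_map phi (e w)).
    by rewrite my; split; rewrite ?sc_ax //; move=> _; apply/eqP.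
  have ny : ~ nodes X (e w) by exact: (onax_nonnode phiP dy yi).
  split=> //; first by have := lpar_ax phiP dy yi.
    by rewrite my sc_ax.
  by split=> // j; apply: cholo_ncj; exact: (nbhs_singleton Ay).
have Hc j : \forall w \near (0 : C), h j (e w) = h j (e 0).
  have hd0 : holo (fun w => h j (e w)) 0.
    apply: removable.
      move=> r r0; apply/nbhsC; have nh : \forall y \near x, cabs (h j y - h j x) < r.
        have cps : \forall v \near chart_map psi (f x), cabs (pj j v - pj j (chart_map psi (f x))) < r.
          by apply/nbhsCC; exists r => // v; case: (j).
        apply: filterS (near_map (@fc x) (ch_cont psiP dfx cps)) => y.
        rewrite /h /ncj; case: (b) => //=.
        by rewrite -opprD cabsN -cjN -cjD cabs_cj.
      by apply: filterS (ne _ nh) => w [+ _ _]; rewrite e0.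
    apply: filterS nw => w H w0; have [y -> [dy ny ly yw [_ hy]]] := H w0.
    have /(cholo_hholo _ ly) := hy j; rewrite yw kI /= => hla.
    by apply: holo_cdiff; apply: (hholo_holo _ _ hla).
  apply: min_principle => //; last by rewrite e0.
  by apply: filterS (ne _ (hp j)) => w [].
have [d d0] := real_shift_near (filterI (filterI (Hc true) (Hc false))
  (filterI nw (filterI (near_join (Hc true)) (near_join (Hc false))))).
rewrite add0r => -[[Et Ef] [Hw [Nt Nf]]].
have dn : cR d != 0 :> C by rewrite -cabs_eq0 cabs_cR normr_eq0 gt_eqF.
have [y yE [dy ny ly yw [dfy hy]]] := Hw dn.
apply: (fn ny).
apply: (@crd_const _ _ _ psi f false y psiP (@fc y) dfy).
apply: (@ncj_const _ _ b) => j; apply/(lpar_const _ ly).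
rewrite yw /=; have : \forall w \near cR d, h j (e w) = h j (e 0) by case: (j).
have hE : h j (e (cR d)) = h j (e 0) by case: (j).
by apply: filterS => w Ew _; rewrite -/(h j (e w)) -/(h j (e (cR d))) Ew hE.
Qed.


Lemma crd_cont psi x b j (P : set C) : atlas Y psi -> chart_dom psi (f x) ->
  (\forall w \near crd b j psi f x, P w) -> \forall y \near x, P (crd b j psi f y).
Proof.
move=> Apsi dfx /nbhsC[r r0 H].
have cps : \forall v \near chart_map psi (f x), cabs (pj j v - pj j (chart_map psi (f x))) < r.
  by apply/nbhsCC; exists r => // v; case: (j).
apply: filterS (near_map (@fc x) (ch_cont (psC Yp Apsi) dfx cps)) => y Hy; apply: H.
by rewrite /crd; case: (b) => //=; rewrite -cjN -cjD cabs_cj.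
Qed.

(** Some coordinate of [f] is not constant near [x], hence takes its value at [x] nowhere else
    nearby; a point sent to a node would give it the same value 0. *)
Lemma node_isolated phi psi x b : atlas X phi -> atlas Y psi -> chart_dom phi x ->
  chart_dom psi (f x) -> signed_at (nodes X) phi psi f b x -> ~ nodes X x -> nodes Y (f x) ->
  \forall y \near x, y <> x -> ~ nodes Y (f y).
Proof.
move=> Aphi Apsi dx dfx A nx Nfx; have phiP := psC Xp Aphi; have psiP := psC Yp Apsi.
have kn : chart_kind psi <> Smooth by move=> /(ch_smooth psiP dfx).
have mfx := (ch_node psiP dfx kn).2 Nfx.
have nd := near_charts Aphi Apsi dx dfx.
have [j Hj] : exists j, \forall y \near x, y <> x -> crd b j psi f y <> crd b j psi f x.
  apply: contrapT => nj; apply: (fn nx).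
  apply: (@crd_const _ _ _ psi f b x psiP (@fc x) dfx) => j.
  have [//|H] := cholo_isolated phiP dx nx (nbhs_singleton A nx j).
  by exfalso; apply: nj; exists j.
apply: filterS2 Hj nd => y Hy [dy dfy] yx /(ch_node psiP dfy kn) mfy.
by apply: (Hy yx); rewrite /crd mfx mfy.
Qed.

End Maps.

Section Boundary.
Variable X : nodal_data R.
Hypothesis Xp : presurf X.

Lemma id_cont : continuous (idfun : X -> X).
Proof. by move=> x; exact: cvg_id. Qed.

Lemma signed_at_id_ex phi psi (x : X) : atlas X phi -> atlas X psi -> chart_dom phi x -> chart_dom psi x ->
  exists b, signed_at (nodes X) phi psi idfun b x.
Proof.
move=> Aphi Apsi dx dpx; apply: (dianalytic_signed_at (psC Xp Aphi) (ch_open (psC Xp Apsi)) id_cont dx dpx).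
by case: Xp => _ _ _ _; apply.
Qed.

(** [boundary] only asks for some chart; [boundary_pull] for the identity map carries the condition
    over to every other one. *)
Lemma boundary_chart phi (x : X) : atlas X phi -> chart_dom phi x ->
  boundary X x <-> model_boundary (chart_kind phi) (chart_map phi x).
Proof.
move=> Aphi dx; split=> [[psi [Apsi dpx mb]]|mb]; last by exists phi.
have [b A] := signed_at_id_ex Aphi Apsi dx dpx.
exact: (boundary_pull Xp Xp id_cont (nowhere_const_id Xp) Aphi Apsi dx dpx A mb).
Qed.

Lemma signed_at_refl phi (x : X) : atlas X phi -> chart_dom phi x -> signed_at (nodes X) phi phi idfun false x.
Proof.
move=> Aphi dx; have phiP := psC Xp Aphi; near=> y => ny j.
have dy : chart_dom phi y by near: y; exact: (ch_dom phiP dx).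
have [i [_ ni]] := lparP phiP dy ny.
have E : \forall v \near y, crd false j phi idfun v = if i == j then (@sc R \o chart_map phi) v else 0.
  apply: filterS ni => v [_ [vE _ _] _]; rewrite /crd /=.
  by move: vE; move: (sc (chart_map phi v)) => t ->; case: (i) (j) => [] [].
case: (i == j) E => E.
  by apply: cholo_eq (cholo_sc phi y); apply: filterS E => v ->.
exists (fun=> 0); [exact: holo_cst|exact: E].
Unshelve. all: by end_near. Qed.

End Boundary.

Section Removable.
Variables X Y : nodal_data R.
Hypotheses (Xp : presurf X) (Yp : presurf Y).
Variable f : X -> Y.
Hypotheses (fc : continuous f) (fb : f @` boundary X `<=` boundary Y).

(** The coordinates of [f] are real on the boundary because [f] maps boundary to boundary; this is
    the condition under which [cholo_removable] reflects. *)
Lemma crd_removable phi psi x b : atlas X phi -> atlas Y psi -> chart_dom phi x ->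
  chart_dom psi (f x) -> ~ nodes X x ->
  (\forall y \near x, y <> x -> forall j, cholo phi (crd b j psi f) y) ->
  forall j, cholo phi (crd b j psi f) x.
Proof.
move=> Aphi Apsi dx dfx nx H j; apply: (cholo_removable (psC Xp Aphi) dx nx).
- by move=> P; exact: (crd_cont Yp fc).
- by apply: filterS H => y Hy yx; exact: Hy.
- apply: filterS (near_charts Xp Yp fc Aphi Apsi dx dfx) => y [dy dfy] mb.
  have : boundary Y (f y) by apply: fb; exists y => //; apply/(boundary_chart Xp Aphi dy).
  move=> /(boundary_chart Yp Apsi dfy)/model_boundary_im[_ /(_ j)].
  by rewrite /crd; case: (b) => //= im0; rewrite cim_cj im0 oppr0.
Qed.

End Removable.

(** * Composition of signs *)

Section Composition.
Variables X Y Z : nodal_data R.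
Hypotheses (Xp : presurf X) (Yp : presurf Y) (Zp : presurf Z).
Variables (f : X -> Y) (g : Y -> Z).

Lemma crd_comp (phi : chart R (points X)) (psi : chart R (points Y)) (chi : chart R (points Z)) x b c :
  {for x, continuous f} -> chart_dom phi x ->
  (forall j, cholo phi (crd b j psi f) x) -> (forall j, cholo psi (crd c j chi g) (f x)) ->
  forall j, cholo phi (crd (b (+) c) j chi (g \o f)) x.
Proof.
move=> fc dx hf hg j.
have hs : cholo phi (cjb b \o @sc R \o chart_map psi \o f) x.
  apply: cholo_eq (choloD (hf false) (hf true)); near=> y.
  by rewrite /crd /= -cjbD.
have := cholo_comp_cj (fun P => @near_map _ _ f x P fc) hs (hg j).
by apply: cholo_eq; near=> y; rewrite /crd /= cjb_addb.
Unshelve. all: by end_near. Qed.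

Hypotheses (fc : continuous f) (fn : nowhere_const f).

(* The outer map g is only used near the image of x. *)
Lemma signed_at_comp_local (F : X -> Z) phi psi chi x b c : continuous F ->
  F @` boundary X `<=` boundary Z -> (\forall y \near x, F y = g (f y)) ->
  atlas X phi -> atlas Y psi -> atlas Z chi ->
  chart_dom phi x -> chart_dom psi (f x) -> chart_dom chi (F x) ->
  signed_at (nodes X) phi psi f b x -> signed_at (nodes Y) psi chi g c (f x) ->
  signed_at (nodes X) phi chi F (b (+) c) x.
Proof.
move=> Fc Fb FE Aphi Apsi Achi dx dfx dgx Af Ag.
have nAg := near_map (@fc x) Ag.
have nd := near_charts Xp Yp fc Aphi Apsi dx dfx.
have nd2 := near_charts Xp Zp Fc Aphi Achi dx dgx.
have near_good : \forall y \near x, [/\ chart_dom phi y, chart_dom psi (f y), chart_dom chi (F y),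
    ~ nodes X y -> forall j, cholo phi (crd b j psi f) y &
    ~ nodes Y (f y) -> forall j, cholo psi (crd c j chi g) (f y)].
  by near=> y; split; [have [] := near nd y|have [] := near nd y|have [] := near nd2 y|
    exact: (near Af y)|exact: (near nAg y)].
have K : \forall y \near x, ~ nodes X y -> ~ nodes Y (f y) ->
    forall j, cholo phi (crd (b (+) c) j chi F) y.
  apply: filterS2 near_good (near_join FE) => y [dy dfy dgy hf hg] FEy ny nfy j.
  have := crd_comp (@fc y) dy (hf ny) (hg nfy) j; apply: cholo_eq.
  by apply: filterS FEy => v Ev; rewrite /crd Ev.
apply: filterS (filterI (near_join K) (filterI near_good (signed_at_near Af))) => y [Ky [[dy dfy dgy hf hg] Afy]] ny.
(* If [f y] is a node, [Ag] says nothing at [f y] itself. The neighbours of [y] are not sent to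
   nodes, so the chain rule holds around [y] and the singularity at [y] is removed. *)
have [Nfy|nfy] := pselect (nodes Y (f y)); last exact: (nbhs_singleton Ky).
apply: (crd_removable Xp Zp Fc Fb) => //.
have ni := node_isolated Xp Yp fc fn Aphi Apsi dy dfy Afy ny Nfy.
apply: filterS2 Ky (filterI ni (nonnode_near Xp ny)) => v Kv [nfv nv] vy.
by apply: Kv => //; exact: nfv.
Unshelve. all: by end_near. Qed.

Hypotheses (fb : f @` boundary X `<=` boundary Y).
Hypotheses (gc : continuous g) (gb : g @` boundary Y `<=` boundary Z).

Lemma comp_cont : continuous (g \o f).
Proof. by move=> y; apply: continuous_comp; [exact: fc|exact: gc]. Qed.

Lemma comp_bdry : (g \o f) @` boundary X `<=` boundary Z.
Proof. by move=> _ [y yb <-]; apply: gb; exists (f y) => //; apply: fb; exists y. Qed.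

Lemma signed_at_comp phi psi chi x b c : atlas X phi -> atlas Y psi -> atlas Z chi ->
  chart_dom phi x -> chart_dom psi (f x) -> chart_dom chi (g (f x)) ->
  signed_at (nodes X) phi psi f b x -> signed_at (nodes Y) psi chi g c (f x) ->
  signed_at (nodes X) phi chi (g \o f) (b (+) c) x.
Proof.
by apply: signed_at_comp_local; [exact: comp_cont|exact: comp_bdry|near=> y].
Unshelve. all: by end_near. Qed.

End Composition.

Section AtlasSigns.
Variable X : nodal_data R.
Hypothesis Xp : presurf X.
Implicit Types (phi psi chi : chart R (points X)).

Lemma id_bdry : (idfun : X -> X) @` boundary X `<=` boundary X.
Proof. by move=> _ [x xb <-]. Qed.

Lemma signed_at_trans phi psi chi (x : X) b c : atlas X phi -> atlas X psi -> atlas X chi ->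
  chart_dom phi x -> chart_dom psi x -> chart_dom chi x ->
  signed_at (nodes X) phi psi idfun b x -> signed_at (nodes X) psi chi idfun c x ->
  signed_at (nodes X) phi chi idfun (b (+) c) x.
Proof.
move=> Aphi Apsi Achi dx dfx dgx.
exact: (signed_at_comp Xp Xp Xp (@id_cont X) (nowhere_const_id Xp) id_bdry (@id_cont X) id_bdry).
Qed.

(** The inverse transition map has some sign [c], and its composite with the given one is the
    identity, of sign [false]; exclusiveness forces [c = b]. *)
Lemma signed_at_sym phi psi (x : X) b : atlas X phi -> atlas X psi -> chart_dom phi x -> chart_dom psi x ->
  signed_at (nodes X) phi psi idfun b x -> signed_at (nodes X) psi phi idfun b x.
Proof.
move=> Aphi Apsi dx dpx A; have [c B] := signed_at_id_ex Xp Apsi Aphi dpx dx.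
have [<-//|cb] := eqVneq c b.
have D := signed_at_trans Aphi Apsi Aphi dx dpx dx A B.
exfalso; apply: (signed_at_excl Xp Xp (@id_cont X) (nowhere_const_id Xp) Aphi Aphi dx dx (signed_at_refl Xp Aphi dx)).
by move: D; case: b c cb {A B} => [] [].
Qed.

End AtlasSigns.

End Surfaces.

(** * Morphisms in terms of pointwise signs *)

Section Morphisms.
Variable R : realType.
Local Notation C := (Cplx R).
Implicit Types (X Y Z : nodal_data R).

Lemma analyticS k (S S' : set (C * C)) (g : C * C -> C * C) : S' `<=` S -> analytic k S g -> analytic k S' g.
Proof.
move=> SS /analyticE H; apply/analyticE => i j; have [W [G [Wo DW Gh GE]]] := H i j.
have sub : [set t | regular_part k S' (ax i t)] `<=` [set t | regular_part k S (ax i t)].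
  by move=> t /= /regularP[St tn]; apply/regularP; split=> //; exact: SS.
exists W, G; split=> //; first by apply: subset_trans sub DW.
by move=> t; rewrite inE => /sub St; apply: GE; rewrite inE.
Qed.

Lemma analytic_dianalytic k (S : set (C * C)) (g : C * C -> C * C) : analytic k S g -> dianalytic k S g.
Proof. by move=> H z Sz; left; apply: analyticS H; exact: connected_component_sub. Qed.

Lemma presurf_klein X : nodal_klein X -> presurf X.
Proof. by move=> [[Xh _ Xf] [Xc Xcov Xt _]]. Qed.

Lemma presurf_riemann X : nodal_riemann X -> presurf X.
Proof.
move=> [[Xh _ Xf] [Xc Xcov Xt _]]; split=> // phi psi Aphi Apsi.
by apply: analytic_dianalytic; exact: Xt.
Qed.

Lemma signed_at_riemann X phi psi (x : X) : nodal_riemann X -> atlas X phi -> atlas X psi ->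
  chart_dom phi x -> chart_dom psi x -> signed_at (nodes X) phi psi idfun false x.
Proof.
move=> XR Aphi Apsi dx dpx; have Xp := presurf_riemann XR.
apply: (analytic_signed_at (psC Xp Aphi) (ch_open (psC Xp Apsi)) (@id_cont R X) dx dpx).
by case: XR => _ [_ _ + _]; apply.
Qed.

Definition signed X Y (f : X -> Y) := forall phi psi x, atlas X phi -> atlas Y psi ->
  chart_dom phi x -> chart_dom psi (f x) -> exists b, signed_at (nodes X) phi psi f b x.

(* The pointwise form of [dianalytic_morphism]. *)
Definition dmor X Y (f : X -> Y) :=
  [/\ continuous f, nowhere_const f, f @` boundary X `<=` boundary Y & signed f].

Definition signedb b X Y (f : X -> Y) := forall phi psi x, atlas X phi -> atlas Y psi ->
  chart_dom phi x -> chart_dom psi (f x) -> signed_at (nodes X) phi psi f b x.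

(* Analytic (b = false) or antianalytic (b = true) morphisms. *)
Definition smor b X Y (f : X -> Y) :=
  [/\ continuous f, nowhere_const f, f @` boundary X `<=` boundary Y & signedb b f].

Lemma smor_dmor b X Y (f : X -> Y) : smor b f -> dmor f.
Proof.
by move=> [fc fn fb fs]; split=> // phi psi x A1 A2 d1 d2; exists b; exact: fs.
Qed.

Lemma nowhere_const_loc X Y (f : X -> Y) x : presurf X -> presurf Y -> continuous f -> signed f -> ~ nodes X x ->
  (forall U : set X, (\forall y \near x, U y) -> exists y, U y /\ \forall v \near y, f v = f y) ->
  \forall y \near x, f y = f x.
Proof.
move=> Xp Yp fc fs nx H.
have [phi Aphi dx] := ps_cov Xp x; have [psi Apsi dfx] := ps_cov Yp (f x).
have [b A] := fs _ _ _ Aphi Apsi dx dfx.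
apply: (@crd_const R _ _ (nodes Y) psi f b x (psC Yp Apsi) (@fc x) dfx) => j.
apply: (cholo_loc_const (psC Xp Aphi) dx nx (nbhs_singleton A nx j)).
move=> U /H[y [Uy fy]]; exists y; split=> //.
by apply: filterS fy => v fv; rewrite /crd fv.
Qed.

(** The non-nodal points near which [f] is constantly [f x] form an open set which, by
    [nowhere_const_loc], is also closed in the component of [x]. *)
Lemma nonconstant_nowhere_const X Y (f : X -> Y) : presurf X -> presurf Y -> continuous f -> signed f ->
  nonconstant f -> nowhere_const f.
Proof.
move=> Xp Yp fc fs fn x nx fx; have [y cy fyx] := fn x nx.
pose D := [set z : X | ~ nodes X z /\ \forall v \near z, f v = f x].
have cc := @component_connected _ (~` nodes X) x.
have E : connected_component (~` nodes X) x `&` D = connected_component (~` nodes X) x.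
  apply: cc.
  - by exists x; split=> //; exact: connected_component_refl.
  - exists D => //; rewrite openE => z [nz fz].
    by apply: filterS2 (nonnode_near Xp nz) (near_join fz) => v nv fv.
  exists (~` [set z | \forall v \near z, ~ D v]).
    by apply: open_closedC; rewrite openE => z Hz; exact: (near_join Hz).
  apply/seteqP; split=> z [cz]; first by move=> Dz; split=> // /nbhs_singleton.
  move=> nDz; split=> //; have nz : ~ nodes X z by exact: (connected_component_sub cz).
  split=> //; have fz : \forall v \near z, f v = f z.
    apply: (nowhere_const_loc Xp Yp fc fs nz) => U Uz.
    have [v [Uv [nv fv]]] : exists v, U v /\ D v.
      apply: contrapT => n; apply: nDz; apply: filterS Uz => v Uv Dv.
      by apply: n; exists v.
    have fvx := nbhs_singleton fv.
    by exists v; split=> //; apply: filterS fv => w ->; rewrite fvx.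
  suff fzx : f z = f x by apply: filterS fz => v ->.
  apply: contrapT => fzx; apply: nDz; apply: filterS fz => v fv [_ /nbhs_singleton].
  by rewrite fv => E; apply: fzx.
by move: cy; rewrite -E => -[_ [_ /nbhs_singleton]].
Qed.

(** The local parametrisation maps a disc or a truncated disc, which is convex, to a node-free set
    containing all points near [x]. *)
Lemma nonnode_connected X (x : X) : presurf X -> ~ nodes X x ->
  \forall y \near x, connected_component (~` nodes X) x y.
Proof.
move=> Xp nx; have [phi Aphi dx] := ps_cov Xp x; have phiP := psC Xp Aphi.
have [i [xi ni]] := lparP phiP dx nx; have [_ _ [[tH _ _ ex] ne eU em mc]] := nbhs_singleton ni.
pose e := chart_inv phi \o ax i; pose k := chart_kind phi.
have := eU _ ni; move=> /(filterI em)/nbhsC[r r0 rP].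
pose D := [set w : C | inH (bdk k) w /\ cabs (w - sc (chart_map phi x)) < r].
have D0 : D (sc (chart_map phi x)) by split=> //; rewrite subrr cabs0.
have Dc : connected D.
  apply: (@convex_connected _ D (sc (chart_map phi x))) => // v s [vH vr] s01.
  split; last by apply: cball_seg => //; rewrite subrr cabs0.
  by move=> kb; have := vH kb; have := tH kb; rewrite !cE mul0r addr0; nra.
have eDc : connected (e @` D).
  apply: connected_continuous_connected => //.
  apply/subspace_continuousP => w [wH wr] U Uw.
  have [/(_ wH) wE /(_ wH) [_ _ [_ _ eUw _ _]]] := rP _ wr.
  have := eUw _ Uw; rewrite wE => H.
  by apply: filterS H => v Hv [vH _]; exact: Hv.
apply: filterS2 ne (mc _ (nbhs_cball (sc (chart_map phi x)) r0)) => y [dy ny yH ey] yr.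
apply: (@connected_component_max _ (~` nodes X) (e @` D)) => //.
- by exists (sc (chart_map phi x)).
- move=> _ [w [wH wr] <-].
  by have [_ /(_ wH) [_ _ [[_ _ nw _] _ _ _ _]]] := rP _ wr.
- by exists (sc (chart_map phi y)).
Qed.

Lemma nowhere_const_nonconstant X Y (f : X -> Y) : presurf X -> nowhere_const f -> nonconstant f.
Proof.
move=> Xp fn x nx; apply: contrapT => H; apply: (fn x nx).
apply: filterS (nonnode_connected Xp nx) => y cy; apply: contrapT => fy.
by apply: H; exists y.
Qed.

Lemma dmor_dianalytic X Y (f : X -> Y) : presurf X -> presurf Y -> dianalytic_morphism f <-> dmor f.
Proof.
move=> Xp Yp; split=> -[fc fn fb fd].
  have fs : signed f.
    move=> phi psi x Aphi Apsi dx dfx.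
    exact: (dianalytic_signed_at (psC Xp Aphi) (ch_open (psC Yp Apsi)) fc dx dfx (fd _ _ Aphi Apsi)).
  by split=> //; exact: nonconstant_nowhere_const.
split=> //; first exact: nowhere_const_nonconstant.
move=> phi psi Aphi Apsi; apply: (signed_at_dianalytic (psC Xp Aphi) (ch_open (psC Yp Apsi)) fc).
  by move=> x; exact: fd.
by move=> x b; exact: signed_at_excl.
Qed.

Lemma signedb_charts b X Y (f : X -> Y) : presurf X -> presurf Y -> continuous f ->
  in_charts (fun k S g => analytic k S (cj2b b g)) (atlas X) (atlas Y) f <-> signedb b f.
Proof.
move=> Xp Yp fc; split=> H phi psi.
  move=> x Aphi Apsi dx dfx.
  exact: (analytic_signed_at (psC Xp Aphi) (ch_open (psC Yp Apsi)) fc dx dfx (H _ _ Aphi Apsi)).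
move=> Aphi Apsi; apply: (signed_at_analytic (psC Xp Aphi)).
by move=> x; exact: H.
Qed.

Lemma signedb_signed b X Y (f : X -> Y) : signedb b f -> signed f.
Proof. by move=> H phi psi x *; exists b; exact: H. Qed.

Lemma smor_analytic X Y (f : X -> Y) : presurf X -> presurf Y -> analytic_morphism f <-> smor false f.
Proof.
move=> Xp Yp; split=> -[fc fn fb fd].
  have fs : signedb false f by exact: (signedb_charts false Xp Yp fc).1.
  by split=> //; exact: nonconstant_nowhere_const (signedb_signed fs) fn.
split=> //; first exact: nowhere_const_nonconstant.
exact: (signedb_charts false Xp Yp fc).2.
Qed.

Lemma nowhere_const_isolated Y Z (g : Y -> Z) y : presurf Y -> presurf Z -> dmor g -> ~ nodes Y y ->
  \forall v \near y, v <> y -> g v <> g y.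
Proof.
move=> Yp Zp [gc gn _ gs] ny; have [psi Apsi dy] := ps_cov Yp y; have [chi Achi dgy] := ps_cov Zp (g y).
have [b A] := gs _ _ _ Apsi Achi dy dgy; have h := nbhs_singleton A ny.
have K j : (\forall v \near y, v <> y -> crd b j chi g v <> crd b j chi g y) ->
    \forall v \near y, v <> y -> g v <> g y.
  by apply: filterS => v H vy gvy; apply: (H vy); rewrite /crd gvy.
have [E1|] := cholo_isolated (psC Yp Apsi) dy ny (h false); last exact: K.
have [E2|] := cholo_isolated (psC Yp Apsi) dy ny (h true); last exact: K.
exfalso; apply: (gn y ny); apply: (crd_const (psC Zp Achi) (@gc y) dgy) => j.
by case: j; [exact: E2|exact: E1].
Qed.

Lemma good_point X Y (f : X -> Y) (x : X) (U : set X) : presurf X -> presurf Y -> dmor f ->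
  (\forall y \near x, U y) -> exists y, [/\ U y, ~ nodes X y & ~ nodes Y (f y)].
Proof.
move=> Xp Yp [fc fn fb fs] Ux.
have [phi Aphi dx] := ps_cov Xp x; have [psi Apsi dfx] := ps_cov Yp (f x).
have [z [Uz [dz dfz]] nz] := nonnode_dense Xp (filterI (near_join Ux) (near_charts Xp Yp fc Aphi Apsi dx dfx)).
have [Nfz|nfz] := pselect (nodes Y (f z)); last by exists z; split=> //; exact: (nbhs_singleton Uz).
have [b A] := fs _ _ _ Aphi Apsi dz dfz.
have ni := node_isolated Xp Yp fc fn Aphi Apsi dz dfz A nz Nfz.
apply: contrapT => H; apply: (nowhere_const_id Xp nz).
apply: filterS2 Uz (filterI ni (nonnode_near Xp nz)) => v Uv [nfv nv].
by apply: contrapT => vz; apply: H; exists v; split=> //; exact: nfv.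
Qed.

(** Points sent to nodes are avoided by [good_point]. At a non-nodal [f y] the map [g] takes its
    value nowhere else nearby, so constancy of [g \o f] near [y] would force that of [f]. *)
Lemma nowhere_const_comp X Y Z (f : X -> Y) (g : Y -> Z) : presurf X -> presurf Y -> presurf Z ->
  dmor f -> dmor g -> nowhere_const (g \o f).
Proof.
move=> Xp Yp Zp fm gm x nx /near_join/(good_point Xp Yp fm)[y [gfy ny nfy]].
have [fc fn _ _] := fm; apply: (fn y ny).
have gfyx : g (f y) = g (f x) := nbhs_singleton gfy.
apply: filterS2 gfy (near_map (@fc y) (nowhere_const_isolated Yp Zp gm nfy)) => v Ev Hv.
apply: contrapT => fvy; apply: (Hv fvy).
by rewrite gfyx; exact: Ev.
Qed.

Lemma dmor_comp X Y Z (f : X -> Y) (g : Y -> Z) : presurf X -> presurf Y -> presurf Z ->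
  dmor f -> dmor g -> dmor (g \o f).
Proof.
move=> Xp Yp Zp fm gm; have [fc fn fb fs] := fm; have [gc gn gb gs] := gm; split.
- exact: comp_cont.
- exact: nowhere_const_comp.
- exact: comp_bdry.
move=> phi chi x Aphi Achi dx dgx; have [psi Apsi dfx] := ps_cov Yp (f x).
have [b Af] := fs _ _ _ Aphi Apsi dx dfx; have [c Ag] := gs _ _ _ Apsi Achi dfx dgx.
by exists (b (+) c); exact: (signed_at_comp Xp Yp Zp fc fn fb gc gb Aphi Apsi Achi).
Qed.

Lemma smor_comp b c X Y Z (f : X -> Y) (g : Y -> Z) : presurf X -> presurf Y -> presurf Z ->
  smor b f -> smor c g -> smor (b (+) c) (g \o f).
Proof.
move=> Xp Yp Zp fm gm; have [fc fn fb fs] := fm; have [gc gn gb gs] := gm; split.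
- exact: comp_cont.
- exact: nowhere_const_comp (smor_dmor fm) (smor_dmor gm).
- exact: comp_bdry.
move=> phi chi x Aphi Achi dx dgx; have [psi Apsi dfx] := ps_cov Yp (f x).
have Af := fs _ _ _ Aphi Apsi dx dfx; have Ag := gs _ _ _ Apsi Achi dfx dgx.
exact: (signed_at_comp Xp Yp Zp fc fn fb gc gb Aphi Apsi Achi).
Qed.

Lemma dmor_id X : presurf X -> dmor (idfun : X -> X).
Proof.
move=> Xp; split; [exact: id_cont|exact: nowhere_const_id|exact: id_bdry|].
by move=> phi psi x; exact: signed_at_id_ex.
Qed.

Lemma smor_id X : nodal_riemann X -> smor false (idfun : X -> X).
Proof.
move=> XR; split; [exact: id_cont|exact: nowhere_const_id (presurf_riemann XR)|exact: id_bdry|].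
by move=> phi psi x *; exact: signed_at_riemann.
Qed.

(** Charts of a Riemann surface have sign [false] relative to each other, so only the change of
    chart on the target affects the sign. *)
Lemma signed_at_change X Y (f : X -> Y) phi phi' psi psi' x b c : nodal_riemann X -> presurf Y -> dmor f ->
  atlas X phi -> chart_dom phi x -> atlas X phi' -> chart_dom phi' x ->
  atlas Y psi -> chart_dom psi (f x) -> atlas Y psi' -> chart_dom psi' (f x) ->
  signed_at (nodes X) phi psi f b x -> signed_at (nodes Y) psi psi' idfun c (f x) ->
  signed_at (nodes X) phi' psi' f (b (+) c) x.
Proof.
move=> XR Yp [fc fn fb _] Aphi dx Aphi' dx' Apsi dfx Apsi' dfx' Af Ac; have Xp := presurf_riemann XR.
have A1 := signed_at_comp Xp Xp Yp (@id_cont _ X) (nowhere_const_id Xp) (@id_bdry _ X) fc fb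
  Aphi' Aphi Apsi dx' dx dfx (signed_at_riemann XR Aphi' Aphi dx' dx) Af.
exact: (signed_at_comp Xp Yp Yp fc fn fb (@id_cont _ Y) (@id_bdry _ Y) Aphi' Apsi Apsi' dx' dfx dfx').
Qed.

End Morphisms.

(** * Lifting and descent along double covers *)

Section LocalSections.
Variable R : realType.
Local Notation C := (Cplx R).

Lemma ncjK b : involutive (@ncj R b).
Proof. by case: b => z //=; rewrite cjN cjK opprK. Qed.

Lemma ncjD b (z w : C) : ncj b (z + w) = ncj b z + ncj b w.
Proof. by case: b; rewrite //= cjD opprD. Qed.

Lemma near_ncj b (z : C) (P : set C) : (\forall w \near ncj b z, P w) -> \forall w \near z, P (ncj b w).
Proof.
move=> /nbhsC[e e0 H]; apply/nbhsC; exists e => // w wz; apply: H.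
case: b => //=; have -> : - cj w - - cj z = - cj (w - z) by rewrite cjD cjN opprD.
by rewrite cabsN cabs_cj.
Qed.

Lemma near_and (T : topologicalType) (x : T) (P Q : set T) : (\forall y \near x, P y) ->
  (\forall y \near x, Q y) -> \forall y \near x, P y /\ Q y.
Proof. exact: filterI. Qed.

Lemma inH_ncj bb b (z : C) : inH bb z -> inH bb (ncj b z).
Proof. by move=> H k; rewrite cim_ncj; exact: H. Qed.

Lemma hholo_cjb bb b (h : C -> C) u : hholo bb (h \o ncj b) (ncj b u) -> hholo bb (cjb b \o h) u.
Proof.
move=> [G Gu E]; exists (cjb b \o G \o ncj b).
  case: b Gu {E} => //= Gu.
  suff : holo (fun w => cj ((G \o (fun w => - w)) (cj w))) u by [].
  by apply: holo_cj; apply: holo_comp Gu; exact: holoN (holo_id _).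
apply: filterS (near_ncj E) => w Ew wH.
by have := Ew (inH_ncj b wH); rewrite /= ncjK => ->.
Qed.

Lemma hholo_weaken (b b' : bool) (h : C -> C) t : (b' -> b) -> hholo b' h t -> hholo b h t.
Proof. by move=> bb [G Gt E]; exists G => //; apply: filterS E => w Ew wH; apply: Ew => /bb/wH. Qed.

Lemma model_boundary_sc k (z : C * C) : model_boundary k z -> bdk k /\ cim (sc z) = 0.
Proof.
move=> /model_boundary_im[bk H]; split=> //.
by rewrite /sc cimD (H false) (H true) addr0.
Qed.

Lemma onax_boundary k i (z : C * C) : onax k i z -> model k z -> bdk k -> cim (sc z) = 0 ->
  model_boundary k z.
Proof.
move=> [zE ki sn] mz bk s0; rewrite zE; apply/bdry_ax => //.
by move=> _; rewrite s0.
Qed.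

Section SectionChart.
Variables (X Y : topologicalType) (N : set X) (M : set Y).
Variables (phi : chart R X) (psi : chart R Y) (f : X -> Y) (s : Y -> X) (x : X).
Hypotheses (phiP : is_chart N phi) (psiP : is_chart M psi).
Hypotheses (dx : chart_dom phi x) (dfx : chart_dom psi (f x)) (nx : ~ N x) (nfx : ~ M (f x)).
Hypothesis sfx : s (f x) = x.
Hypothesis sP : \forall y \near f x, f (s y) = y /\ {for y, continuous s}.
Hypothesis fc : {for x, continuous f}.
Hypothesis fb : \forall y \near x,
  model_boundary (chart_kind phi) (chart_map phi y) <->
  model_boundary (chart_kind psi) (chart_map psi (f y)).

(* In the scalar coordinates s is a right inverse of f; antianalytic maps are
   first made analytic by the reflection [ncj b]. *)
Lemma section_cholo b : (forall j, cholo phi (crd b j psi f) x) ->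
  forall j, cholo psi (crd b j phi s) (f x).
Proof.
move=> hf j.
pose k := chart_kind phi; pose k' := chart_kind psi.
pose m := chart_map phi; pose m' := chart_map psi.
have [i [xi ni]] := lparP phiP dx nx; have [i' [xi' ni']] := lparP psiP dfx nfx.
have [_ _ lx] := nbhs_singleton ni; have [_ _ lx'] := nbhs_singleton ni'.
have [[tH _ _ ex] ne eU em mc] := lx; have [[tH' _ _ ex'] ne' eU' em' mc'] := lx'.
set e := chart_inv phi \o ax i in ni lx ex ne eU em.
set e' := chart_inv psi \o ax i' in ni' lx' ex' ne' eU' em'.
set t := sc (chart_map phi x) in tH ex eU em mc; set u := sc (chart_map psi (f x)) in tH' ex' eU' em' mc'.
have sc0 : {for f x, continuous s} by have [] := nbhs_singleton sP.
have sn (P : set X) : (\forall y \near x, P y) -> \forall y \near f x, P (s y).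
  by move=> Px; apply: near_map sc0 _; rewrite sfx.
(* The kinds [k] and [k'] may differ, a smooth chart being bordered and an interior node not. At a
   boundary point both sides are treated in the half-plane, otherwise both in the plane; [bb] makes
   this choice. *)
pose bb : bool := `[< model_boundary k (m x) >].
have bbk : bb -> bdk k by move=> /asboolP/model_boundary_sc[].
have fbx : model_boundary k (m x) <-> model_boundary k' (m' (f x)) := nbhs_singleton fb.
have bbk' : bb -> bdk k' by move=> /asboolP/fbx/model_boundary_sc[].
have t0 : bb -> cim t = 0 by move=> /asboolP/model_boundary_sc[].
have u0 : bb -> cim u = 0 by move=> /asboolP/fbx/model_boundary_sc[].
have tn : ~~ bb -> bdk k -> cim t != 0.
  move=> nb kb; apply: contraNneq nb => tt; apply/asboolP.
  by apply: onax_boundary xi _ _ _ => //; exact: (ch_model phiP).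
have un : ~~ bb -> bdk k' -> cim u != 0.
  move=> nb kb; apply: contraNneq nb => tt; apply/asboolP/fbx.
  by apply: onax_boundary xi' _ _ _ => //; exact: (ch_model psiP).
have Hk : \forall w \near t, inH bb w -> inH (bdk k) w.
  have [bT|bF] := boolP bb; first by apply: (@filterE _ (nbhs t)) => w + _; apply.
  by apply: filterS (near_inH tH (tn bF)) => w.
have Hk' : \forall w \near u, inH bb w -> inH (bdk k') w.
  have [bT|bF] := boolP bb; first by apply: (@filterE _ (nbhs u)) => w + _; apply.
  by apply: filterS (near_inH tH' (un bF)) => w.
pose F w := sc (m' (f (e w))); pose gam w := sc (m (s (e' w))).
have gu : gam u = t by rewrite /gam ex' sfx.
have gP : \forall w \near u, inH bb w -> [/\ inH (bdk k) (gam w), conH bb gam w & F (gam w) = w].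
  have A := eU' _ (near_and (sn _ (near_and ne ni)) (near_and ni' sP)).
  have Hk2 := near_join Hk'.
  have := em'; move=> /(filterI A) A2.
  apply: filterS2 Hk2 A2 => w Hw [Aw ew] wb.
  have wH := nbhs_singleton Hw wb.
  have [[[_ _ sH es] [ds _ _]] [[_ _ lw] [fs scw]]] := Aw wH; have {ew} ew := ew wH.
  split=> //; last by rewrite /F /gam es fs ew.
  move=> d d0; have [_ _ eUw _ _] := lw; rewrite ew in eUw.
  have Q := ch_cont phiP ds (sc_near (nbhs_cball (gam w) d0)).
  by apply: filterS2 Hw (eUw _ (near_map scw Q)) => v Hv Qv /Hv/Qv.
have L : hholo bb (gam \o ncj b) (ncj b u).
  apply: (@right_inverse_hholo R bb (ncj b \o F)).
  - by apply: inH_ncj => /bbk'; exact: tH'.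
  - rewrite /= ncjK gu; have : cholo phi (fun y => ncj b (sc (m' (f y)))) x.
      have hn j' : cholo phi (fun y => ncj b (pj j' (m' (f y)))) x.
        move: (hf j'); rewrite /crd; case: (b) => //= -[G Gt E].
        by exists (fun w => - G w); [exact: holoN|apply: filterS E => y ->].
      apply: cholo_eq (choloD (hn false) (hn true)).
      by apply: (@filterE _ (nbhs x)) => y; rewrite -ncjD.
    move=> /(cholo_hholo _ lx)[G Gt E]; exists G => //.
    by apply: filterS2 Hk E => w Hw Ew /Hw/Ew.
  - rewrite -[u](ncjK b) in gP; apply: filterS (near_ncj gP) => w Hw wb.
    have [g1 g2 g3] := Hw (inH_ncj b wb); split=> /=.
    + by move=> /bbk; exact: g1.
    + move=> d d0; have := near_ncj (g2 d d0).
      by apply: filterS => v Hv /(inH_ncj b)/Hv.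
    + by rewrite g3 ncjK.
  - move=> bT _; have A := eU' _ (near_and (sn _ (near_and ni fb)) (near_and ni' sP)).
    rewrite -[u](ncjK b) in A em'.
    apply: filterS2 (near_ncj A) (near_ncj em') => w Aw ew w0.
    have wH : inH (bdk k') (ncj b w) by move=> _; rewrite cim_ncj w0.
    have [[[ds _ _] fbs] [[dw wi _] [fs _]]] := Aw wH.
    have {}ew := ew wH.
    have : model_boundary k (m (s (e' (ncj b w)))).
      apply/fbs; rewrite fs; apply: onax_boundary wi _ _ _; [exact: (ch_model psiP)|exact: bbk'|].
      by rewrite ew cim_ncj.
    by case/model_boundary_sc.
  - move=> bT _; rewrite /= ncjK gu; have A := eU _ (near_and ni fb).
    apply: filterS2 A em => w Aw ew w0.
    have wH : inH (bdk k) w by move=> _; rewrite w0.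
    have [[dw wi _] fbw] := Aw wH; have {}ew := ew wH.
    have : model_boundary k' (m' (f (e w))).
      apply/fbw; apply: onax_boundary wi _ _ _; [exact: (ch_model phiP)|exact: bbk|].
      by rewrite ew.
    by rewrite cim_ncj; case/model_boundary_sc.
  - by move=> bT; rewrite cim_ncj u0 ?eqxx.
have hs : cholo psi (cjb b \o @sc R \o m \o s) (f x).
  by apply/(cholo_hholo _ lx'); exact: hholo_weaken bbk' (hholo_cjb L).
have E : \forall v \near f x, crd b j phi s v = if i == j then (cjb b \o @sc R \o m \o s) v else 0.
  apply: filterS (sn _ ni) => v [_ [vE _ _] _]; rewrite /crd /= /m.
  by move: vE; move: (sc (chart_map phi (s v))) => z ->; case: (i) (j) (b) => [] [] [] //; exact: cj0.
case: (i == j) E => E.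
  by apply: cholo_eq hs; apply: filterS E => v ->.
exists (fun=> 0); [exact: holo_cst|exact: E].
Qed.

End SectionChart.
Definition local_section (X Y : topologicalType) (f : X -> Y) p (s : Y -> X) :=
  [/\ s (f p) = p, \forall y \near f p, f (s y) = y /\ {for y, continuous s} &
      \forall x \near p, s (f x) = x].

Lemma double_cover_section (X Y : topologicalType) (f : X -> Y) p : double_cover f ->
  exists s, local_section f p s.
Proof.
move=> [fc /(_ (f p))[U [V [W [[Uo Ufp] [Vo Wo] _ E [hV hW]]]]]].
have K (A : set X) : open A -> homeo_on A U f -> A p -> exists s, local_section f p s.
  move=> Ao [_ [s [sc fA sU Ks Kf]]] Ap; exists s; split.
  - by apply: Ks; rewrite inE.
  - apply: filterS (open_nbhs_nbhs (conj Uo Ufp)) => y Uy; split; first by apply: Kf; rewrite inE.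
    by move: sc; rewrite continuous_open_subspace // => /(_ y); rewrite inE; apply.
  - by apply: filterS (open_nbhs_nbhs (conj Ao Ap)) => x Ax; apply: Ks; rewrite inE.
have [Vp|Wp] : (V `|` W) p by rewrite -E.
  exact: (K V).
exact: (K W).
Qed.

Lemma double_cover_surj (X Y : topologicalType) (f : X -> Y) p : double_cover f -> exists x, f x = p.
Proof.
move=> [fc /(_ p)[U [V [W [[Uo Up] [Vo Wo] _ E [[_ [s [_ _ _ _ Kf]]] _]]]]]].
by exists (s p); apply: Kf; rewrite inE.
Qed.

Lemma double_cover_fiber (X Y : topologicalType) (f : X -> Y) x y z : double_cover f ->
  f x = f y -> f z = f y -> x <> y -> z <> x -> z = y.
Proof.
move=> [fc /(_ (f y))[U [V [W [[Uo Up] [Vo Wo] VW E [hV hW]]]]]] xy zy nxy nzx.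
have inj (A : set X) u v : homeo_on A U f -> A u -> A v -> f u = f v -> u = v.
  by move=> [_ [s [_ _ _ K _]]] Au Av uv; rewrite -(K u) ?inE // uv K ?inE.
have H u : f u = f y -> V u \/ W u by move=> uy; have : (f @^-1` U) u by [rewrite /= uy]; rewrite E.
have [Vx|Wx] := H x xy; have [Vy|Wy] := H y erefl; have [Vz|Wz] := H z zy.
- by case: nxy; apply: inj hV Vx Vy xy.
- by case: nxy; apply: inj hV Vx Vy xy.
- by case: nzx; apply: inj hV Vz Vx _; rewrite xy.
- by apply: inj hW Wz Wy zy.
- by apply: inj hV Vz Vy zy.
- by case: nzx; apply: inj hW Wz Wx _; rewrite xy.
- by case: nxy; apply: inj hW Wx Wy xy.
- by case: nxy; apply: inj hW Wx Wy xy.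
Qed.

(** * Lifts of maps from Riemann surfaces, determined by signs *)

Section Cover.
Variables (X K : nodal_data R) (f : X -> K).
Hypotheses (Xp : presurf X) (Kp : presurf K) (fm : dmor f).
Hypotheses (fbd : f @^-1` boundary K = boundary X) (fnd : f @^-1` nodes K = nodes X).

Lemma signed_at_section phi psi s x b : local_section f x s -> atlas X phi -> atlas K psi ->
  chart_dom phi x -> chart_dom psi (f x) ->
  signed_at (nodes X) phi psi f b x -> signed_at (nodes K) psi phi s b (f x).
Proof.
move=> [sfx sP _] Aphi Apsi dx dfx A; have [fc fn fb fs] := fm.
have phiP := psC Xp Aphi; have psiP := psC Kp Apsi.
have sc0 : {for f x, continuous s} by have [] := nbhs_singleton sP.
have sn (P : set X) : (\forall y \near x, P y) -> \forall y \near f x, P (s y).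
  by move=> Px; apply: near_map sc0 _; rewrite sfx.
have nd := near_charts Xp Kp fc Aphi Apsi dx dfx.
apply: filterS2 (near_join sP) (sn _ (near_and (near_join nd) A)) => y sPy [ndy Ay] ny.
have [fsy scy] := nbhs_singleton sPy; have [dsy dfsy] := nbhs_singleton ndy.
have nsy : ~ nodes X (s y) by rewrite -fnd /= fsy.
rewrite -fsy; apply: (section_cholo phiP psiP) => //.
- by rewrite fsy.
- by rewrite fsy.
- by rewrite fsy.
- apply: filterS ndy => v [dv dfv]; rewrite -(boundary_chart Xp Aphi dv).
  by rewrite -(boundary_chart Kp Apsi dfv) -fbd.
- by move=> j; exact: Ay.
Qed.

(* f and h have the same sign at x and y, with respect to charts at x and y
   and a common chart at f x = h y. *)
Definition same_sign (Y : nodal_data R) (h : Y -> K) (x : X) (y : Y) :=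
  f x = h y /\ forall phi psi chi b,
    atlas X phi -> chart_dom phi x -> atlas K psi -> chart_dom psi (h y) ->
    atlas Y chi -> chart_dom chi y -> signed_at (nodes X) phi psi f b x ->
    signed_at (nodes Y) chi psi h b y.

Hypothesis XR : nodal_riemann X.

(** Changing charts alters the signs of [f] and [h] by the same amount, so a single choice of charts
    decides. *)
Lemma same_sign_intro (Y : nodal_data R) (h : Y -> K) x y phi psi chi b :
  nodal_riemann Y -> dmor h -> f x = h y ->
  atlas X phi -> chart_dom phi x -> atlas K psi -> chart_dom psi (h y) ->
  atlas Y chi -> chart_dom chi y -> signed_at (nodes X) phi psi f b x ->
  signed_at (nodes Y) chi psi h b y -> same_sign h x y.
Proof.
move=> YR hm fxhy Aphi dx Apsi dhy Achi dy Af Ah; split=> // phi' psi' chi' b' Aphi' dx' Apsi' dhy' Achi' dy' Af'.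
have [fc fn _ _] := fm; have dfx : chart_dom psi (f x) by rewrite fxhy.
have dfx' : chart_dom psi' (f x) by rewrite fxhy.
have [c B] := signed_at_id_ex Kp Apsi Apsi' dhy dhy'.
have B' : signed_at (nodes K) psi psi' idfun c (f x) by rewrite fxhy.
have X2 := signed_at_change XR Kp fm Aphi dx Aphi' dx' Apsi dfx Apsi' dfx' Af B'.
have Y2 := signed_at_change YR Kp hm Achi dy Achi' dy' Apsi dhy Apsi' dhy' Ah B.
have [<-//|nb] := eqVneq (b (+) c) b'.
exfalso; apply: (signed_at_excl Xp Kp fc fn Aphi' Apsi' dx' dfx' X2).
by move: nb Af'; case: (b (+) c); case: b'.
Qed.

Variable sg : X -> X.
Hypothesis fsec : forall p, exists s, local_section f p s.
Hypothesis fsurj : forall y, exists x, f x = y.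
Hypothesis fib : forall x x', f x = f x' -> x' = x \/ x' = sg x.
Hypotheses (sgm : smor true sg) (fsg : forall x, f (sg x) = f x) (sgK : involutive sg).

Lemma signed_at_flip phi phi' psi x b : atlas X phi -> chart_dom phi x -> atlas X phi' -> chart_dom phi' (sg x) ->
  atlas K psi -> chart_dom psi (f x) ->
  signed_at (nodes X) phi psi f b x -> signed_at (nodes X) phi' psi f (~~ b) (sg x).
Proof.
move=> Aphi dx Aphi' dsx Apsi dfx A; have [fc fn fb _] := fm; have [sc sn sb ss] := sgm.
have E : f = f \o sg by apply/funext => v /=; rewrite fsg.
have dx' : chart_dom phi (sg (sg x)) by rewrite sgK.
have dfx' : chart_dom psi (f (sg (sg x))) by rewrite sgK.
have A' : signed_at (nodes X) phi psi f b (sg (sg x)) by rewrite sgK.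
have := signed_at_comp Xp Xp Kp sc sn sb fc fb Aphi' Aphi Apsi dsx dx' dfx' (ss _ _ _ Aphi' Aphi dsx dx') A'.
by rewrite -E.
Qed.

Lemma signed_at_ex (Y : nodal_data R) (h : Y -> K) y : presurf Y -> dmor h -> exists psi chi b,
  [/\ atlas K psi, chart_dom psi (h y), atlas Y chi, chart_dom chi y & signed_at (nodes Y) chi psi h b y].
Proof.
move=> Yp [_ _ _ hs]; have [psi Apsi dp] := ps_cov Kp (h y); have [chi Achi dc] := ps_cov Yp y.
by have [b A] := hs _ _ _ Achi Apsi dc dp; exists psi, chi, b.
Qed.

Lemma same_sign_ex (Y : nodal_data R) (h : Y -> K) y : nodal_riemann Y -> dmor h ->
  exists x, same_sign h x y.
Proof.
move=> YR hm; have Yp := presurf_riemann YR; have [x fx] := fsurj (h y).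
have [psi [chi [b [Apsi dp Achi dc A]]]] := signed_at_ex y Yp hm.
have [phi Aphi dx] := ps_cov Xp x; have [phi' Aphi' dsx] := ps_cov Xp (sg x).
have [fc fn fb fs] := fm; have dfx : chart_dom psi (f x) by rewrite fx.
have [c Af] := fs _ _ _ Aphi Apsi dx dfx.
have [cb|cb] := eqVneq c b.
  by exists x; apply: (same_sign_intro YR hm fx Aphi dx Apsi dp Achi dc _ A); rewrite -cb.
exists (sg x); apply: (same_sign_intro YR hm _ Aphi' dsx Apsi dp Achi dc _ A); first by rewrite fsg.
by have := signed_at_flip Aphi dx Aphi' dsx Apsi dfx Af; case: c b cb {A Af} => [] [].
Qed.

Lemma same_sign_uniq (Y : nodal_data R) (h : Y -> K) x x' y : presurf Y -> dmor h ->
  same_sign h x y -> same_sign h x' y -> x = x'.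
Proof.
move=> Yp hm [fx sx] [fx' sx']; have [//|xx] := fib (etrans fx (esym fx')).
have [psi [chi [_ [Apsi dp Achi dc _]]]] := signed_at_ex y Yp hm.
have [phi Aphi dx] := ps_cov Xp x; have [phi' Aphi' dsx] := ps_cov Xp x'.
have [fc fn fb fs] := fm; have dfx : chart_dom psi (f x) by rewrite fx.
have [c Af] := fs _ _ _ Aphi Apsi dx dfx; have [hc hn _ _] := hm.
exfalso; apply: (signed_at_excl Yp Kp hc hn Achi Apsi dc dp (sx _ _ _ _ Aphi dx Apsi dp Achi dc Af)).
apply: (sx' _ _ _ _ Aphi' dsx Apsi dp Achi dc); rewrite xx in dsx *.
exact: (signed_at_flip Aphi dx).
Qed.

Lemma same_sign_smor (Y : nodal_data R) (h : Y -> K) (g : Y -> X) y : nodal_riemann Y -> dmor h ->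
  smor false g -> f \o g = h -> same_sign h (g y) y.
Proof.
move=> YR hm [gc gn gb gs] E; have Yp := presurf_riemann YR; rewrite -E.
have [phi Aphi dx] := ps_cov Xp (g y); have [psi [chi [b [Apsi dp Achi dc A]]]] := signed_at_ex y Yp hm.
rewrite -E in dp A; have [fc fn fb fs] := fm; have [c Af] := fs _ _ _ Aphi Apsi dx dp.
have hm' : dmor (f \o g) by rewrite E.
apply: (same_sign_intro YR hm' erefl Aphi dx Apsi dp Achi dc Af).
exact: (signed_at_comp Yp Xp Kp gc gn gb fc fb Achi Aphi Apsi dc dx dp (gs _ _ _ Achi Aphi dc dx) Af).
Qed.

Lemma lift_uniq (Y : nodal_data R) (g g' : Y -> X) : nodal_riemann Y ->
  smor false g -> smor false g' -> f \o g = f \o g' -> g = g'.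
Proof.
move=> YR gm gm' E; apply/funext => y; have Yp := presurf_riemann YR.
have hm : dmor (f \o g) := dmor_comp Yp Xp Kp (smor_dmor gm) fm.
apply: (same_sign_uniq Yp hm); first exact: same_sign_smor YR hm gm erefl.
exact: same_sign_smor YR hm gm' (esym E).
Qed.

Lemma lift_ex (Y : nodal_data R) (h : Y -> K) : nodal_riemann Y -> dmor h ->
  exists2 g : Y -> X, smor false g & f \o g = h.
Proof.
move=> YR hm; have Yp := presurf_riemann YR.
have [g gP] := choice (fun y => same_sign_ex y YR hm).
have gE : f \o g = h by apply/funext => y; case: (gP y).
have [fc fn fb fs] := fm; have [hc hn hb hs] := hm.
(* [g] was chosen point by point. But signs persist nearby, so [s (h v)] lies over [h v] with the
   sign of [h] at [v]; by uniqueness it is [g v], and [g] is locally [s \o h]. *)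
have loc y s phi psi chi b : local_section f (g y) s -> atlas X phi -> chart_dom phi (g y) ->
    atlas K psi -> chart_dom psi (h y) -> atlas Y chi -> chart_dom chi y ->
    signed_at (nodes X) phi psi f b (g y) -> signed_at (nodes Y) chi psi h b y ->
    \forall v \near y, g v = s (h v).
  move=> [sf sP _] Aphi dx Apsi dp Achi dc Af Ah; rewrite -[g y]/(g y) in dx Af *.
  have fgy : f (g y) = h y := congr1 (@^~ y) gE.
  rewrite fgy in sf sP; have dfx : chart_dom psi (f (g y)) by rewrite fgy.
  have sc0 : {for h y, continuous s} by have [] := nbhs_singleton sP.
  have N1 := near_and (signed_at_near Af) (near_charts Xp Kp fc Aphi Apsi dx dfx).
  have N2 : \forall v \near h y, signed_at (nodes X) phi psi f b (s v) /\
      (chart_dom phi (s v) /\ chart_dom psi (f (s v))).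
    by apply: (near_map sc0 (P := fun w => signed_at _ phi psi f b w /\ (chart_dom phi w /\ chart_dom psi (f w)))); rewrite sf.
  have N3 := near_map (@hc y) (near_and N2 sP).
  have N4 := near_and (signed_at_near Ah) (near_charts Yp Kp hc Achi Apsi dc dp).
  apply: filterS2 N3 N4 => v [[A1 [d1 d2]] [E1 _]] [A2 [d3 d4]].
  by apply: (same_sign_uniq Yp hm (gP v)); apply: (same_sign_intro YR hm E1 Aphi _ Apsi _ Achi _ A1 A2).
have data y : exists s phi psi chi b, [/\ local_section f (g y) s, atlas X phi /\ chart_dom phi (g y),
    atlas K psi /\ chart_dom psi (h y), atlas Y chi /\ chart_dom chi y &
    signed_at (nodes X) phi psi f b (g y) /\ signed_at (nodes Y) chi psi h b y].
  have [s sP] := fsec (g y); have [phi Aphi dx] := ps_cov Xp (g y).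
  have [psi [chi [b [Apsi dp Achi dc A]]]] := signed_at_ex y Yp hm; have [fgy sg'] := gP y.
  have [c Af] := fs _ _ _ Aphi Apsi dx (eq_ind_r (chart_dom psi) dp fgy).
  exists s, phi, psi, chi, c; split=> //; split=> //; exact: (sg' _ _ _ _ Aphi dx Apsi dp Achi dc Af).
have gc : continuous g.
  move=> y; have [s [phi [psi [chi [b [ls [Aphi dx] [Apsi dp] [Achi dc] [Af Ah]]]]]]] := data y.
  have gs := loc y s phi psi chi b ls Aphi dx Apsi dp Achi dc Af Ah.
  move=> P; rewrite (nbhs_singleton gs) => Ps.
  have [sf sP _] := ls; have fgy : f (g y) = h y := congr1 (@^~ y) gE; rewrite fgy in sf sP.
  have sc0 : {for h y, continuous s} by have [] := nbhs_singleton sP.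
  by apply: filterS2 gs (near_map (@hc y) (near_map sc0 Ps)) => v /= ->.
have gb : g @` boundary Y `<=` boundary X.
  move=> _ [y yb <-]; rewrite -fbd /=; have -> : f (g y) = h y := congr1 (@^~ y) gE.
  by apply: hb; exists y.
exists g => //; split=> //.
  move=> y ny gy; apply: (hn y ny); rewrite -gE; apply: filterS gy => v /= -> //.
move=> chi' phi' y Achi' Aphi' dc' dx'.
have [s [phi [psi [chi [b [ls [Aphi dx] [Apsi dp] [Achi dc] [Af Ah]]]]]]] := data y.
have gs := loc y s phi psi chi b ls Aphi dx Apsi dp Achi dc Af Ah.
have fgy : f (g y) = h y := congr1 (@^~ y) gE.
have dfx : chart_dom psi (f (g y)) by rewrite fgy.
have As := signed_at_section ls Aphi Apsi dx dfx Af; rewrite fgy in As.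
(* Locally [g] is [s \o h], where [s] has the sign [b] of [f] and [h] has the same sign; the two
   cancel. *)
have A1 : signed_at (nodes Y) chi phi g false y.
  rewrite -(addbb b).
  exact: (signed_at_comp_local Yp Kp Xp hc hn gc gb gs Achi Apsi Aphi dc dp dx Ah As).
have iyc := @id_cont _ Y; have iyn := nowhere_const_id Yp; have iyb := @id_bdry _ Y.
have ixc := @id_cont _ X; have ixb := @id_bdry _ X.
have A2 := signed_at_comp Yp Yp Xp iyc iyn iyb gc gb Achi' Achi Aphi dc' dc dx (signed_at_riemann YR Achi' Achi dc' dc) A1.
have gn : nowhere_const g by move=> v nv gv; apply: (hn v nv); rewrite -gE; apply: filterS gv => w /= ->.
exact: (signed_at_comp Yp Xp Xp gc gn gb ixc ixb Achi' Aphi Aphi' dc' dx dx' A2 (signed_at_riemann XR Aphi Aphi' dx dx')).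
Qed.

(** * Descent of maps along the cover *)

Section Descent.
Variables (L : nodal_data R) (k : K -> L).
Hypothesis km : dmor (k \o f).

Lemma descent_continuous : continuous k.
Proof.
move=> p; have [x <-] := fsurj p; have [s [sf sP _]] := fsec x; have [kc _ _ _] := km.
have sc0 : {for f x, continuous s} by have [] := nbhs_singleton sP.
move=> P Pk; have Pk' : \forall v \near s (f x), P (k (f v)) by rewrite sf; exact: kc.
by apply: filterS2 sP (near_map sc0 Pk') => v [fsv _]; rewrite /= fsv.
Qed.

(** Near [f x] the map [k] is [(k \o f) \o s] for a local section [s], which has the sign of [f]
    and, by [fnd], maps non-nodal points to non-nodal ones; so the chain rule applies directly. *)
Lemma signed_at_descent phi psi chi x b c : atlas X phi -> chart_dom phi x -> atlas K psi -> chart_dom psi (f x) ->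
  atlas L chi -> chart_dom chi (k (f x)) -> signed_at (nodes X) phi psi f b x ->
  signed_at (nodes X) phi chi (k \o f) c x -> signed_at (nodes K) psi chi k (b (+) c) (f x).
Proof.
move=> Aphi dx Apsi dfx Achi dkx Af Ak; have [s ls] := fsec x; have [sf sP _] := ls.
have As := signed_at_section ls Aphi Apsi dx dfx Af; have [kc _ _ _] := km.
have sc0 : {for f x, continuous s} by have [] := nbhs_singleton sP.
have N1 : \forall v \near s (f x), chart_dom phi v /\
    (~ nodes X v -> forall j, cholo phi (crd c j chi (k \o f)) v).
  by rewrite sf; exact: near_and (ch_dom (psC Xp Aphi) dx) Ak.
have N2 := near_and (near_map sc0 N1) (near_join sP).
have N3 := ch_dom (psC Kp Apsi) dfx.
apply: filterS3 As N2 N3 => v Asv [[dsv hk] sPv] dv nv j.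
have [fsv scv] := nbhs_singleton sPv.
have nsv : ~ nodes X (s v) by rewrite -fnd /= fsv.
have := crd_comp scv dv (Asv nv) (hk nsv) j; apply: cholo_eq.
by apply: filterS sPv => w [fsw _]; rewrite /crd /= fsw.
Qed.

Lemma descent_dmor : dmor k.
Proof.
have kc := descent_continuous; have [kfc kfn kfb kfs] := km; have [fc fn fb fs] := fm; split=> //.
- move=> p; have [x <-] := fsurj p => nx kx; apply: (kfn x); first by rewrite -fnd.
  by apply: filterS (near_map (@fc x) kx).
- move=> _ [p pb <-]; have [x fx] := fsurj p; rewrite -fx; apply: kfb; exists x => //.
  by rewrite -fbd /= fx.
move=> psi chi p Apsi Achi; have [x <-] := fsurj p => dp dk.
have [phi Aphi dx] := ps_cov Xp x; have [b Af] := fs _ _ _ Aphi Apsi dx dp.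
have [c Ak] := kfs _ _ _ Aphi Achi dx dk.
by exists (b (+) c); exact: (signed_at_descent Aphi dx).
Qed.

End Descent.
End Cover.
End LocalSections.

(** * Mirror charts *)

Section Mirror.
Variable R : realType.
Local Notation C := (Cplx R).

Arguments ncj : simpl never.

(* The reflection in the imaginary axis preserves the models and reverses orientation. *)
Definition mir (z : C * C) : C * C := (ncj true z.1, ncj true z.2).

Lemma mirK : involutive mir.
Proof. by move=> [a b]; rewrite /mir /= !ncjK. Qed.

Lemma sc_mir z : sc (mir z) = ncj true (sc z).
Proof. by rewrite /sc ncjD. Qed.

Lemma pj_mir j z : pj j (mir z) = ncj true (pj j z).
Proof. by case: j. Qed.

Lemma mir_near z (P : set (C * C)) : (\forall w \near mir z, P w) -> \forall w \near z, P (mir w).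
Proof.
move=> /nbhsCC[e e0 H]; apply/nbhsCC; exists e => // w w1 w2; apply: H; rewrite /= /ncj.
  by have -> : - cj w.1 - - cj z.1 = - cj (w.1 - z.1); rewrite ?cabsN ?cabs_cj // cjD cjN opprD.
by have -> : - cj w.2 - - cj z.2 = - cj (w.2 - z.2); rewrite ?cabsN ?cabs_cj // cjD cjN opprD.
Qed.

Lemma mir_model k z : model k z -> model k (mir z).
Proof.
case: k; case: z => a b /=; rewrite ?Im_ge0 ?cim_ncj.
- by move=> [a0 ->]; rewrite /ncj cj0 oppr0.
- by move=> [a0 b0 ab]; split=> //; rewrite /ncj mulrNN -cjM ab cj0.
- by move=> ab; rewrite /ncj mulrNN -cjM ab cj0.
Qed.

Lemma mir0 : mir (0, 0) = (0, 0).
Proof. by rewrite /mir /= /ncj cj0 oppr0. Qed.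

Definition mirror (X : topologicalType) (phi : chart R X) : chart R X :=
  Chart (chart_kind phi) (chart_dom phi) (mir \o chart_map phi) (chart_inv phi \o mir).

Lemma mirror_chart (X : topologicalType) (N : set X) (phi : chart R X) :
  is_chart N phi -> is_chart N (mirror phi).
Proof.
move=> phiP; have [[dO [V Vo VE]] mc ic mK nP] := phiP.
have iE (z : C * C) : ((mir \o chart_map phi) @` chart_dom phi) z <-> (chart_map phi @` chart_dom phi) (mir z).
  split=> [[y dy <-]|[y dy yz]]; first by exists y => //=; rewrite mirK.
  by exists y => //=; rewrite yz mirK.
split.
- split; first exact: dO.
  exists (mir @^-1` V).
    rewrite openE => z Vz; apply: (@mir_near z V).
    by move: Vo; rewrite openE; apply.
  apply/seteqP; split=> z.
    move=> /iE; rewrite VE => -[Vz mz]; split=> //; by rewrite -[z]mirK; exact: mir_model.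
  by move=> [Vz mz]; apply/iE; rewrite VE; split=> //; exact: mir_model.
- apply/subspace_continuousP => x dx P /mir_near Px.
  by move/subspace_continuousP: mc => /(_ x dx (P \o mir) Px).
- apply/subspace_continuousP => z /iE dz P Pz.
  move/subspace_continuousP: ic => /(_ _ dz P Pz) H.
  by apply: filterS (mir_near H) => w Hw /iE.
- by move=> x dx; rewrite /= mirK mK.
- rewrite /=; case: (chart_kind phi) nP => // -[p [p0 pN]]; exists p; by rewrite p0 mir0.
Qed.

Lemma cholo_mirror (X : topologicalType) (phi psi : chart R X) (h : X -> C) x :
  (forall y, sc (chart_map psi y) = ncj true (sc (chart_map phi y))) ->
  cholo phi h x -> cholo psi (fun y => cj (h y)) x.
Proof.
move=> E [G Gt GE]; exists (fun w => cj (G (ncj true w))).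
  rewrite E; move: (sc _) Gt => t Gt.
  suff : holo (fun w => cj ((G \o (fun w => - w)) (cj w))) (ncj true t) by [].
  by apply: holo_cj; apply: holo_comp; [exact: holoN (holo_id _)|by rewrite /= /ncj cjN cjK opprK].
by apply: filterS GE => y ->; rewrite E ncjK.
Qed.

Lemma cholo_unmirror (X : topologicalType) (phi : chart R X) (h : X -> C) x :
  cholo phi (fun y => cj (h y)) x -> cholo (mirror phi) h x.
Proof.
move=> H; have := @cholo_mirror _ phi (mirror phi) _ x (fun y => sc_mir _) H.
by apply: cholo_eq; apply: (@filterE _ (nbhs x)) => y; rewrite cjK.
Qed.

Lemma signed_at_mirror_l (X Y : topologicalType) (N : set X) phi (psi : chart R Y) (f : X -> Y) b x :
  signed_at N phi psi f b x -> signed_at N (mirror phi) psi f (~~ b) x.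
Proof.
apply: filterS => y H ny j; apply: cholo_unmirror; apply: cholo_eq (H ny j).
by apply: (@filterE _ (nbhs y)) => v; rewrite /crd; case: (b) => //=; rewrite cjK.
Qed.

Lemma signed_at_unmirror_l (X Y : topologicalType) (N : set X) phi (psi : chart R Y) (f : X -> Y) b x :
  signed_at N (mirror phi) psi f b x -> signed_at N phi psi f (~~ b) x.
Proof.
apply: filterS => y H ny j; have {}H := H ny j.
have := @cholo_mirror _ (mirror phi) phi _ y _ H; move=> /(_ _)/wrap[].
  by move=> v /=; rewrite sc_mir ncjK.
by apply: cholo_eq; apply: (@filterE _ (nbhs y)) => v; rewrite /crd; case: (b) => //=; rewrite cjK.
Qed.

Lemma choloN (X : topologicalType) (phi : chart R X) (h : X -> C) x : cholo phi h x -> cholo phi (fun y => - h y) x.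
Proof. by move=> [G Gt E]; exists (fun w => - G w); [exact: holoN|apply: filterS E => y ->]. Qed.

Lemma signed_at_mirror_r (X Y : topologicalType) (N : set X) phi (psi : chart R Y) (f : X -> Y) b x :
  signed_at N phi psi f b x -> signed_at N phi (mirror psi) f (~~ b) x.
Proof.
apply: filterS => y H ny j; apply: cholo_eq (choloN (H ny j)).
apply: (@filterE _ (nbhs y)) => v; rewrite /crd /= pj_mir.
by case: (b); rewrite /= /ncj ?cjN ?cjK.
Qed.

Lemma signed_at_unmirror_r (X Y : topologicalType) (N : set X) phi (psi : chart R Y) (f : X -> Y) b x :
  signed_at N phi (mirror psi) f b x -> signed_at N phi psi f (~~ b) x.
Proof.
apply: filterS => y H ny j; apply: cholo_eq (choloN (H ny j)).
apply: (@filterE _ (nbhs y)) => v; rewrite /crd /= pj_mir.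
by case: (b); rewrite /= /ncj ?cjN ?cjK opprK.
Qed.

(** Transition maps with the mirror chart still have signs, namely the opposite ones, so the maximal
    atlas contains it. Both local orientations at a point are thus given by charts of the atlas. *)
Lemma mirror_atlas (K : nodal_data R) phi : nodal_klein K -> atlas K phi -> atlas K (mirror phi).
Proof.
move=> KK Aphi; have Kp := presurf_klein KK; have [_ [_ _ _ Kmax]] := KK.
have phiP := mirror_chart (psC Kp Aphi).
have ex := signed_at_excl Kp Kp (@id_cont _ K) (nowhere_const_id Kp).
apply: Kmax => // [_ psi -> Apsi|psi _ Apsi ->].
- apply: (signed_at_dianalytic phiP (ch_open (psC Kp Apsi)) (@id_cont _ K)).
    move=> x dx dfx; have [b A] := signed_at_id_ex Kp Aphi Apsi dx dfx.
    by exists (~~ b); exact: signed_at_mirror_l.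
  move=> x b dx dfx /signed_at_unmirror_l A1 /signed_at_unmirror_l A2.
  exact: (ex _ _ _ _ Aphi Apsi dx dfx A1 A2).
- apply: (signed_at_dianalytic (psC Kp Apsi) (ch_open phiP) (@id_cont _ K)).
    move=> x dx dfx; have [b A] := signed_at_id_ex Kp Apsi Aphi dx dfx.
    by exists (~~ b); exact: signed_at_mirror_r.
  move=> x b dx dfx /signed_at_unmirror_r A1 /signed_at_unmirror_r A2.
  exact: (ex _ _ _ _ Apsi Aphi dx dfx A1 A2).
Qed.

End Mirror.

(** * The quotient of a symmetric Riemann surface *)

Section OrbitMap.

(** A point and its image under [sg] are distinct, hence separated by open sets. Shrinking gives an
    open [V] disjoint from its preimage [W] under [sg]; [f] is injective on each, as its fibres are
    orbits, and they are the sheets over the image of [V]. *)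
Lemma double_cover_intro (X Y : topologicalType) (f : X -> Y) (sg : X -> X) :
  hausdorff_space X -> continuous f -> (forall U, open U -> open (f @` U)) ->
  (forall y, exists x, f x = y) -> (forall x x', f x = f x' -> x' = x \/ x' = sg x) ->
  (forall x, f (sg x) = f x) -> continuous sg -> involutive sg -> (forall x, sg x <> x) ->
  double_cover f.
Proof.
move=> Xh fc fo fsurj fib fsg sc sgK nfix; split=> // p; have [x fx] := fsurj p.
have [[A B] [/= xA sxB] [Ao Bo /seteqP[AB _]]] : exists2 AB : set X * set X,
    (x \in AB.1 /\ sg x \in AB.2) & [/\ open AB.1, open AB.2 & AB.1 `&` AB.2 = set0].
  have := Xh; rewrite open_hausdorff => /(_ x (sg x)).
  have /eqP xs : x <> sg x by move=> E; apply: (nfix x).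
  by move=> /(_ xs)[AB [? ?] [? ? /eqP ?]]; exists AB.
rewrite !inE in xA sxB.
pose V := A `&` sg @^-1` B; pose W := sg @^-1` V; pose U := f @` V.
have sgo (S : set X) : open S -> open (sg @^-1` S) by move=> So; exact: open_comp.
have Vo : open V by apply: openI => //; exact: sgo.
have Wo : open W by exact: sgo.
have Uo : open U by exact: fo.
have Vinj v v' : V v -> V v' -> f v = f v' -> v = v'.
  by move=> [_ svB] [v'A _] /fib[->//|E]; case: (AB v'); rewrite E in v'A *.
have [g gP] : {g : Y -> X & forall y, U y -> V (g y) /\ f (g y) = y}.
  apply: (choice (P := fun y v => U y -> V v /\ f v = y)) => y.
  by have [[v Vv fv]|n] := pselect (U y); [exists v|exists x].
have gV v : V v -> g (f v) = v.
  by move=> Vv; have [] := gP (f v); [exists v|move=> ? ?; exact: Vinj].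
have gc : {in U, continuous g}.
  move=> y; rewrite inE => Uy P Pg; have [Vy fy] := gP _ Uy.
  have [Q [[Qo Qg] QP]] : exists Q, open_nbhs (g y) Q /\ Q `<=` P by move: Pg; rewrite nbhsE => -[Q ? ?]; exists Q.
  have fQ : open (f @` (Q `&` V)) by apply: fo; exact: openI.
  have fQy : (f @` (Q `&` V)) y by exists (g y).
  apply: filterS (open_nbhs_nbhs (conj fQ fQy)) => z [w [Qw Vw] <-].
  by rewrite /= gV //; exact: QP.
exists U, V, W; split.
- by split=> //; rewrite -fx; exists x; split.
- by [].
- by apply/seteqP; split=> v // [[vA svB] [svA _]]; apply: (AB (sg v)).
- apply/seteqP; split=> v; last by case=> [Vv|Wv]; [exists v|exists (sg v)].
  by case=> w Vw /fib[->|->]; [left|right; rewrite /W /= sgK].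
split; split.
- exact: continuous_subspaceT.
- exists g; split.
  + by rewrite continuous_open_subspace.
  + by move=> _ [v Vv <-]; exists v.
  + by move=> _ [y /gP[Vy _] <-].
  + by move=> v; rewrite inE; exact: gV.
  + by move=> y; rewrite inE => /gP[].
- exact: continuous_subspaceT.
- exists (sg \o g); split.
  + rewrite continuous_open_subspace // => y Uy.
    by apply: continuous_comp; [exact: gc|exact: sc].
  + by move=> _ [v Wv <-]; exists (sg v).
  + by move=> _ [y /gP[Vy _] <-]; rewrite /W /= sgK.
  + by move=> v; rewrite inE => Wv; rewrite /= -[f v]fsg gV.
  + by move=> y; rewrite inE => /gP[_ fy]; rewrite /= fsg.
Qed.

Variables (X : topologicalType) (s : X -> X).
Hypothesis sK : involutive s.
Let q := @orbit_map X s sK.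
Local Open Scope quotient_scope.

Lemma orbit_mapP x y : q x = q y <-> x = y \/ x = s y.
Proof.
split; first by move=> /eqmodP/orP[]/eqP ->; [left|right].
by move=> H; apply/eqmodP; apply/orP; case: H => ->; [left|right].
Qed.

Lemma orbit_map_surj y : exists x, q x = y.
Proof. by exists (repr y); rewrite /q /orbit_map reprK. Qed.

Lemma orbit_map_cont : continuous q.
Proof. exact: pi_continuous. Qed.

Lemma orbit_map_open : continuous s -> forall U, open U -> open (q @` U).
Proof.
move=> sc U Uo; change (open (q @^-1` (q @` U))).
have -> : q @^-1` (q @` U) = U `|` s @^-1` U.
  apply/seteqP; split=> x; first by case=> y Uy /orbit_mapP[<-|E]; [left|right; rewrite E in Uy].
  case=> [Ux|sx]; first by exists x.
  by exists (s x) => //; apply/orbit_mapP; right.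
by apply: openU => //; exact: open_comp.
Qed.

End OrbitMap.

Section Quotient.
Variable R : realType.
Local Notation C := (Cplx R).
Implicit Types X K : nodal_data R.

(** For the boundary, [boundary_pull] is applied at [s x], whose image [s (s x) = x] is a boundary
    point. *)
Lemma smor_involution X (s : X -> X) : nodal_riemann X -> involutive s -> continuous s ->
  in_charts (@antianalytic R) (atlas X) (atlas X) s -> smor true s.
Proof.
move=> XR sK sc sa; have Xp := presurf_riemann XR.
have ss : signedb true s by apply: (signedb_charts true Xp Xp sc).1.
have sn : nowhere_const s.
  by move=> x nx sx; apply: (nowhere_const_id Xp nx); apply: filterS sx => y /(can_inj sK).
split=> // _ [x xb <-].
have [phi Aphi dx] := ps_cov Xp (s x); have [psi Apsi dsx] := ps_cov Xp x.
have dssx : chart_dom psi (s (s x)) by rewrite sK.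
apply/(boundary_chart Xp Aphi dx).
apply: (boundary_pull Xp Xp sc sn Aphi Apsi dx dssx (ss _ _ _ Aphi Apsi dx dssx)).
by rewrite sK; apply/(boundary_chart Xp Apsi dsx).
Qed.

(* A fixed point of sg would make f both analytic and antianalytic near it. *)
Lemma antianalytic_no_fix X K (f : X -> K) (sg : X -> X) x : presurf X -> presurf K ->
  dmor f -> smor true sg -> (forall y, f (sg y) = f y) -> sg x <> x.
Proof.
move=> Xp Kp [fc fn fb fs] [sc sn sb ss] fsg sx.
have [phi Aphi dx] := ps_cov Xp x; have [psi Apsi dfx] := ps_cov Kp (f x).
have [b A] := fs _ _ _ Aphi Apsi dx dfx.
have dsx : chart_dom phi (sg x) by rewrite sx.
have dfsx : chart_dom psi (f (sg x)) by rewrite fsg.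
have A' : signed_at (nodes X) phi psi f b (sg x) by rewrite sx.
have := signed_at_comp Xp Xp Kp sc sn sb fc fb Aphi Aphi Apsi dx dsx dfsx (ss _ _ _ Aphi Aphi dx dsx) A'.
have -> : f \o sg = f by apply/funext => y /=.
exact: (signed_at_excl Xp Kp fc fn Aphi Apsi dx dfx A).
Qed.

(* Near a smooth point over a node, one of the two coordinates of f would
   vanish identically, which is impossible for an open map. *)
Lemma local_homeo_nodes X K (f : X -> K) x s : presurf X -> presurf K -> dmor f ->
  local_section f x s -> nodes K (f x) -> nodes X x.
Proof.
move=> Xp Kp [fc fn fb fs] [sf sP _] Nfx; apply: contrapT => nx.
have [phi Aphi dx] := ps_cov Xp x; have [psi Apsi dfx] := ps_cov Kp (f x).
have [b A] := fs _ _ _ Aphi Apsi dx dfx; have h := nbhs_singleton A nx.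
have psiP := psC Kp Apsi; have kn : chart_kind psi <> Smooth by move=> /(ch_smooth psiP dfx).
have mfx := (ch_node psiP dfx kn).2 Nfx.
have c0 j : crd b j psi f x = 0 by rewrite /crd mfx; case: (j) (b) => [] [] //; exact: cj0.
have sc0 : {for f x, continuous s} by have [] := nbhs_singleton sP.
have K1 j : ~ (\forall y \near x, crd b j psi f y = crd b j psi f x).
  move=> H; have H' : \forall v \near s (f x), crd b j psi f v = 0 by rewrite sf -(c0 j).
  have := ch_inv psiP dfx (near_and (near_map sc0 H') sP); rewrite mfx => /nbhsCC[e e0 He].
  have e2 : cabs (cR (e / 2) - 0) < e by rewrite subr0 cabs_cR gtr0_norm ?divr_gt0 //; move: e0; lra.
  have [] := He (ax j (cR (e / 2))).
  - by case: (j); [exact: cabs_sub0|exact: e2].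
  - by case: (j); [exact: e2|exact: cabs_sub0].
  - apply: ax_model; first by move=> /kn.
    by move=> _; rewrite !cE.
  move=> [+ [fsv _]] _ mv; rewrite /crd fsv mv.
  have E : pj j (ax j (cR (e / 2))) = cR (e / 2) by case: (j).
  rewrite E => /(congr1 (@cabs R)); rewrite cabs0.
  have -> : cabs (cjb b (cR (e / 2))) = e / 2.
    have -> : cabs (cjb b (cR (e / 2))) = cabs (cR (e / 2)) by case: (b) => //; exact: cabs_cj.
    by rewrite cabs_cR gtr0_norm // divr_gt0.
  by move=> E2; move: e0; lra.
have iso j := cholo_isolated (psC Xp Aphi) dx nx (h j).
have [/K1//|I0] := iso false; have [/K1//|I1] := iso true.
apply: (nowhere_const_id Xp nx); apply: filterS3 I0 I1 (near_charts Xp Kp fc Aphi Apsi dx dfx).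
move=> y y0 y1 [dy dfy]; apply: contrapT => yx.
have := ch_model psiP dfy; have {}y0 := y0 yx; have {}y1 := y1 yx; rewrite !c0 in y0 y1.
have z j : pj j (chart_map psi (f y)) = 0 -> crd b j psi f y = 0.
  by rewrite /crd => ->; case: (b) => //; exact: cj0.
have P : (chart_map psi (f y)).1 * (chart_map psi (f y)).2 = 0 -> False.
  by move=> /eqP; rewrite mulf_eq0 => /orP[]/eqP E; [apply: y0; exact: (z false)|apply: y1; exact: (z true)].
case: (chart_kind psi) kn => // _; by case=> _ _ /P.
Qed.

(** What lifting and descent use of an orienting double, without marked points and in terms of
    signs. *)
Record is_double (X K : nodal_data R) (sg : X -> X) (f : X -> K) : Prop := IsDouble {
  dbl_riemann : nodal_riemann X;
  dbl_presurf : presurf K;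
  dbl_mor : dmor f;
  dbl_boundary : f @^-1` boundary K = boundary X;
  dbl_nodes : f @^-1` nodes K = nodes X;
  dbl_section : forall p, exists s, local_section f p s;
  dbl_surj : forall y, exists x, f x = y;
  dbl_fiber : forall x x', f x = f x' -> x' = x \/ x' = sg x;
  dbl_anti : smor true sg;
  dbl_inv : forall x, f (sg x) = f x;
  dbl_invK : involutive sg }.

Lemma is_double_intro X K (sg : X -> X) (f : X -> K) : nodal_riemann X -> nodal_klein K ->
  dmor f -> double_cover f -> f @^-1` boundary K = boundary X -> f @^-1` nodes K = nodes X ->
  smor true sg -> (forall x, f (sg x) = f x) -> involutive sg -> is_double sg f.
Proof.
move=> XR KK fm fd fb fn sm fsg sK; have Xp := presurf_riemann XR; have Kp := presurf_klein KK.
split=> //.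
- by move=> p; exact: double_cover_section.
- by move=> y; exact: double_cover_surj.
move=> x x' fx; have [->|xx'] := pselect (x' = x); first by left.
right; apply/esym; apply: (double_cover_fiber fd (x := x)) => //; first by rewrite fsg.
  by move=> E; apply: xx'.
exact: (antianalytic_no_fix Xp Kp fm sm).
Qed.

Lemma orienting_double_is_double (K : klein_obj R) (X : symriem_obj R) (f : X -> K) :
  orienting_double f -> is_double (@sym_inv R X) f.
Proof.
move=> [[fd dc] fb fn fsg _]; have XR := symP X; have KK := kleinP K.
have Xp := presurf_riemann XR; have Kp := presurf_klein KK.
apply: is_double_intro => //; first exact/(dmor_dianalytic _ Xp Kp).
apply: smor_involution => //; [exact: sym_invK|exact: sym_inv_continuous|exact: sym_inv_antianalytic].
exact: sym_invK.
Qed.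

Lemma signed_chart (K : nodal_data R) X (f : X -> K) x b : presurf X -> nodal_klein K -> dmor f ->
  exists phi psi, [/\ atlas X phi, chart_dom phi x, atlas K psi, chart_dom psi (f x) &
    signed_at (nodes X) phi psi f b x].
Proof.
move=> Xp KK [_ _ _ fs]; have Kp := presurf_klein KK.
have [phi Aphi dx] := ps_cov Xp x; have [psi Apsi dfx] := ps_cov Kp (f x).
have [c A] := fs _ _ _ Aphi Apsi dx dfx; have [<-|cb] := eqVneq c b; first by exists phi, psi.
exists phi, (mirror psi); split=> //; first exact: mirror_atlas.
by move: (signed_at_mirror_r A); case: (c) (b) cb => [] [].
Qed.

(** The orientation at the image of a marked point is the class of a chart [w i] in which the
    quotient map is analytic there, so these orientations select the given points. An involution
    without fixed points leaves no fixed marked points. *)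
Lemma quotient_double (X : symriem_obj R) : exists (K : klein_obj R) (f : X -> K), orienting_double f.
Proof.
have [N [A [[KQ cQ] qd nq bq _]]] := sym_dianalytic X.
set Q := NodalData N A in KQ cQ qd nq bq; set q : X -> Q := orbit_map _ in qd nq bq.
have XR := symP X; have Xp := presurf_riemann XR; have Kp := presurf_klein KQ.
have qm : dmor q by apply/(dmor_dianalytic _ Xp Kp).
pose sK := @sym_invK R X; have sc := @sym_inv_continuous R X.
have sm : smor true (@sym_inv R X) by apply: smor_involution => //; exact: sym_inv_antianalytic.
have qs x : q (sym_inv x) = q x by apply/(@orbit_mapP _ _ sK); right.
have nfix x : sym_inv x <> x := antianalytic_no_fix Xp Kp qm sm qs.
have dc : double_cover q.
  apply: (@double_cover_intro _ _ q (@sym_inv R X)) => //; first by case: XR => -[].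
  - exact: orbit_map_cont.
  - exact: orbit_map_open.
  - exact: orbit_map_surj.
  by move=> x x' /(@orbit_mapP _ _ sK)[->|->]; [left|right; rewrite sK].
have qn : q @^-1` nodes Q = nodes X.
  apply/seteqP; split=> x; last by move=> /nq[].
  by have [s ls] := double_cover_section x dc; exact: (local_homeo_nodes Xp Kp qm ls).
have qb : q @^-1` boundary Q = boundary X.
  have [qc qnl qbd qsg] := qm; apply/seteqP; split=> x; last by move=> xb; apply: qbd; exists x.
  have [phi Aphi dx] := ps_cov Xp x; have [psi Apsi dfx] := ps_cov Kp (q x).
  have [b Ab] := qsg _ _ _ Aphi Apsi dx dfx.
  move=> /(boundary_chart Kp Apsi dfx) H; apply/(boundary_chart Xp Aphi dx).
  exact: (boundary_pull Xp Kp qc qnl Aphi Apsi dx dfx Ab H).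
pose pt (i : 'I_(sym_free X)) : X := sym_free_pt (lshift _ i).
have [w1 w1P] := choice (fun i => signed_chart (pt i) false Xp KQ qm).
have [w wP] := choice w1P.
pose or i := charts_at (q (pt i)) `&` [set psi | analytic_near (w i) psi idfun (q (pt i))].
have bn p : nodes Q p -> boundary_node p.
  have [x <-] : exists x, q x = p by exact: orbit_map_surj.
  by move=> Nx; apply: nq; rewrite -qn.
have pin : injective (q \o pt).
  move=> i j /(@orbit_mapP _ _ sK)[/sym_free_pt_inj/lshift_inj //|].
  rewrite sym_free_pt_inv => /sym_free_pt_inj/eqP.
  by rewrite eq_lrshift.
have pnn i : ~ nodes Q (q (pt i)).
  by move=> Nq; apply: (@sym_free_pt_nonnodal _ X (lshift _ i)); rewrite -qn.
have orP i : local_orientation (q (pt i)) (or i).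
  by exists (w i) => //; have [] := wP i.
pose K := KleinObj KQ cQ bn pin pnn (fun i => bq (lshift _ i)) orP.
exists K, (q : X -> K); split=> //.
split.
  apply/eqP; rewrite -leqn0 leqNgt; apply/negP => n0.
  exact: nfix (sym_fixed_pt_inv (Ordinal n0)).
exists erefl => i; rewrite cast_ord_id; split=> // phi psi [Aphi dx] [[Apsi dfx] /= an].
have [A1 d1 A2 d2 Af] := wP i.
have [_ _ Ac] := (analytic_near_signed_at (psC Kp A2) (ch_open (psC Kp Apsi)) (@id_cont _ Q) _).1 an.
have [qc _ _ _] := qm.
apply/(analytic_near_signed_at (psC Xp Aphi) (ch_open (psC Kp Apsi)) qc); split=> //.
exact: (signed_at_change XR Kp qm A1 d1 Aphi dx A2 d2 Apsi dfx Af Ac).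
Qed.

End Quotient.

(** * The orienting double of a Klein surface *)

Section Push.
Variable R : realType.
Local Notation C := (Cplx R).

(** Transport of a chart along a homeomorphism [h] with inverse [k], by which the orbit space of the
    double receives the Klein structure of [K]. *)
Definition push (X Y : topologicalType) (h : X -> Y) (k : Y -> X) (phi : chart R X) : chart R Y :=
  Chart (chart_kind phi) (k @^-1` chart_dom phi) (chart_map phi \o k) (h \o chart_inv phi).

Lemma push_chart (X Y : topologicalType) (h : X -> Y) (k : Y -> X) (N : set X) phi :
  continuous h -> continuous k -> cancel h k -> cancel k h ->
  is_chart N phi -> is_chart (k @^-1` N) (push h k phi).
Proof.
move=> hc kc hK kK [[dO [V Vo VE]] mc ic mK nP].
have iE : (chart_map phi \o k) @` (k @^-1` chart_dom phi) = chart_map phi @` chart_dom phi.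
  apply/seteqP; split=> z; first by move=> [y dy <-]; exists (k y).
  by move=> [x dx <-]; exists (h x); rewrite /= hK.
split.
- split; first exact: open_comp.
  by exists V => //=; rewrite iE.
- apply/subspace_continuousP => y dy P Py.
  move/subspace_continuousP: mc => /(_ _ dy P Py)/(near_map (@kc y)).
  by apply: filterS => w Hw dw; exact: Hw.
- change {within (chart_map phi \o k) @` (k @^-1` chart_dom phi), continuous (h \o chart_inv phi)}.
  rewrite iE; apply/subspace_continuousP => z dz P Pz.
  move/subspace_continuousP: ic => /(_ _ dz _ (@hc _ _ Pz)).
  exact.
- by move=> y; rewrite inE => dy /=; rewrite mK ?inE.
rewrite /=; case: (chart_kind phi) nP => [d0|[p [p0 /seteqP[pN1 pN2]]]|[p [p0 /seteqP[pN1 pN2]]]].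
- by apply/seteqP; split=> // y [dy Ny]; have : (chart_dom phi `&` N) (k y) by []; rewrite d0.
- exists (h p); rewrite /= hK; split=> //; apply/seteqP; split=> y.
    by move=> /(pN1 (k y)) <-; rewrite kK.
  by move=> ->; rewrite /setI /= hK; exact: pN2.
- exists (h p); rewrite /= hK; split=> //; apply/seteqP; split=> y.
    by move=> /(pN1 (k y)) <-; rewrite kK.
  by move=> ->; rewrite /setI /= hK; exact: pN2.
Qed.

Lemma pushK (X Y : topologicalType) (h : X -> Y) (k : Y -> X) phi :
  cancel h k -> push k h (push h k phi) = phi.
Proof.
move=> hK; rewrite /push /=; case: phi => kd d m i /=; congr Chart.
- by apply/seteqP; split=> x /=; rewrite hK.
- by apply/funext => x /=; rewrite hK.
- by apply/funext => x /=; rewrite hK.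
Qed.

Lemma push_in_charts P (X Y : topologicalType) (h : X -> Y) (k : Y -> X) (A B : set (chart R X)) :
  cancel h k -> cancel k h -> in_charts P A B idfun ->
  in_charts P (push h k @` A) (push h k @` B) idfun.
Proof.
move=> hK kK H _ _ [phi Aphi <-] [psi Bpsi <-]; have := H _ _ Aphi Bpsi.
have -> : local_expr (push h k phi) (push h k psi) idfun = local_expr phi psi idfun.
  by apply/funext => z; rewrite /local_expr /= hK.
suff -> : local_dom (push h k phi) (push h k psi) idfun = local_dom phi psi idfun by [].
apply/seteqP; split=> z [x [dx dx'] <-]; first by exists (k x).
by exists (h x); rewrite /= /preimage /= ?hK.
Qed.

Variables (K : nodal_data R) (T : topologicalType) (h : K -> T) (k : T -> K).
Hypotheses (hc : continuous h) (kc : continuous k) (hK : cancel h k) (kK : cancel k h).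

Definition push_data := NodalData (k @^-1` nodes K) (push h k @` atlas K).

Lemma push_klein : nodal_klein K -> nodal_klein push_data.
Proof.
move=> [[Kh Kc Kf] [Kat Kcov Kt Kmax]]; split; split.
- move=> x y cxy; rewrite -[x]kK -[y]kK; congr h; apply: Kh => A B Ax By.
  have [z [Az Bz]] := cxy _ _ (@kc x _ Ax) (@kc y _ By).
  by exists (k z).
- have -> : [set: points push_data] = h @` [set: K].
    by apply/seteqP; split=> // y _; exists (k y) => //; exact: kK.
  apply: continuous_compact => //; exact: continuous_subspaceT.
- have -> : nodes push_data = h @` nodes K.
    apply/seteqP; split=> y; first by exists (k y) => //; exact: kK.
    by move=> [x Nx <-]; rewrite /push_data /= hK.
  exact: finite_image.
- by move=> _ [phi Aphi <-]; apply: push_chart => //; exact: Kat.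
- by move=> y; have [phi Aphi dy] := Kcov (k y); exists (push h k phi) => //; exists phi.
- exact: push_in_charts.
move=> phi phiP H1 H2; exists (push k h phi); last exact: pushK.
have E (A : set (chart R K)) : push k h @` (push h k @` A) = A.
  apply/seteqP; split=> psi; first by move=> [_ [chi Achi <-] <-]; rewrite pushK.
  by move=> Apsi; exists (push h k psi); [exists psi|rewrite pushK].
have S : [set push k h phi] = push k h @` [set phi] by rewrite image_set1.
apply: Kmax.
- have := push_chart kc hc kK hK phiP; congr (is_chart _ _).
  by apply/seteqP; split=> x /=; rewrite hK.
- by rewrite S -[atlas K]E; apply: push_in_charts.
- by rewrite S -[X in in_charts _ X]E; apply: push_in_charts.
Qed.

End Push.

(* The point (p, b) stands for p with the local orientation at p given by the
   chart c p if b = false, and by its mirror image if b = true. *)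
Definition odouble (R : realType) (K : nodal_data R) (c : K -> chart R K) : Type := (K * bool)%type.

Section DoubleSpace.
Variables (R : realType) (K : nodal_data R) (c : K -> chart R K).

Local Notation D := (odouble c).

HB.instance Definition _ := Choice.copy D (K * bool)%type.

(** The reference charts [c p] are chosen independently at each point, so nearby pairs may have
    unrelated second components; only the sections [sec phi] tell which pairs are close. *)
Definition sgn (phi : chart R K) (p : K) : bool := `[< signed_at (nodes K) phi (c p) idfun true p >].

Definition sec (phi : chart R K) (p : K) : D := (p, sgn phi p).

(** The final topology for the sections [sec phi]. *)
Definition double_open (O : set D) := forall phi p,
  atlas K phi -> chart_dom phi p -> O (sec phi p) -> \forall v \near p, O (sec phi v).

Lemma double_openT : double_open setT.
Proof. by move=> phi p _ _ _; apply: filterE. Qed.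

Lemma double_openI (A B : set D) : double_open A -> double_open B -> double_open (A `&` B).
Proof.
move=> Ao Bo phi p Aphi dp [Ap Bp]; exact: (filterI (Ao _ _ Aphi dp Ap) (Bo _ _ Aphi dp Bp)).
Qed.

Lemma double_open_bigU (I : Type) (f : I -> set D) :
  (forall i, double_open (f i)) -> double_open (\bigcup_i f i).
Proof.
move=> fo phi p Aphi dp [i _ fi]; apply: filterS (fo i _ _ Aphi dp fi) => v fv.
by exists i.
Qed.

HB.instance Definition _ := isOpenTopological.Build D double_openT double_openI double_open_bigU.

Hypotheses (KK : nodal_klein K) (cP : forall p, charts_at p (c p)).
Let Kp : presurf K := presurf_klein KK.
Implicit Types (phi psi : chart R K) (p : K) (x : D).

Lemma signed_at_id_uniq phi psi p b b' : atlas K phi -> chart_dom phi p -> atlas K psi -> chart_dom psi p ->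
  signed_at (nodes K) phi psi idfun b p -> signed_at (nodes K) phi psi idfun b' p -> b = b'.
Proof.
move=> A1 d1 A2 d2 H1 H2; apply/eqP; apply: contraT => bb; exfalso.
apply: (signed_at_excl Kp Kp (@id_cont _ K) (nowhere_const_id Kp) A1 A2 d1 d2 H1).
by case: b b' bb H1 H2 => [] [].
Qed.

Lemma sgnP phi p : atlas K phi -> chart_dom phi p -> signed_at (nodes K) phi (c p) idfun (sgn phi p) p.
Proof.
move=> Aphi dp; have [Ac dc] := cP p; rewrite /sgn; case: asboolP => // n.
by have [[//|//]] := signed_at_id_ex Kp Aphi Ac dp dc.
Qed.

Lemma sgn_signed_at phi psi p b : atlas K phi -> chart_dom phi p -> atlas K psi -> chart_dom psi p ->
  signed_at (nodes K) phi psi idfun b p <-> sgn phi p = b (+) sgn psi p.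
Proof.
move=> A1 d1 A2 d2; have [Ac dc] := cP p.
have H b' : signed_at (nodes K) phi psi idfun b' p -> sgn phi p = b' (+) sgn psi p.
  move=> A; apply: (signed_at_id_uniq A1 d1 Ac dc (sgnP A1 d1)).
  have A' := sgnP A2 d2.
  have T := @signed_at_trans R K Kp phi psi (c p) p b' (sgn psi p) A1 A2 Ac d1 d2 dc A A'.
  exact: T.
split; first exact: H.
have [b' A] := signed_at_id_ex Kp A1 A2 d1 d2; rewrite (H _ A) => /(congr1 (addb^~ (sgn psi p))).
by rewrite -!addbA addbb !addbF => <-.
Qed.

Lemma sgn_mirror phi p : atlas K phi -> chart_dom phi p -> sgn (mirror phi) p = ~~ sgn phi p.
Proof.
move=> A1 d1; apply/(sgn_signed_at true) => //; first exact: mirror_atlas.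
have A := signed_at_refl Kp A1 d1.
have B := signed_at_mirror_l A.
exact: B.
Qed.

Lemma sec_eq phi psi p : atlas K phi -> chart_dom phi p -> atlas K psi -> chart_dom psi p ->
  sgn phi p = sgn psi p -> \forall v \near p, sec phi v = sec psi v.
Proof.
move=> A1 d1 A2 d2 E; have A : signed_at (nodes K) phi psi idfun false p by apply/sgn_signed_at.
apply: filterS3 (signed_at_near A) (ch_dom (psC Kp A1) d1) (ch_dom (psC Kp A2) d2) => v Av d1' d2'.
by congr pair; apply/(sgn_signed_at false).
Qed.

Lemma sec_ex x : exists phi, [/\ atlas K phi, chart_dom phi x.1 & x = sec phi x.1].
Proof.
case: x => p b /=; have [Ac dc] := cP p.
have s0 : sgn (c p) p = false.
  by apply/(@signed_at_id_uniq (c p) (c p) p) => //; [exact: sgnP|exact: signed_at_refl].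
case: b; last by exists (c p); rewrite /sec s0.
by exists (mirror (c p)); split=> //; [exact: mirror_atlas|rewrite /sec sgn_mirror // s0].
Qed.

(** Charts with the same sign at a point define the same section near it ([sec_eq]), so sections
    have open images and are homeomorphisms onto them. *)
Lemma nbhs_sec phi p (P : set D) : atlas K phi -> chart_dom phi p ->
  nbhs (sec phi p) P <-> \forall v \near p, P (sec phi v).
Proof.
move=> A1 d1; split.
  rewrite nbhsE => -[U [Uo Up] UP]; apply: filterS (Uo phi p A1 d1 Up) => v; exact: UP.
move=> H; pose O : set D := [set x | x = sec phi x.1 /\
  \forall v \near x.1, chart_dom phi v /\ P (sec phi v)].
have Op : O (sec phi p) by split=> //; exact: near_and (ch_dom (psC Kp A1) d1) H.
apply: filterS (open_nbhs_nbhs (conj (_ : open O) Op)).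
  by move=> x [-> Hx]; have [] := nbhs_singleton Hx.
move=> psi v Apsi dv [sv nv]; have [dphi _] := nbhs_singleton nv.
have E : sgn psi v = sgn phi v by case: sv.
apply: filterS2 (sec_eq Apsi dv A1 dphi E) (near_join nv) => w -> nw.
by split.
Qed.

Lemma fst_continuous : continuous (fst : D -> K).
Proof.
move=> x P Px; have [phi [A1 d1 ->]] := sec_ex x.
by apply/nbhs_sec.
Qed.

Lemma fst_near x (P : set K) : (\forall v \near x.1, P v) -> \forall y \near x, P y.1.
Proof. exact: fst_continuous. Qed.

Lemma fst_open (U : set D) : open U -> open (fst @` U).
Proof.
move=> Uo; rewrite openE => _ [x Ux <-]; have [phi [A1 d1 E]] := sec_ex x.
have /nbhs_sec : nbhs (sec phi x.1) U by rewrite -E; exact: open_nbhs_nbhs.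
move=> /(_ A1 d1); apply: filterS => v Uv; by exists (sec phi v).
Qed.

Definition flip x : D := (x.1, ~~ x.2).

Lemma flipK : involutive flip.
Proof. by case=> p b; rewrite /flip /= negbK. Qed.

Lemma flip_sec phi p : atlas K phi -> chart_dom phi p -> flip (sec phi p) = sec (mirror phi) p.
Proof. by move=> A1 d1; rewrite /flip /sec sgn_mirror. Qed.

Lemma flip_continuous : continuous flip.
Proof.
move=> x; have [phi [A1 d1 ->]] := sec_ex x => P; rewrite (flip_sec A1 d1) => PP.
apply/(nbhs_sec _ A1 d1); have := (nbhs_sec P (mirror_atlas KK A1) d1).1 PP.
by apply: filterS2 (ch_dom (psC Kp A1) d1) => v dv; rewrite /= flip_sec.
Qed.

(** Points over distinct points are separated in [K]. The two points over one [p] lie on the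
    sections of a chart and of its mirror, which are disjoint. *)
Lemma double_hausdorff : hausdorff_space D.
Proof.
have [[Kh _ _] _] := KK.
move=> x y cxy; have E : x.1 = y.1.
  apply: Kh => A B Ax By; have [z [Az Bz]] := cxy _ _ (@fst_continuous x _ Ax) (@fst_continuous y _ By).
  by exists z.1.
have [phi [A1 d1 Ex]] := sec_ex x; have [psi [A2 d2 Ey]] := sec_ex y; rewrite E in d1 Ex.
have [sE|sn] := eqVneq (sgn phi y.1) (sgn psi y.1); first by rewrite Ex Ey /sec sE.
exfalso; have sm : sgn psi y.1 = sgn (mirror phi) y.1.
  by rewrite sgn_mirror //; move: sn; case: (sgn phi _); case: (sgn psi _).
have nE := sec_eq A2 d2 (mirror_atlas KK A1) d1 sm.
have n1 : nbhs x [set z | chart_dom phi z.1 /\ z = sec phi z.1].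
  rewrite Ex; apply/nbhs_sec => //; apply: filterS (ch_dom (psC Kp A1) d1) => v dv.
  by split.
have n2 : nbhs y [set z | z = sec (mirror phi) z.1].
  by rewrite Ey; apply/nbhs_sec => //; apply: filterS nE => v ->.
have [z [[dz ->]]] := cxy _ _ n1 n2; rewrite /= -flip_sec // => -[].
by case: (sgn phi _).
Qed.

(** An ultrafilter projects to one converging to some [p]. It contains the image of the section of
    [c p] or the complement, which over the domain of [c p] is the image of the section of the
    mirror chart; either section lifts the limit. *)
Lemma double_compact : compact [set: D].
Proof.
have [[_ Kc _] _] := KK.
rewrite compact_ultra => F FU FT; have := Kc; rewrite compact_ultra => /(_ (fst @ F)) KF.
have FfU : UltraFilter (fst @ F).
  split; first exact: fmap_proper_filter.
  move=> G GP FG; apply/seteqP; split=> A; last exact: FG.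
  move=> GA; have [//|nA] := @in_ultra_setVsetC _ F (fst @^-1` A) FU.
  have GnA : G (~` A) := FG (~` A) nA.
  by have [v []] := filter_ex (filterI GA GnA).
have [p [_ Fp]] := KF FfU FT.
have [Ac dc] := cP p.
have conv phi : atlas K phi -> chart_dom phi p -> F [set x | x = sec phi x.1] -> F --> sec phi p.
  move=> A1 d1 FS P /(nbhs_sec _ A1 d1) PP.
  have FP : F [set x | P (sec phi x.1)] := Fp _ PP.
  by apply: filterS2 FS FP => x /= <-.
have dF : F [set x | chart_dom (c p) x.1] := Fp _ (ch_dom (psC Kp Ac) dc).
have [FS|FS] := @in_ultra_setVsetC _ F [set x | x = sec (c p) x.1] FU.
  by exists (sec (c p) p); split; [|exact: conv].
exists (sec (mirror (c p)) p); split=> //; apply: conv => //; first exact: mirror_atlas.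
apply: filterS2 FS dF => x nx dx; change (x = sec (mirror (c p)) x.1).
rewrite -flip_sec //; case: x nx dx => q b /= nx dx.
by move: nx; rewrite /flip /sec /=; case: b; case: (sgn _ _).
Qed.

End DoubleSpace.
Arguments sec {R K} c phi p.
Arguments flip {R K} c x.

(** * The Riemann structure of the orienting double *)

Section DoubleSurface.
Variable R : realType.
Local Notation C := (Cplx R).

(** When only nodes are sent to nodes, the chain rule applies at every non-nodal point. Signs can
    thus be composed before the double is known to be a surface. *)
Lemma signed_at_comp_nodes (X Y Z : nodal_data R) (phi : chart R X) (psi : chart R Y) (chi : chart R Z) (f : X -> Y) (g : Y -> Z) (x : X) b c :
  continuous f -> (forall y, nodes Y (f y) -> nodes X y) -> (\forall y \near x, chart_dom phi y) ->
  signed_at (nodes X) phi psi f b x -> signed_at (nodes Y) psi chi g c (f x) ->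
  signed_at (nodes X) phi chi (g \o f) (b (+) c) x.
Proof.
move=> fc fn dx Af Ag; apply: filterS3 dx Af (near_map (@fc x) Ag) => y dy hf hg ny.
by apply: (crd_comp (@fc y) dy (hf ny)) => j; apply: hg => /fn.
Qed.

Variables (K : nodal_data R) (c : K -> chart R K).
Hypotheses (KK : nodal_klein K) (cP : forall p, charts_at p (c p)).
Let Kp : presurf K := presurf_klein KK.
Local Notation D := (odouble c).
Implicit Types (phi psi : chart R K) (p : K) (x : D) (chi : chart R D).

Definition double_chart phi : chart R D :=
  @Chart R D (chart_kind phi) [set x | chart_dom phi x.1 /\ x = sec c phi x.1]
    (fun x => chart_map phi x.1) (sec c phi \o chart_inv phi).

Definition double_nodes : set D := [set x | nodes K x.1].

(** Maximality is built in: the atlas consists of all charts compatible with the generating family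
    [double_chart]. *)
Definition double_atlas : set (chart R D) := [set chi | is_chart double_nodes chi /\
  forall phi x, atlas K phi -> chart_dom chi x -> chart_dom (double_chart phi) x ->
    signed_at double_nodes chi (double_chart phi) idfun false x /\
    signed_at double_nodes (double_chart phi) chi idfun false x].

Definition double_surf := NodalData double_nodes double_atlas.
Local Notation DS := double_surf.

Lemma double_chart_chart phi : atlas K phi -> is_chart double_nodes (double_chart phi).
Proof.
move=> A1; have [[dO [V Vo VE]] mc ic mK nP] := psC Kp A1; have phiP := psC Kp A1.
have iE : chart_map (double_chart phi) @` chart_dom (double_chart phi) = chart_map phi @` chart_dom phi.
  apply/seteqP; split=> z; first by move=> [x [dx _] <-]; exists x.1.
  by move=> [p dp <-]; exists (sec c phi p).
split.
- split; last by exists V => //; rewrite iE.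
  rewrite openE => x [dx ->]; apply/(nbhs_sec KK cP _ A1 dx).
  by apply: filterS (ch_dom phiP dx) => v dv.
- apply/subspace_continuousP => x [dx _] P Px.
  move/subspace_continuousP: mc => /(_ _ dx P Px)/(fst_near KK cP).
  by apply: filterS => y Hy [dy _]; exact: Hy.
- rewrite iE; apply/subspace_continuousP => z dz P Pz.
  have [p dp pz] := dz; have ip : chart_inv phi z = p by rewrite -pz (ch_K phiP dp).
  have Pz' : \forall v \near chart_inv phi z, P (sec c phi v).
    by rewrite ip; apply/(nbhs_sec KK cP _ A1 dp); rewrite -ip.
  by move/subspace_continuousP: ic => /(_ _ dz _ Pz').
- by move=> x; rewrite inE => -[dx {2}->]; rewrite /= (ch_K phiP dx).
rewrite /=; case: (chart_kind phi) nP => [d0|[p [p0 /seteqP[pN1 pN2]]]|[p [p0 /seteqP[pN1 pN2]]]].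
- apply/seteqP; split=> // x [[dx _] Nx].
  by have : (chart_dom phi `&` nodes K) x.1 by []; rewrite d0.
- exists (sec c phi p); split=> //; apply/seteqP; split=> x.
    by move=> [[dx ->] Nx]; rewrite /= [x.1](pN1 x.1).
  by have [dp Np] := pN2 p erefl; move=> ->.
- exists (sec c phi p); split=> //; apply/seteqP; split=> x.
    by move=> [[dx ->] Nx]; rewrite /= [x.1](pN1 x.1).
  by have [dp Np] := pN2 p erefl; move=> ->.
Qed.

Lemma cholo_double phi (h : K -> C) x : cholo phi h x.1 -> cholo (double_chart phi) (h \o fst) x.
Proof.
move=> [G Gt E]; exists G => //.
exact: (fst_near KK cP E).
Qed.

Lemma signed_at_fst phi psi x b : signed_at (nodes K) phi psi idfun b x.1 ->
  signed_at double_nodes (double_chart phi) psi fst b x.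
Proof.
move=> A; apply: filterS (fst_near KK cP A) => y Ay ny j.
exact: cholo_double (Ay ny j).
Qed.

Lemma double_chart_trans phi psi x : atlas K phi -> atlas K psi ->
  chart_dom (double_chart phi) x -> chart_dom (double_chart psi) x ->
  signed_at double_nodes (double_chart phi) (double_chart psi) idfun false x.
Proof.
move=> A1 A2 [d1 E1] [d2 E2]; apply: (@signed_at_fst phi psi x).
by apply/(sgn_signed_at KK cP) => //; move: E2; rewrite {1}E1 => -[].
Qed.

Lemma double_chart_ex x : exists phi, atlas K phi /\ chart_dom (double_chart phi) x.
Proof.
by have [phi [A1 d1 E]] := sec_ex KK cP x; exists phi.
Qed.

Lemma double_chart_atlas phi : atlas K phi -> atlas DS (double_chart phi).
Proof.
move=> A1; split; first exact: double_chart_chart.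
by move=> psi x A2 d1 d2; split; exact: double_chart_trans.
Qed.

Lemma double_atlas_signed_at chi chi' x : atlas DS chi -> atlas DS chi' -> chart_dom chi x -> chart_dom chi' x ->
  signed_at double_nodes chi chi' idfun false x.
Proof.
move=> [c1 H1] [c2 H2] d1 d2; have [phi [A1 dx]] := double_chart_ex x.
have [B1 _] := H1 _ _ A1 d1 dx; have [_ B2] := H2 _ _ A1 d2 dx.
exact: (@signed_at_comp_nodes DS DS DS _ _ _ _ _ x _ _ (@id_cont _ DS) _ (ch_dom c1 d1) B1 B2).
Qed.

Lemma double_riemann : nodal_riemann DS.
Proof.
split; split.
- exact: double_hausdorff KK cP.
- exact: double_compact KK cP.
- have [[_ _ Kf] _] := KK.
  have : finite_set (nodes K `*` [set: bool]) by apply: finite_setX => //; exact: finite_finset.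
  by apply: sub_finite_set => -[p b].
- by move=> chi [].
- by move=> x; have [phi [A1 dx]] := double_chart_ex x; exists (double_chart phi) => //; exact: double_chart_atlas.
- move=> chi chi' A1 A2; apply: (@signed_at_analytic _ _ _ _ _ _ _ A1.1 false) => x d1 d2.
  exact: double_atlas_signed_at.
move=> chi chiP H1 H2; split=> // phi x A1 d1 dx.
have A2 := double_chart_atlas A1.
split.
  exact: (analytic_signed_at (f := idfun : DS -> DS) chiP (ch_open A2.1) (@id_cont _ DS) d1 dx (b := false) (H1 _ _ erefl A2)).
exact: (analytic_signed_at (f := idfun : DS -> DS) A2.1 (ch_open chiP) (@id_cont _ DS) dx d1 (b := false) (H2 _ _ A2 erefl)).
Qed.

Let Dp : presurf DS := presurf_riemann double_riemann.

Lemma double_fst_boundary : fst @^-1` boundary K = boundary DS.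
Proof.
apply/seteqP; split=> x; have [phi [A1 dx]] := double_chart_ex x;
  have A2 := double_chart_atlas A1; have [d1 _] := dx.
  by move=> /(boundary_chart Kp A1 d1) H; apply/(boundary_chart Dp A2 dx).
by move=> /(boundary_chart Dp A2 dx) H; apply/(boundary_chart Kp A1 d1).
Qed.

Lemma double_fst_signed_at chi phi psi x b : atlas DS chi -> chart_dom chi x -> atlas K phi ->
  chart_dom (double_chart phi) x -> signed_at (nodes K) phi psi idfun b x.1 ->
  signed_at (nodes DS) chi psi (fst : DS -> K) b x.
Proof.
move=> A d A1 d1 B; have A2 := double_chart_atlas A1.
apply: (@signed_at_comp_nodes DS DS K chi (double_chart phi) psi idfun fst x false b (@id_cont _ DS) _ (ch_dom A.1 d)).
- by [].
- exact: double_atlas_signed_at.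
- exact: signed_at_fst.
Qed.

Lemma double_fst_dmor : dmor (fst : DS -> K).
Proof.
split.
- exact: fst_continuous KK cP.
- move=> x nx H; have [phi [A1 [d1 E]]] := double_chart_ex x.
  apply: (nowhere_const_id Kp nx); have : nbhs (sec c phi x.1) [set y | y.1 = x.1] by rewrite -E.
  by move=> /(nbhs_sec KK cP _ A1 d1).
- by move=> _ [x xb <-]; have : (fst @^-1` boundary K) x by rewrite double_fst_boundary.
move=> chi psi x A A2 d d2; have [phi [A1 dx]] := double_chart_ex x; have [d1 _] := dx.
have [b B] := signed_at_id_ex Kp A1 A2 d1 d2.
by exists b; exact: double_fst_signed_at dx B.
Qed.

(** Read from [double_chart phi] to [double_chart (mirror phi)], the flip is the coordinate
    reflection [mir], which has sign [true]; the remaining changes of chart are analytic. *)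
Lemma double_flip_anti : in_charts (@antianalytic R) (atlas DS) (atlas DS) (flip c).
Proof.
apply: (signedb_charts true Dp Dp (flip_continuous KK cP)).2 => chi chi' x A A' d d'.
have [phi [A1 dx]] := double_chart_ex x; have A2 := mirror_atlas KK A1; have [d1 _] := dx.
have dfx : chart_dom (double_chart (mirror phi)) (flip c x).
  by have [_ E] := dx; split=> //; rewrite {1}E (flip_sec KK cP).
have F : signed_at (nodes DS) (double_chart phi) (double_chart (mirror phi)) (flip c) true x.
  have B : signed_at (nodes K) phi (mirror phi) idfun true x.1.
    have Z := signed_at_refl Kp A1 d1; have Y := signed_at_mirror_r Z; exact: Y.
  exact: (signed_at_fst B).
have G := @signed_at_comp_nodes DS DS DS _ _ _ _ _ x _ _ (@id_cont _ DS) (fun y => id) (ch_dom A.1 d)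
  (double_atlas_signed_at A (double_chart_atlas A1) d dx) F.
have fn : forall y, nodes DS (flip c y) -> nodes DS y by [].
exact: (@signed_at_comp_nodes DS DS DS _ _ _ _ _ x _ _ (flip_continuous KK cP) fn (ch_dom A.1 d)
  G (double_atlas_signed_at (double_chart_atlas A2) A' dfx d')).
Qed.

Lemma double_fst_cover : double_cover (fst : D -> K).
Proof.
apply: (@double_cover_intro _ _ _ (flip c)).
- exact: double_hausdorff KK cP.
- exact: fst_continuous KK cP.
- exact: fst_open KK cP.
- by move=> p; exists (p, false).
- by move=> [p b] [q b'] /= ->; case: b b' => [] []; [left|right|right|left].
- by [].
- exact: flip_continuous KK cP.
- exact: flipK.
- by move=> [p []].
Qed.

End DoubleSurface.

(** * The orbit space of the double, identified with the given surface *)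

Section DoubleObject.
Variables (R : realType) (K : klein_obj R) (c : K -> chart R K).
Hypothesis cP : forall p, charts_at p (c p).
Let KK := kleinP K.
Let Kp : presurf K := presurf_klein KK.
Local Notation D := (odouble c).
Local Notation DS := (double_surf c).
Local Notation sK := (@flipK R K c).
Local Open Scope quotient_scope.

(** An object of the symmetric category must carry a Klein structure on the orbit space itself. It
    is transported from [K] along [th], whose inverse [et] reads the point off any
    representative. *)
Let th (p : K) : orbit_space sK := orbit_map sK (p, false).
Let et (y : orbit_space sK) : K := (repr y).1.

Lemma orbit_fst (x : D) : th x.1 = orbit_map sK x.
Proof. by apply/orbit_mapP; case: x => p []; [right|left]. Qed.

Lemma etP (x : D) : et (orbit_map sK x) = x.1.
Proof.
have : orbit_map sK (repr (orbit_map sK x)) = orbit_map sK x by rewrite /orbit_map reprK.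
by move=> /orbit_mapP; rewrite /et; case=> ->.
Qed.

Lemma thK : cancel th et.
Proof. by move=> p; rewrite /th etP. Qed.

Lemma etK : cancel et th.
Proof. by move=> y; have [x <-] := orbit_map_surj y; rewrite etP orbit_fst. Qed.

Lemma et_cont : continuous et.
Proof.
apply/(quotient_continuous (Q0 := {eq_quot orbit_equiv sK})).
have -> : et \o \pi_({eq_quot orbit_equiv sK}) = fst by apply/funext => x; exact: etP.
exact: fst_continuous KK cP.
Qed.

Lemma th_cont : continuous th.
Proof.
move=> p P Pp; have [Ac dc] := cP p.
have H : \forall v \near sec c (c p) p, P (orbit_map sK v).
  by apply: near_map (@orbit_map_cont _ _ sK _) _; rewrite -orbit_fst.
have := (nbhs_sec KK cP _ Ac dc).1 H; apply: filterS => v.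
by rewrite -orbit_fst.
Qed.

Let Q := push_data th et.
Let q : DS -> Q := @orbit_map D (flip c) sK.

Lemma orbit_klein : nodal_klein Q.
Proof. by apply: push_klein KK; [exact: th_cont|exact: et_cont|exact: thK|exact: etK]. Qed.

Lemma orbit_connected : connected_surface Q.
Proof.
have [[p _] cK] := klein_connected K; split; first by exists (th p).
have -> : [set: points Q] = th @` [set: K].
  by apply/seteqP; split=> // y _; exists (et y) => //; exact: etK.
apply: connected_continuous_connected => //; apply: continuous_subspaceT; exact: th_cont.
Qed.

Lemma orbit_boundary p : boundary K p -> boundary Q (th p).
Proof.
move=> [phi [A1 d1 m1]]; exists (push th et phi); split; first by exists phi.
  by rewrite /= thK.
by rewrite /= thK.
Qed.

Lemma orbit_dmor : dmor q.
Proof.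
have [fc fn fb fs] := double_fst_dmor KK cP; split.
- exact: orbit_map_cont.
- move=> x nx H; apply: (fn x nx); apply: filterS H => y /(congr1 et).
  by rewrite /q !etP.
- move=> _ [x xb <-]; rewrite /q -orbit_fst; apply: orbit_boundary; apply: fb.
  by exists x.
move=> chi _ x A [phi A1 <-] d /= d1; have dx : chart_dom phi x.1 by move: d1; rewrite /q etP.
have [b B] := fs _ _ _ A A1 d dx; exists b; apply: filterS B => y H ny j.
by apply: cholo_eq (H ny j); near=> v; rewrite /crd /= /q etP.
Unshelve. all: by end_near. Qed.

Lemma orbit_boundary_node (x : DS) : nodes DS x -> boundary_node (q x).
Proof.
move=> Nx; have [_ [phi [A1 d1 kb]]] := klein_nodes Nx.
split; first by rewrite /= /q etP.
by exists (push th et phi); split=> //; [exists phi|rewrite /= /q etP].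
Qed.

Lemma double_dianalytic n (pt : 'I_(n + n) -> DS) (fx : 'I_0 -> DS) :
  (forall i, boundary K (pt i).1) ->
  exists (N : set (orbit_space sK)) (A : set (chart R (orbit_space sK))),
      let Q := NodalData N A in
      let q : DS -> Q := @orbit_map DS (flip c) sK in
      [/\ nodal_klein Q /\ connected_surface Q,
          dianalytic_morphism q,
          forall p, nodes DS p -> boundary_node (q p),
          forall i, boundary Q (q (pt i)) &
          forall i, boundary Q (q (fx i))].
Proof.
move=> pb; exists (nodes Q), (atlas Q) => /=; split.
- by split; [exact: orbit_klein|exact: orbit_connected].
- apply/(dmor_dianalytic _ (presurf_riemann (double_riemann KK cP)) (presurf_klein orbit_klein)).
  exact: orbit_dmor.
- exact: orbit_boundary_node.
- by move=> i; rewrite -orbit_fst; exact: orbit_boundary.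
- by case.
Qed.

End DoubleObject.

Lemma double_ex (R : realType) (K : klein_obj R) :
  exists (X : symriem_obj R) (f : X -> K), orienting_double f.
Proof.
have KK := kleinP K; have Kp := presurf_klein KK.
have [c cP] : {c : K -> chart R K & forall p, charts_at p (c p)}.
  by apply: choice => p; have [phi A d] := ps_cov Kp p; exists phi.
have wE (i : 'I_(klein_pts K)) : exists phi, charts_at (klein_pt i) phi /\
    klein_or i = charts_at (klein_pt i) `&` [set psi | analytic_near phi psi idfun (klein_pt i)].
  by have [phi A E] := @klein_orP _ K i; exists phi.
have [w wP] := choice wE.
(* The given local orientation at a marked point is itself a point of the double, the one at which
   the projection preserves it; [flip] supplies the second half of the tuple. *)
pose m (i : 'I_(klein_pts K)) : double_surf c := sec c (w i) (klein_pt i).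
pose pt (i : 'I_(klein_pts K + klein_pts K)) : double_surf c :=
  match fintype.split i with inl j => m j | inr j => flip c (m j) end.
have ptl i : pt (lshift _ i) = m i by rewrite /pt (unsplitK (inl i)).
have ptr i : pt (rshift _ i) = flip c (m i) by rewrite /pt (unsplitK (inr i)).
have pt1 i : exists j, (pt i).1 = klein_pt j by rewrite /pt; case: fintype.split => j; exists j.
have pti : injective pt.
  move=> i j; rewrite -(splitK i) -(splitK j); case: (fintype.split i) => i'; case: (fintype.split j) => j' /=;
    rewrite ?ptl ?ptr /flip /m /sec => -[/klein_pt_inj -> //].
    by case: sgn.
  by case: sgn.
have ptinv i : flip c (pt (lshift _ i)) = pt (rshift _ i) by rewrite ptl ptr.
have ptn i : ~ nodes (double_surf c) (pt i).
  by have [j E] := pt1 i; change (~ nodes K (pt i).1); rewrite E; exact: klein_pt_nonnodal.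
have ptb i : boundary K (pt i).1 by have [j ->] := pt1 i; exact: klein_pt_boundary.
pose fx (i : 'I_0) : double_surf c := pt (match i with Ordinal k H => False_rect _ (notF H) end).
have fxinj : injective fx by case.
have fxinv i : flip c (fx i) = fx i by case: i.
have fxn i : ~ nodes (double_surf c) (fx i) by case: i.
pose X := SymRiemObj (double_riemann KK cP)
  (flip_continuous KK cP : continuous (flip c : double_surf c -> double_surf c))
  (double_flip_anti KK cP) pti ptinv ptn fxinj fxinv fxn (double_dianalytic cP fx ptb).
exists X, (fst : double_surf c -> K); split.
- split; last exact: double_fst_cover KK cP.
  apply/(dmor_dianalytic _ (presurf_riemann (double_riemann KK cP)) Kp).
  exact: double_fst_dmor KK cP.
- exact: double_fst_boundary KK cP.
- by [].
- by [].
split=> //; exists erefl => i; rewrite cast_ord_id /=; split; first by rewrite ptl.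
rewrite ptl => chi psi [Achi dchi]; have [[Aw dw] ->] := wP i => -[[Apsi dpsi] /= an].
have [_ _ Ac] := (analytic_near_signed_at (psC Kp Aw) (ch_open (psC Kp Apsi)) (@id_cont _ K) _).1 an.
apply/(analytic_near_signed_at _ (ch_open (psC Kp Apsi)) (fst_continuous KK cP)); first exact: Achi.1.
split=> //; apply: (double_fst_signed_at KK cP Achi dchi Aw _ Ac).
by split.
Qed.

(** * The equivalence of categories *)

Section Categories.
Variables D E : category_data.
Hypotheses (Dc : is_category D) (Ec : is_category E).

Definition mor_id (C : category_data) (Cc : is_category C) (A : C) : mor A A := exist _ idfun (Cc.1 A).

Definition mor_comp (C : category_data) (Cc : is_category C) (A B H : C) (f : mor A B) (g : mor B H) :
  mor A H := exist _ (fn g \o fn f) (Cc.2 _ _ _ _ _ (svalP f) (svalP g)).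

Variable F : functor D E.

Lemma fmap_mor_comp (A B H : D) (f : mor A B) (g : mor B H) :
  fn (fmap F (mor_comp Dc f g)) = fn (fmap F g) \o fn (fmap F f).
Proof. exact: fmap_comp. Qed.

Hypothesis faithful : forall (A B : D) (f g : mor A B), fn (fmap F f) = fn (fmap F g) -> fn f = fn g.
Hypothesis full : forall (A B : D) (u : mor (F A) (F B)), exists f : mor A B, fn (fmap F f) = fn u.
Hypothesis ess_surj : forall X : E, exists (A : D) (i : mor (F A) X) (j : mor X (F A)),
  fn j \o fn i = idfun /\ fn i \o fn j = idfun.

(** [G] sends [u] to the arrow that [F] maps to the composite of [i], [u] and [j], found by
    fullness. The functor laws and the unit are checked after applying the faithful [F]; the counit
    is [i]. *)
Lemma equivalence_intro : is_equivalence F.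
Proof.
pose es X := cid (ess_surj X); pose G0 X : D := projT1 (es X).
pose esi X := cid (projT2 (es X)); pose i X : mor (F (G0 X)) X := projT1 (esi X).
pose esj X := cid (projT2 (esi X)); pose j X : mor X (F (G0 X)) := projT1 (esj X).
have ji X : fn (j X) \o fn (i X) = idfun by have [] := projT2 (esj X).
have ij X : fn (i X) \o fn (j X) = idfun by have [] := projT2 (esj X).
have jiE X x : fn (j X) (fn (i X) x) = x := congr1 (@^~ x) (ji X).
have ijE X x : fn (i X) (fn (j X) x) = x := congr1 (@^~ x) (ij X).
pose gm X Y (u : mor X Y) := cid (full (mor_comp Ec (mor_comp Ec (i X) u) (j Y))).
pose G1 X Y (u : mor X Y) : mor (G0 X) (G0 Y) := projT1 (gm X Y u).
have G1E X Y (u : mor X Y) x : fn (fmap F (G1 X Y u)) x = fn (j Y) (fn u (fn (i X) x)).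
  have GE : fn (fmap F (G1 X Y u)) = fn (mor_comp Ec (mor_comp Ec (i X) u) (j Y)) := projT2 (gm X Y u).
  by rewrite GE.
have Gid X (u : mor X X) : fn u = idfun -> fn (G1 X X u) = idfun.
  move=> u1; apply: (@faithful _ _ _ (mor_id Dc (G0 X))); apply/funext => x.
  by rewrite G1E u1 jiE (fmap_id F (i := mor_id Dc (G0 X))).
have Gcomp X Y Z (f : mor X Y) (g : mor Y Z) (h : mor X Z) :
    fn h = fn g \o fn f -> fn (G1 X Z h) = fn (G1 Y Z g) \o fn (G1 X Y f).
  move=> hE; apply: (@faithful _ _ _ (mor_comp Dc (G1 X Y f) (G1 Y Z g))); apply/funext => x.
  by rewrite fmap_mor_comp /= !G1E hE /= ijE.
pose G := @Functor E D G0 G1 Gid Gcomp; exists G; split.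
  pose em A := cid (full (j (F A))); pose eta A : mor A (G0 (F A)) := projT1 (em A).
  have etaE A : fn (fmap F (eta A)) = fn (j (F A)) := projT2 (em A).
  exists eta; split=> [A|A B f].
    have [r rE] := full (i (F A)); exists r; split.
      apply: (@faithful _ _ (mor_comp Dc (eta A) r) (mor_id Dc A)).
      by rewrite fmap_mor_comp etaE rE ij (fmap_id F (i := mor_id Dc A)).
    apply: (@faithful _ _ (mor_comp Dc r (eta A)) (mor_id Dc _)).
    by rewrite fmap_mor_comp etaE rE ji (fmap_id F (i := mor_id Dc _)).
  apply: (@faithful _ _ (mor_comp Dc f (eta B)) (mor_comp Dc (eta A) (G1 _ _ (fmap F f)))).
  by rewrite !fmap_mor_comp !etaE; apply/funext => x /=; rewrite G1E ijE.
exists i; split=> [X|X Y u]; first by exists (j X); split; [exact: ji|exact: ij].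
by apply/funext => x /=; rewrite G1E ijE.
Qed.

End Categories.

(** * Lifting and descent with marked points *)

Section Klein.
Variable R : realType.

Lemma local_orientation_signed_at (K : nodal_data R) (p : K) o phi psi : presurf K -> local_orientation p o ->
  o phi -> o psi -> [/\ atlas K phi, chart_dom phi p, atlas K psi, chart_dom psi p &
    signed_at (nodes K) phi psi idfun false p].
Proof.
move=> Kp [w [Aw dw] ->] [[A1 d1] /= n1] [[A2 d2] /= n2]; split=> //.
have ana chi : atlas K chi -> analytic_near w chi idfun p -> signed_at (nodes K) w chi idfun false p.
  by move=> A /(analytic_near_signed_at (psC Kp Aw) (ch_open (psC Kp A)) (@id_cont _ K))[].
have := signed_at_trans Kp A1 Aw A2 d1 dw d2 (signed_at_sym Kp Aw A1 dw d1 (ana _ A1 n1)) (ana _ A2 n2).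
exact.
Qed.

Lemma local_orientation_ex (K : nodal_data R) (p : K) o : presurf K -> local_orientation p o ->
  exists phi, o phi.
Proof.
move=> Kp [w [Aw dw] ->]; exists w; split=> //=.
by apply/(analytic_near_signed_at (psC Kp Aw) (ch_open (psC Kp Aw)) (@id_cont _ K)); split=> //; exact: signed_at_refl.
Qed.

Lemma preserves_orientation_signed_at (X Y : nodal_data R) (f : X -> Y) p (o : set (chart R X)) (o' : set (chart R Y)) :
  presurf X -> presurf Y -> continuous f -> o `<=` charts_at p -> o' `<=` charts_at (f p) ->
  preserves_orientation f p o o' <->
  forall phi psi, o phi -> o' psi -> signed_at (nodes X) phi psi f false p.
Proof.
move=> Xp Yp fc o1 o2; split=> H phi psi oo oo'; have [A1 d1] := o1 _ oo; have [A2 d2] := o2 _ oo'.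
  by have [] := (analytic_near_signed_at (psC Xp A1) (ch_open (psC Yp A2)) fc _).1 (H _ _ oo oo').
by apply/(analytic_near_signed_at (psC Xp A1) (ch_open (psC Yp A2)) fc); split=> //; exact: H.
Qed.

Lemma local_orientation_sub (K : nodal_data R) (p : K) o : local_orientation p o -> o `<=` charts_at p.
Proof. by move=> [w _ ->] phi []. Qed.

Lemma klein_presurf (K : klein_obj R) : presurf K.
Proof. exact: presurf_klein (kleinP K). Qed.

Lemma klein_hom_id (K : klein_obj R) : klein_hom (idfun : K -> K).
Proof.
have Kp := klein_presurf K; split; first by apply/(dmor_dianalytic _ Kp Kp); exact: dmor_id.
exists erefl => i; rewrite cast_ord_id; split=> //.
have o1 := local_orientation_sub (klein_orP i).
apply/(preserves_orientation_signed_at Kp Kp (@id_cont _ K) o1 o1) => phi psi oo oo'.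
by have [] := local_orientation_signed_at Kp (klein_orP i) oo oo'.
Qed.

Lemma klein_hom_comp (K L M : klein_obj R) (f : K -> L) (g : L -> M) :
  klein_hom f -> klein_hom g -> klein_hom (g \o f).
Proof.
have Kp := klein_presurf K; have Lp := klein_presurf L; have Mp := klein_presurf M.
move=> [/(dmor_dianalytic _ Kp Lp) fm [e fo]] [/(dmor_dianalytic _ Lp Mp) gm [e' go]].
have gfm := dmor_comp Kp Lp Mp fm gm.
split; first exact/(dmor_dianalytic _ Kp Mp).
exists (etrans e e') => i; have [fi po] := fo i; have [gi po'] := go (cast_ord e i).
rewrite -cast_ord_comp; split; first by rewrite /= fi.
have [fc fn fb fs] := fm; have [gc gn gb gs] := gm; have [gfc _ _ _] := gfm.
have o1 := local_orientation_sub (klein_orP i).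
have o2 := local_orientation_sub (klein_orP (cast_ord e i)).
have o3 := local_orientation_sub (klein_orP (cast_ord e' (cast_ord e i))).
rewrite -gi in o3; rewrite -fi in o2 o3 po'.
apply/(preserves_orientation_signed_at Kp Mp gfc o1 o3) => phi chi oo oo'.
have [psi oo2] := local_orientation_ex Lp (klein_orP (cast_ord e i)).
have A1 := (preserves_orientation_signed_at Kp Lp fc o1 o2).1 po _ _ oo oo2.
have A2 := (preserves_orientation_signed_at Lp Mp gc o2 o3).1 po' _ _ oo2 oo'.
have [a1 d1] := o1 _ oo; have [a2 d2] := o2 _ oo2; have [a3 d3] := o3 _ oo'.
exact: (signed_at_comp Kp Lp Mp fc fn fb gc gb a1 a2 a3 d1 d2 d3 A1 A2).
Qed.

Lemma dnKlein_category : is_category (dnKlein R).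
Proof. by split; [exact: klein_hom_id|move=> A B E f g; exact: klein_hom_comp]. Qed.

Lemma symriem_presurf (X : symriem_obj R) : presurf X.
Proof. exact: presurf_riemann (symP X). Qed.

Lemma symriem_hom_id (X : symriem_obj R) : symriem_hom (idfun : X -> X).
Proof.
have Xp := symriem_presurf X; split=> //.
- by apply/(smor_analytic _ Xp Xp); exact: smor_id (symP X).
- by exists erefl => i; rewrite cast_ord_id.
- by exists erefl => i; rewrite cast_ord_id.
Qed.

Lemma symriem_hom_comp (X Y Z : symriem_obj R) (f : X -> Y) (g : Y -> Z) :
  symriem_hom f -> symriem_hom g -> symriem_hom (g \o f).
Proof.
have Xp := symriem_presurf X; have Yp := symriem_presurf Y; have Zp := symriem_presurf Z.
move=> [/(smor_analytic _ Xp Yp) fm fs [e1 f1] [e2 f2]] [/(smor_analytic _ Yp Zp) gm gs [e3 g1] [e4 g2]].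
split.
- by apply/(smor_analytic _ Xp Zp); exact: smor_comp Xp Yp Zp fm gm.
- by move=> x; rewrite /= fs gs.
- by exists (etrans e1 e3) => i; rewrite /= f1 g1 cast_ord_comp.
- by exists (etrans e2 e4) => i; rewrite /= f2 g2 cast_ord_comp.
Qed.

Lemma dnSymRiem_category : is_category (dnSymRiem R).
Proof. by split; [exact: symriem_hom_id|move=> A B E f g; exact: symriem_hom_comp]. Qed.

(* The points of an orienting double over the marked points are determined by
   the local orientations. *)
Lemma lift_hom (K L : klein_obj R) (X Y : symriem_obj R) (f : X -> K) (f' : Y -> L) (g : K -> L) :
  orienting_double f -> orienting_double f' -> klein_hom g ->
  exists2 u : X -> Y, symriem_hom u & f' \o u = g \o f.
Proof.
move=> fo fo' [gd [e ge]]; have D := orienting_double_is_double fo; have D' := orienting_double_is_double fo'.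
have [XR Kp fm fbd fnd fsec fsurj fib sgm fsg sgK] := D.
have [YR Lp fm' fbd' fnd' fsec' fsurj' fib' sgm' fsg' sgK'] := D'.
have Xp := presurf_riemann XR; have Yp := presurf_riemann YR.
have gm : dmor g by exact/(dmor_dianalytic _ Kp Lp).
have gfm := dmor_comp Xp Kp Lp fm gm.
have [u um uE] := lift_ex Yp Lp fm' fbd' fnd' YR fsec' fsurj' fib' sgm' fsg' sgK' XR gfm.
have equi x : u (sym_inv x) = sym_inv (u x).
  (* Conjugating [u] by the involutions gives another lift of the same map, analytic since two
     reversals cancel; uniqueness identifies it with [u]. *)
  suff E : @sym_inv R Y \o u \o @sym_inv R X = u.
    by have := congr1 (@^~ (sym_inv x)) E; rewrite /= sgK => <-.
  apply: (lift_uniq Yp Lp fm' YR fib' sgm' fsg' sgK' XR) => //.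
    have m1 : smor true (u \o @sym_inv R X) := smor_comp Xp Xp Yp sgm um.
    exact: (smor_comp Xp Yp Yp m1 sgm').
  apply/funext => x'; rewrite /= fsg'.
  have H z : f' (u z) = g (f z) := congr1 (@^~ z) uE.
  by rewrite !H fsg.
have [_ _ _ _ [fx [e1 f1]]] := fo; have [_ _ _ _ [fx' [e2 f2]]] := fo'.
have marked i : u (sym_free_pt (lshift _ (cast_ord e1 i))) =
    sym_free_pt (lshift _ (cast_ord e2 (cast_ord e i))).
  have [q1 p1] := f1 i; have [q2 p2] := f2 (cast_ord e i); have [gi gp] := ge i.
  set q := sym_free_pt _ in q1 p1 *; set q' := sym_free_pt _ in q2 p2 *.
  have [fc fn fb _] := fm; have [fc' _ _ _] := fm'; have [gc gn gb _] := gm.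
  have o1 := local_orientation_sub (klein_orP i).
  have o2 := local_orientation_sub (klein_orP (cast_ord e i)).
  have [psi o_psi] := local_orientation_ex Kp (klein_orP i).
  have [chi o_chi] := local_orientation_ex Lp (klein_orP (cast_ord e i)).
  have [a1 d1] := o1 _ o_psi; have [a2 d2] := o2 _ o_chi.
  have [phi aphi dphi] := ps_cov Xp q; have [phi' aphi' dphi'] := ps_cov Yp q'.
  have d1q : chart_dom psi (f q) by rewrite q1.
  have d2g : chart_dom chi (g (f q)) by rewrite q1 gi.
  have d2q : chart_dom chi (f' q') by rewrite q2.
  have [_ _ A1] := (analytic_near_signed_at (psC Xp aphi) (ch_open (psC Kp a1)) fc q).1 (p1 _ _ (conj aphi dphi) o_psi).
  have [_ _ A2] := (analytic_near_signed_at (psC Kp a1) (ch_open (psC Lp a2)) gc _).1 (gp _ _ o_psi o_chi).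
  have [_ _ A3] := (analytic_near_signed_at (psC Yp aphi') (ch_open (psC Lp a2)) fc' q').1 (p2 _ _ (conj aphi' dphi') o_chi).
  rewrite -q1 in A2.
  have A4 := signed_at_comp Xp Kp Lp fc fn fb gc gb aphi a1 a2 dphi d1q d2g A1 A2.
  (* [u q] and [q'] both lie over [g (f q)], and at both [f'] has the sign of [g \o f] at [q]; there
     is only one such point. *)
  apply: (same_sign_uniq Yp Lp fm' fib' sgm' fsg' sgK' Xp gfm (y := q)).
    exact: (same_sign_smor Yp Lp fm' YR q XR gfm um uE).
  apply: (same_sign_intro Yp Lp fm' YR XR gfm _ aphi' dphi' a2 d2g aphi dphi A3 A4).
  by rewrite q2 /= q1 gi.
exists u => //; split=> //.
- exact/(smor_analytic _ Xp Yp).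
- have E : sym_free X = sym_free Y by rewrite -e1 e e2.
  exists (congr2 addn E E) => i.
  have l (i' : 'I_(sym_free X)) : u (sym_free_pt (lshift _ i')) = sym_free_pt (lshift _ (cast_ord E i')).
    have -> : i' = cast_ord e1 (cast_ord (esym e1) i') by rewrite cast_ordKV.
    rewrite marked; congr (sym_free_pt (lshift _ _)); exact: val_inj.
  rewrite -(splitK i); case: (fintype.split i) => i' /=.
    by rewrite l; congr sym_free_pt; exact: val_inj.
  rewrite -sym_free_pt_inv equi l sym_free_pt_inv; congr sym_free_pt; apply: val_inj => /=.
  by congr addn; rewrite E.
by exists (etrans fx (esym fx')) => i; have := ltn_ord i; rewrite {2}fx.
Qed.

Lemma lift_hom_uniq (L : klein_obj R) (X Y : symriem_obj R) (f' : Y -> L) (u v : X -> Y) :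
  orienting_double f' -> symriem_hom u -> symriem_hom v -> f' \o u = f' \o v -> u = v.
Proof.
move=> fo' [um _ _ _] [vm _ _ _] E; have Xp := symriem_presurf X.
have [YR Lp fm' _ _ _ _ fib' sgm' fsg' sgK'] := orienting_double_is_double fo'.
have Yp := presurf_riemann YR.
apply: (lift_uniq Yp Lp fm' YR fib' sgm' fsg' sgK' (symP X)) => //; exact/(smor_analytic _ Xp Yp).
Qed.

Lemma descent_hom (K L : klein_obj R) (X Y : symriem_obj R) (f : X -> K) (f' : Y -> L) (u : X -> Y) :
  orienting_double f -> orienting_double f' -> symriem_hom u ->
  exists2 g : K -> L, klein_hom g & f' \o u = g \o f.
Proof.
move=> fo fo' [ua us [e ue] _]; have D := orienting_double_is_double fo; have D' := orienting_double_is_double fo'.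
have [XR Kp fm fbd fnd fsec fsurj fib sgm fsg sgK] := D.
have [YR Lp fm' fbd' fnd' fsec' fsurj' fib' sgm' fsg' sgK'] := D'.
have Xp := presurf_riemann XR; have Yp := presurf_riemann YR.
have um : smor false u by exact/(smor_analytic _ Xp Yp).
have [r rP] := choice fsurj.
(* Two points over [p] are exchanged by the involution, [u] is equivariant and [f'] invariant, so
   the choice of [r p] does not matter. *)
pose g p := f' (u (r p)).
have gE : g \o f = f' \o u.
  by apply/funext => x; rewrite /g /=; case: (fib x (r (f x))) => [|->|->] //; rewrite us fsg'.
have gfm : dmor (g \o f) by rewrite gE; exact: dmor_comp (smor_dmor um) fm'.
have gm := descent_dmor Xp Kp fm fbd fnd fsec fsurj gfm.
exists g => //; split; first exact/(dmor_dianalytic _ Kp Lp).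
have [_ _ _ _ [_ [e1 f1]]] := fo; have [_ _ _ _ [_ [e2 f2]]] := fo'.
have E : sym_free X = sym_free Y by apply: double_inj; rewrite -!addnn.
exists (etrans e1 (etrans E (esym e2))) => i.
set i2 := cast_ord _ i.
have [q1 p1] := f1 i; have [q2 p2] := f2 i2.
set q := sym_free_pt _ in q1 p1; set q' := sym_free_pt _ in q2 p2.
have uq : u q = q' by rewrite /q ue /q'; congr sym_free_pt; exact: val_inj.
have gi : g (klein_pt i) = klein_pt i2 by rewrite -q1 -q2 -uq; have := congr1 (@^~ q) gE.
split=> //.
have [fc _ _ _] := fm; have [fc' _ fb' _] := fm'; have [gc _ _ _] := gm; have [uc un ub us'] := um.
have o1 := local_orientation_sub (klein_orP i).
have o2 := local_orientation_sub (klein_orP i2); rewrite -gi in o2.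
apply/(preserves_orientation_signed_at Kp Lp gc o1 o2) => psi chi o_psi o_chi.
have [a1 d1] := o1 _ o_psi; have [a2 d2] := o2 _ o_chi.
have [phi aphi dphi] := ps_cov Xp q; have [phi' aphi' dphi'] := ps_cov Yp q'.
have [_ d1q A1] := (analytic_near_signed_at (psC Xp aphi) (ch_open (psC Kp a1)) fc q).1 (p1 _ _ (conj aphi dphi) o_psi).
have [_ d2q A3] := (analytic_near_signed_at (psC Yp aphi') (ch_open (psC Lp a2)) fc' q').1 (p2 _ _ (conj aphi' dphi') o_chi).
rewrite -uq in dphi' d2q A3.
have A4 := signed_at_comp Xp Yp Lp uc un ub fc' fb' aphi aphi' a2 dphi dphi' d2q (us' _ _ _ aphi aphi' dphi dphi') A3.
rewrite -gE in A4; rewrite -q1 in d2 *.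
exact: (signed_at_descent Xp Kp fm fbd fnd fsec gfm aphi dphi a1 d1q a2 d2 A1 A4).
Qed.

End Klein.

Theorem proposition5p3p11 (R : realType) :
  is_category (dnKlein R) /\ is_category (dnSymRiem R) /\
  (exists (F : functor (dnKlein R) (dnSymRiem R))
          (f : forall K : dnKlein R, under (F K) -> under K),
     orienting_double_functor f) /\
  (forall (F : functor (dnKlein R) (dnSymRiem R))
          (f : forall K : dnKlein R, under (F K) -> under K),
     orienting_double_functor f -> is_equivalence F).
Proof.
have KC := dnKlein_category R; have SC := dnSymRiem_category R.
split=> //; split=> //; split.
- pose eX (K : dnKlein R) := cid (double_ex K).
  pose F0 (K : dnKlein R) : dnSymRiem R := projT1 (eX K).
  pose ef K := cid (projT2 (eX K)).
  pose f (K : dnKlein R) : under (F0 K) -> under K := projT1 (ef K).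
  have fo (K : klein_obj R) : orienting_double (f K) := projT2 (ef K).
  have lift (A B : dnKlein R) (g : mor A B) : exists u : mor (F0 A) (F0 B), f B \o fn u = fn g \o f A.
    have [u uh uE] := lift_hom (fo A) (fo B) (svalP g).
    by exists (exist _ u uh).
  pose el A B g := cid (lift A B g).
  pose F1 (A B : dnKlein R) (g : mor A B) : mor (F0 A) (F0 B) := projT1 (el A B g).
  have F1E A B g : f B \o fn (F1 A B g) = fn g \o f A := projT2 (el A B g).
  (* Both functor laws follow from the uniqueness of lifts. *)
  have Fid A (i : mor A A) : fn i = idfun -> fn (F1 A A i) = idfun.
    move=> iE; apply: (lift_hom_uniq (fo A) (svalP (F1 A A i)) (symriem_hom_id _)).
    by have := F1E A A i; rewrite iE.
  have Fcomp A B H (g : mor A B) (h : mor B H) (k : mor A H) :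
      fn k = fn h \o fn g -> fn (F1 A H k) = fn (F1 B H h) \o fn (F1 A B g).
    move=> kE; apply: (lift_hom_uniq (fo H) (svalP (F1 A H k))).
      exact: symriem_hom_comp (svalP (F1 A B g)) (svalP (F1 B H h)).
    have F1x A' B' (u : mor A' B') x : f B' (fn (F1 A' B' u) x) = fn u (f A' x) :=
      congr1 (@^~ x) (F1E A' B' u).
    by apply/funext => x; rewrite /= [LHS]F1x kE /= F1x F1x.
  by exists (Functor Fid Fcomp), f; split.
move=> F f [fo fE].
have fs (K : dnKlein R) : forall y, exists x, f K x = y.
  by have [] := orienting_double_is_double (fo K).
apply: equivalence_intro => //.
(* Faithfulness: the covering maps are surjective. *)
- move=> A B g h gh; apply/funext => p; have [x <-] := fs A p.
  have := fE _ _ g; rewrite gh fE => /(congr1 (@^~ x)).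
  by [].
(* Fullness: [u] descends to some [g], and then [u] and the image of [g] lift the same map. *)
- move=> A B u; have [g gh gE] := descent_hom (fo A) (fo B) (svalP u).
  exists (exist _ g gh); apply: (lift_hom_uniq (fo B) (svalP _) (svalP u)).
  by rewrite -/(fn _) fE -gE.
(* Essential surjectivity: [X] and [F K] are both orienting doubles of the quotient [K]. The
   identity of [K] lifts in both directions, and by uniqueness the two lifts are mutually
   inverse. *)
move=> X; have [K [q qo]] := quotient_double X.
have [i ih iE] := lift_hom (fo K) qo (klein_hom_id K).
have [j jh jE] := lift_hom qo (fo K) (klein_hom_id K).
exists K, (exist _ i ih), (exist _ j jh); split.
  apply: (lift_hom_uniq (fo K) (symriem_hom_comp ih jh) (symriem_hom_id _)).
  by rewrite compA /fn /= jE.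
apply: (lift_hom_uniq qo (symriem_hom_comp jh ih) (symriem_hom_id _)).
by rewrite compA /fn /= iE.
Qed.
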